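(* Let $p,q$ be primes and let $\Delta_p,\Delta_q$ be the Bruhat–Tits buildings of $\mathrm{PGL}_3(\mathbb{Q}_p)$ and $\mathrm{PGL}_3(\mathbb{Q}_q)$, with one-skeletons $\Delta_p^{(1)},\Delta_q^{(1)}$. Let $\Gamma<\mathrm{PGL}_3(\mathbb{Q}_p)\times \mathrm{PGL}_3(\mathbb{Q}_q)$ be an irreducible lattice that acts transitively on the vertices and freely on the geometric cells of the square complex $Y=\Delta_p^{(1)}\times\Delta_q^{(1)}$. Then $\Sigma=\Gamma\backslash Y$ is a VH-T-complex with one vertex, and $G(A^{T}(\Sigma))$ is isomorphic to the stabilizer $\Gamma_{O_p}$ in $\Gamma$ of a vertex $O_p$ of $\Delta_p$, which is a lattice in $\mathrm{PGL}_3(\mathbb{Q}_q)$. In particular $G(A^{T}(\Sigma))$ has Kazhdan's property (T).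
   Context: **Automata.** A finite synchronous automaton $A=\langle X,Q,\pi,\lambda\rangle$ consists of finite sets $X$ (alphabet) and $Q$ (states), a transition function $\pi:X\times Q\to Q$ and an output function $\lambda:X\times Q\to X$ (also written $\pi(q,x),\lambda(q,x)$). For $q\in Q$ the map $\mathfrak{T}(A,q):X^*\to X^*$ on the free monoid $X^*$ is defined by $\mathfrak{T}(A,q)(\emptyset)=\emptyset$ and $\mathfrak{T}(A,q)(xw)=\lambda(x,q)\,\mathfrak{T}(A,\pi(x,q))(w)$. If all these maps are bijective, $G(A)$ is the group of bijections of $X^*$ generated by $\{\mathfrak{T}(A,q)\}_{q\in Q}$. **Square complexes.** A square complex is built from a graph (with directed edges $e$, inverse edges $\overline{e}\neq e$) by attaching squares along closed paths of length four; each geometric square carries eight distinct directed squares permuted freely by the dihedral group of order 8. It is a VH-complex if its edges are partitioned into vertical and horizontal ones so that every vertex link is a bipartite graph with bipartition (horizontal, vertical). It is a VH-T-complex if moreover every vertex link is a complete bipartite graph. **The automaton $A^{T}(\Sigma)$.** Let $\Sigma$ be a finite VH-T-complex with one vertex. $A^{T}(\Sigma)=\langle X,Q,\pi,\lambda\rangle$ has $X$ = the set of directed horizontal edges, $Q$ = the set of directed vertical edges; for $x\in X,q\in Q$ there is a unique square incident to $x$ and $q$ near their origins, and in this square $\lambda(q,x)$ is the (directed) edge opposite to $x$ and $\pi(q,x)$ the (directed) edge opposite to $q$, directed parallel to $x$ and $q$ respectively. **Conventions.** In $\Sigma=\Gamma\backslash Y$, edges coming from $\Delta_p^{(1)}$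 are horizontal and edges coming from $\Delta_q^{(1)}$ are vertical. ''Acts freely on the geometric cells'' means that no nontrivial element of $\Gamma$ maps a (non-oriented) vertex, edge or square of $Y$ to itself. $\Gamma_{O_p}$ is the stabilizer of $O_p$ for the action of $\Gamma$ on $\Delta_p$ through the first factor; it is regarded as a subgroup of $\mathrm{PGL}_3(\mathbb{Q}_q)$ via projection to the second factor. *)

(* Defs.v *)
From HB Require Import structures.
From mathcomp Require Import all_boot all_order all_algebra.
From mathcomp Require Import all_classical all_reals all_analysis.
From mathcomp Require Import complex.
From mathcomp Require sesquilinear.

Set Implicit Arguments.
Unset Strict Implicit.
Unset Printing Implicit Defensive.
Import Order.TTheory GRing.Theory Num.Theory.

Local Open Scope classical_set_scope.
Local Open Scope quotient_scope.
Local Open Scope ring_scope.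

(* The inverse limit of the rings Z / p ^ n Z; x n is the representative in
   [0, p ^ n) of the n-th component. *)
Record padic_int (p : nat) (p_pr : prime p) := PadicInt {
  padic_res :> nat -> int;
  _ : `[< forall n, (padic_res n.+1 %% (p ^ n)%N)%Z = padic_res n >] }.

Section PadicInt.
Variables (p : nat) (p_pr : prime p).
Local Notation Zp := (padic_int p_pr).
Implicit Types x y z : Zp.

HB.instance Definition _ := [isSub for @padic_res p p_pr].
HB.instance Definition _ := [Choice of Zp by <:].

Lemma padicP x n : (x n.+1 %% (p ^ n)%N)%Z = x n.
Proof. by case: x => x /= /asboolP. Qed.

Lemma padic_mod x n : (x n %% (p ^ n)%N)%Z = x n.
Proof. by rewrite -(padicP x n) modz_mod. Qed.

Lemma padic_eqP x y : (forall n, x n = y n) -> x = y.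
Proof. by move=> xy; apply/val_inj/funext. Qed.

Lemma modz_exp (a : int) (n m : nat) :
  ((a %% (p ^ (n + m))%N)%Z %% (p ^ n)%N)%Z = (a %% (p ^ n)%N)%Z.
Proof.
rewrite [in RHS](divz_eq a (p ^ (n + m))%N) expnD PoszM.
by rewrite [X in X + _]mulrA mulrAC modzMDl.
Qed.

Definition padic_coherent (f : nat -> int) :=
  forall n, (f n.+1 %% (p ^ n)%N)%Z = (f n %% (p ^ n)%N)%Z.

Lemma padic_coherentP (f : nat -> int) : padic_coherent f ->
  forall n, ((f n.+1 %% (p ^ n.+1)%N)%Z %% (p ^ n)%N)%Z = (f n %% (p ^ n)%N)%Z.
Proof.
by move=> fP n; rewrite -addn1 modz_exp addn1.
Qed.

Definition padic_of (f : nat -> int) (fP : padic_coherent f) : Zp :=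
  @PadicInt p p_pr (fun n => (f n %% (p ^ n)%N)%Z) (asboolT (padic_coherentP fP)).

Fact padic_add_subproof x y : padic_coherent (fun n => x n + y n).
Proof. by move=> n; rewrite -modzDm !padicP. Qed.
Fact padic_opp_subproof x : padic_coherent (fun n => - x n).
Proof. by move=> n; rewrite -modzNm padicP. Qed.
Fact padic_mul_subproof x y : padic_coherent (fun n => x n * y n).
Proof. by move=> n; rewrite -modzMm !padicP. Qed.

Definition padic_cst (a : int) : Zp :=
  @padic_of (fun=> a) (fun _ => erefl).
Definition padic_add x y := padic_of (padic_add_subproof x y).
Definition padic_opp x := padic_of (padic_opp_subproof x).
Definition padic_mul x y := padic_of (padic_mul_subproof x y).

Fact padic_addA : associative padic_add.
Proof. by move=> x y z; apply: padic_eqP => n /=; rewrite modzDml modzDmr addrA. Qed.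
Fact padic_addC : commutative padic_add.
Proof. by move=> x y; apply: padic_eqP => n /=; rewrite addrC. Qed.
Fact padic_add0 : left_id (padic_cst 0) padic_add.
Proof. by move=> x; apply: padic_eqP => n /=; rewrite mod0z add0r padic_mod. Qed.
Fact padic_addN : left_inverse (padic_cst 0) padic_opp padic_add.
Proof. by move=> x; apply: padic_eqP => n /=; rewrite modzDml addNr. Qed.
HB.instance Definition _ :=
  GRing.isZmodule.Build Zp padic_addA padic_addC padic_add0 padic_addN.

Fact padic_mulA : associative padic_mul.
Proof. by move=> x y z; apply: padic_eqP => n /=; rewrite modzMml modzMmr mulrA. Qed.
Fact padic_mulC : commutative padic_mul.
Proof. by move=> x y; apply: padic_eqP => n /=; rewrite mulrC. Qed.
Fact padic_mul1 : left_id (padic_cst 1) padic_mul.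
Proof. by move=> x; apply: padic_eqP => n /=; rewrite modzMml mul1r padic_mod. Qed.
Fact padic_mulDl : left_distributive padic_mul padic_add.
Proof.
by move=> x y z; apply: padic_eqP => n /=; rewrite modzMml modzDml modzDmr mulrDl.
Qed.
Fact padic_oner_neq0 : padic_cst 1 != 0.
Proof.
apply/eqP => /(congr1 (fun x : Zp => x 1%N)) /=.
rewrite expn1 mod0z modz_small//=.
by rewrite ltz_nat prime_gt1.
Qed.
HB.instance Definition _ := GRing.Zmodule_isComNzRing.Build Zp
  padic_mulA padic_mulC padic_mul1 padic_mulDl padic_oner_neq0.

(* The library asks for an explicit inverse; units and inverses are classical. *)
Definition padic_unit : {pred Zp} := [pred x | `[< exists y, y * x = 1 >]].
Definition padic_inv x : Zp :=
  if pselect (exists y, y * x = 1) is left e then sval (cid e) else x.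

Fact padic_mulVx : {in padic_unit, left_inverse 1 padic_inv *%R}.
Proof.
move=> x /asboolP ex; rewrite /padic_inv.
by case: pselect => [e|/(_ ex)//]; exact: svalP (cid e).
Qed.
Fact padic_unitPl x y : y * x = 1 -> padic_unit x.
Proof. by move=> yx; apply/asboolP; exists y. Qed.
Fact padic_inv_out : {in [predC padic_unit], padic_inv =1 id}.
Proof.
move=> x /asboolPn ex; rewrite /padic_inv.
by case: pselect.
Qed.
HB.instance Definition _ := GRing.ComNzRing_hasMulInverse.Build Zp
  padic_mulVx padic_unitPl padic_inv_out.

Lemma padic_modm x m n : (x (n + m)%N %% (p ^ n)%N)%Z = x n.
Proof.
elim: m => [|m IH]; first by rewrite addn0 padic_mod.
by rewrite -[RHS]IH addnS -(padicP x (n + m)) modz_exp.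
Qed.

Lemma padic_neq0 x : x != 0 -> exists n, x n != 0.
Proof.
move=> x0; apply: contrapT => /forallNP xn; move/eqP: x0; apply.
by apply: padic_eqP => n /=; rewrite mod0z; apply/eqP; apply: contrapT => /negP/xn.
Qed.

Fact padic_mulf_eq0 x y : x * y = 0 -> (x == 0) || (y == 0).
Proof.
move=> xy0; apply/norP => -[/padic_neq0[m xm] /padic_neq0[n yn]].
have dvdE (z : Zp) (k l : nat) : (z k == 0) = (p ^ k %| `|z (k + l)%N|)%N.
  by rewrite -(padic_modm z l k); apply: (sameP eqP); exact: dvdz_mod0P.
have := congr1 (fun z : Zp => z (m + n)%N) xy0 => /=; rewrite mod0z.
have {}xm : ~~ (p ^ m %| `|x (m + n)%N|)%N.
  by rewrite -dvdE.
have {}yn : ~~ (p ^ n %| `|y (m + n)%N|)%N.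
  by rewrite addnC -dvdE.
move=> /dvdz_mod0P; rewrite dvdzE abszM /=.
move: xm yn; set a := `|_|%N; set b := `|_|%N => am bn.
have a0 : (0 < a)%N by case: a am => //; rewrite dvdn0.
have b0 : (0 < b)%N by case: b bn => //; rewrite dvdn0.
rewrite pfactor_dvdn ?muln_gt0 ?a0 ?b0//.
move: am bn; rewrite !pfactor_dvdn// -!ltnNge => am bn.
by rewrite lognM// leqNgt (ltn_trans (_ : _ < m + logn p b)%N)
  ?ltn_add2r ?ltn_add2l.
Qed.
HB.instance Definition _ :=
  GRing.ComUnitRing_isIntegral.Build Zp padic_mulf_eq0.

Definition padic := {fraction Zp}.
HB.instance Definition _ := GRing.Field.on padic.

Definition padic_incl : Zp -> padic := @tofrac Zp.

(* The balls v + p ^ n Z_p form a basis of the topology. *)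
Definition padic_open (U : set padic) : Prop :=
  forall v, U v -> exists n, forall z : Zp, U (v + (p ^ n)%:R * padic_incl z).

Fact padic_openT : padic_open setT. Proof. by move=> x _; exists 0%N. Qed.
Fact padic_openI : setI_closed padic_open.
Proof.
move=> U V oU oV x [/oU[m Um] /oV[n Vn]]; exists (m + n)%N => z.
split.
- have := Um ((p ^ n)%:R * z).
  by rewrite /padic_incl rmorphM rmorph_nat/= mulrA -natrM -expnD.
- have := Vn ((p ^ m)%:R * z).
  by rewrite /padic_incl rmorphM rmorph_nat/= mulrA -natrM -expnD addnC.
Qed.
Fact padic_open_bigU (I : Type) (f : I -> set padic) :
  (forall i, padic_open (f i)) -> padic_open (\bigcup_i f i).
Proof.
move=> fo x [i _ /fo[n fn]]; exists n => z; by exists i.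
Qed.
HB.instance Definition _ := isOpenTopological.Build padic
  padic_openT padic_openI padic_open_bigU.

End PadicInt.

(* The two join structures below record no continuity of the operations: their
   instances are the fields of p-adic numbers, the groups PGL3 over them and
   products of these, whose operations are continuous. *)
#[short(type="groupTopologicalType")]
HB.structure Definition GroupTopological := {G of Group G & Topological G}.

HB.instance Definition _ (G H : groupTopologicalType) :=
  Topological.on (G * H)%type.

#[short(type="fieldTopologicalType")]
HB.structure Definition FieldTopological :=
  {K of GRing.Field K & Topological K}.
HB.instance Definition _ (p : nat) (p_pr : prime p) := GRing.Field.on (padic p_pr).

Section PGL3.
Variable K : fieldTopologicalType.

Record GL3 := MkGL3 { GL3_mx :> 'M[K]_3; _ : GL3_mx \in unitmx }.
HB.instance Definition _ := [isSub for GL3_mx].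
HB.instance Definition _ := [Choice of GL3 by <:].

Lemma GL3_unit (g : GL3) : (g : 'M[_]_3) \in unitmx. Proof. by case: g. Qed.

Fact GL3_one_subproof : (1%:M : 'M[K]_3) \in unitmx.
Proof. exact: unitmx1. Qed.
Fact GL3_mul_subproof (g h : GL3) : (g *m h : 'M[K]_3) \in unitmx.
Proof. by rewrite unitmx_mul !GL3_unit. Qed.
Fact GL3_inv_subproof (g : GL3) : invmx g \in unitmx.
Proof. by rewrite unitmx_inv GL3_unit. Qed.

Definition GL3_one := MkGL3 GL3_one_subproof.
Definition GL3_mul g h := MkGL3 (GL3_mul_subproof g h).
Definition GL3_inv g := MkGL3 (GL3_inv_subproof g).

Fact GL3_mulA : associative GL3_mul.
Proof. by move=> x y z; apply/val_inj/mulmxA. Qed.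
Fact GL3_mul1 : left_id GL3_one GL3_mul.
Proof. by move=> x; apply/val_inj/mul1mx. Qed.
Fact GL3_mulr1 : right_id GL3_one GL3_mul.
Proof. by move=> x; apply/val_inj/mulmx1. Qed.
Fact GL3_mulV : left_inverse GL3_one GL3_inv GL3_mul.
Proof. by move=> x; apply/val_inj/mulVmx/GL3_unit. Qed.
Fact GL3_mulrV : right_inverse GL3_one GL3_inv GL3_mul.
Proof. by move=> x; apply/val_inj/mulmxV/GL3_unit. Qed.
HB.instance Definition _ := isGroup.Build GL3
  GL3_mulA GL3_mul1 GL3_mulr1 GL3_mulV GL3_mulrV.
HB.instance Definition _ := Topological.copy GL3 (initial_topology GL3_mx).

Definition proportional : rel GL3 :=
  fun g h => `[< exists2 c : K, c != 0 & (g : 'M[_]_3) = c *: (h : 'M[_]_3) >].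

Fact proportional_refl : reflexive proportional.
Proof. by move=> g; apply/asboolP; exists 1; rewrite ?oner_neq0 ?scale1r. Qed.
Fact proportional_sym : symmetric proportional.
Proof.
suff H g h : proportional g h -> proportional h g by move=> g h; apply/idP/idP=> /H.
move=> /asboolP[c c0 gh]; apply/asboolP; exists c^-1; rewrite ?invr_neq0//.
by rewrite gh scalerA mulVf// scale1r.
Qed.
Fact proportional_trans : transitive proportional.
Proof.
move=> h g k /asboolP[c c0 gh] /asboolP[d d0 hk]; apply/asboolP.
by exists (c * d); rewrite ?mulf_neq0// gh hk scalerA.
Qed.
Canonical proportional_equiv :=
  EquivRel proportional proportional_refl proportional_sym proportional_trans.

(* Subspace topology of 'M[K]_3 on GL3 (inversion is continuous for it), then
   quotient topology on PGL3. *)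
Definition PGL3 := quotient_topology {eq_quot proportional}.
HB.instance Definition _ := Topological.on PGL3.
HB.instance Definition _ := Quotient.on PGL3.

Lemma PGL3_eqP (g h : GL3) : \pi_PGL3 g = \pi_PGL3 h <->
  exists2 c : K, c != 0 & (g : 'M[_]_3) = c *: (h : 'M[_]_3).
Proof.
split=> [/eqmodP/asboolP//|gh]; exact/eqmodP/asboolP.
Qed.

Lemma PGL3_reprP (g : GL3) :
  exists2 c : K, c != 0 & (repr (\pi_PGL3 g) : 'M[_]_3) = c *: (g : 'M[_]_3).
Proof. by apply/PGL3_eqP; rewrite reprK. Qed.

Definition PGL3_one : PGL3 := \pi_PGL3 1%g.
Definition PGL3_mul (x y : PGL3) : PGL3 := \pi_PGL3 (repr x * repr y)%g.
Definition PGL3_inv (x : PGL3) : PGL3 := \pi_PGL3 (repr x)^-1%g.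

Lemma PGL3_piM (g h : GL3) : PGL3_mul (\pi_PGL3 g) (\pi_PGL3 h) = \pi_PGL3 (g * h)%g.
Proof.
apply/PGL3_eqP; have [c c0 gE] := PGL3_reprP g; have [d d0 hE] := PGL3_reprP h.
by exists (c * d); rewrite ?mulf_neq0//= gE hE -scalemxAl -scalemxAr scalerA.
Qed.
Lemma PGL3_piV (g : GL3) : PGL3_inv (\pi_PGL3 g) = \pi_PGL3 g^-1%g.
Proof.
apply/PGL3_eqP; have [c c0 gE] := PGL3_reprP g; exists c^-1; rewrite ?invr_neq0//=.
by rewrite gE invmxZ// -gE GL3_unit.
Qed.

Fact PGL3_mulA : associative PGL3_mul.
Proof.
elim/quotW=> x; elim/quotW=> y; elim/quotW=> z. 
by rewrite (PGL3_piM y z) (PGL3_piM x y) (PGL3_piM x (y * z)%g) (PGL3_piM (x * y)%g z) mulgA.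
Qed.
Fact PGL3_mul1 : left_id PGL3_one PGL3_mul.
Proof. by elim/quotW=> x; rewrite (PGL3_piM 1%g x) mul1g. Qed.
Fact PGL3_mulr1 : right_id PGL3_one PGL3_mul.
Proof. by elim/quotW=> x; rewrite (PGL3_piM x 1%g) mulg1. Qed.
Fact PGL3_mulV : left_inverse PGL3_one PGL3_inv PGL3_mul.
Proof. by elim/quotW=> x; rewrite (PGL3_piV x) (PGL3_piM x^-1%g x) mulVg. Qed.
Fact PGL3_mulrV : right_inverse PGL3_one PGL3_inv PGL3_mul.
Proof. by elim/quotW=> x; rewrite (PGL3_piV x) (PGL3_piM x x^-1%g) mulgV. Qed.
HB.instance Definition _ := isGroup.Build PGL3
  PGL3_mulA PGL3_mul1 PGL3_mulr1 PGL3_mulV PGL3_mulrV.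

End PGL3.

Record subgroup (G : groupType) := Subgroup {
  subgroup_set :> set G;
  subgroup1 : subgroup_set 1%g;
  subgroupM : forall x y, subgroup_set x -> subgroup_set y -> subgroup_set (x * y)%g;
  subgroupV : forall x, subgroup_set x -> subgroup_set x^-1%g }.

Section SubgroupType.
Variables (G : groupType) (H : subgroup G).

Definition subgroup_type := set_type H.
HB.instance Definition _ := SubChoice.on subgroup_type.

Fact subgroup_closed_subproof : group_closed (mem (H : set G)).
Proof.
split=> [|x y]; first exact/mem_set/subgroup1.
move=> /set_mem Hx /set_mem Hy; apply/mem_set.
exact/subgroupM/subgroupV.
Qed.
HB.instance Definition _ :=
  SubChoice_isSubGroup.Build G (mem (H : set G)) subgroup_type
    subgroup_closed_subproof.

End SubgroupType.

Definition isomorphic (G H : groupType) :=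
  exists f : {multiplicative G -> H}, bijective f.

Section SubgroupConstructions.
Variables G1 G2 : groupType.

Program Definition generated_subgroup (G : groupType) (S : set G) : subgroup G :=
  @Subgroup G [set x | forall H : subgroup G, S `<=` H -> (H : set G) x] _ _ _.
Next Obligation. by move=> G S H _; exact: subgroup1. Qed.
Next Obligation.
by move=> G S x y Hx Hy H SH; apply: subgroupM; [exact: Hx|exact: Hy].
Qed.
Next Obligation. by move=> G S x Hx H SH; apply: subgroupV; exact: Hx. Qed.

Program Definition prod_subgroup (H1 : subgroup G1) (H2 : subgroup G2) :
    subgroup (G1 * G2)%type :=
  @Subgroup (G1 * G2)%type (H1 `*` H2) _ _ _.
Next Obligation. by move=> H1 H2; split; exact: subgroup1. Qed.
Next Obligation.
by move=> H1 H2 x y [? ?] [? ?]; split; exact: subgroupM.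
Qed.
Next Obligation. by move=> H1 H2 x [? ?]; split; exact: subgroupV. Qed.

Program Definition snd_subgroup (H : subgroup (G1 * G2)%type) : subgroup G2 :=
  @Subgroup G2 (snd @` H) _ _ _.
Next Obligation. by move=> H; exists 1%g => //; exact: subgroup1. Qed.
Next Obligation.
by move=> H _ _ [x Hx <-] [y Hy <-]; exists (x * y)%g => //; exact: subgroupM.
Qed.
Next Obligation.
by move=> H _ [x Hx <-]; exists x^-1%g => //; exact: subgroupV.
Qed.

End SubgroupConstructions.

Section CosetSpace.
Variables (G : groupTopologicalType) (H : subgroup G).

Definition coset_rel : rel G := fun x y => `[< (H : set G) (x^-1 * y)%g >].

Fact coset_rel_refl : reflexive coset_rel.
Proof. by move=> x; apply/asboolP; rewrite mulVg; exact: subgroup1. Qed.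
Fact coset_rel_sym : symmetric coset_rel.
Proof.
suff S x y : coset_rel x y -> coset_rel y x by move=> x y; apply/idP/idP=> /S.
by move=> /asboolP/subgroupV Hxy; apply/asboolP; rewrite invgM invgK in Hxy.
Qed.
Fact coset_rel_trans : transitive coset_rel.
Proof.
move=> y x z /asboolP Hxy /asboolP Hyz; apply/asboolP.
by have := subgroupM Hxy Hyz; rewrite mulgA mulgK.
Qed.
Canonical coset_rel_equiv :=
  EquivRel coset_rel coset_rel_refl coset_rel_sym coset_rel_trans.

Definition coset_space := quotient_topology {eq_quot coset_rel}.
HB.instance Definition _ := Topological.on coset_space.
HB.instance Definition _ := Quotient.on coset_space.
HB.instance Definition _ := isPointed.Build coset_space (\pi_coset_space 1%g).

Definition coset_act (g : G) (x : coset_space) : coset_space :=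
  \pi_coset_space (g * repr x)%g.

Definition discrete_subgroup :=
  exists2 U : set G, open U & U `&` H = [set 1%g].

Definition borel_coset_space := g_sigma_algebraType (@open coset_space).

End CosetSpace.

(* A discrete subgroup H such that G / H carries a nonzero finite G-invariant
   Borel measure. *)
Definition is_lattice (R : realType) (G : groupTopologicalType)
    (H : subgroup G) :=
  discrete_subgroup H /\
  exists mu : {measure set (borel_coset_space H) -> \bar R},
    [/\ (0 < mu setT)%E, (mu setT < +oo)%E &
      forall (g : G) (A : set (borel_coset_space H)),
        measurable A -> mu (coset_act g @^-1` A) = mu A].

Definition finite_index (G : groupType) (H K : set G) :=
  exists s : seq G, forall x, K x -> exists2 g, g \in s & H (g^-1 * x)%g.

Definition commensurable (G : groupType) (H K : subgroup G) :=
  finite_index (H `&` K) H /\ finite_index (H `&` K) K.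

(* H is reducible when it is commensurable with a product of lattices of the
   two factors. *)
Definition irreducible_lattice (R : realType) (G1 G2 : groupTopologicalType)
    (H : subgroup (G1 * G2)%type) :=
  @is_lattice R (G1 * G2)%type H /\
  ~ exists (H1 : subgroup G1) (H2 : subgroup G2),
      [/\ is_lattice R H1, is_lattice R H2 & commensurable H (prod_subgroup H1 H2)].

Import sesquilinear.

Definition hilbert_complete (R : realType) (V : lmodType R[i])
    (dot : {dot V for Num.conj}) :=
  forall u : nat -> V,
    (forall e : R[i], 0 < e ->
      exists N : nat, forall m n : nat, (N <= m)%N -> (N <= n)%N ->
        dot (u m - u n) (u m - u n) < e) ->
    exists l : V, forall e : R[i], 0 < e ->
      exists N : nat, forall n : nat, (N <= n)%N -> dot (u n - l) (u n - l) < e.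

Record unitary_rep (R : realType) (G : groupType) (V : lmodType R[i])
    (dot : {dot V for Num.conj}) := UnitaryRep {
  rep :> G -> {linear V -> V};
  rep1 : rep 1%g =1 id;
  repM : forall g h v, rep (g * h)%g v = rep g (rep h v);
  rep_dot : forall g u v, dot (rep g u) (rep g v) = dot u v }.

(* Kazhdan's property (T) of G as a discrete group, whose compact subsets are
   finite; s is the Kazhdan set and e the Kazhdan constant. Norms are squared,
   and dot takes its values in R[i], where 0 < z implies that z is real. *)
Definition property_T (R : realType) (G : groupType) :=
  exists (s : seq G) (e : R), 0 < e /\
    forall (V : lmodType R[i]) (dot : {dot V for Num.conj}),
      hilbert_complete dot -> forall rho : unitary_rep G dot,
        (exists2 v : V, v != 0 & forall g, g \in s ->
            dot (rho g v - v) (rho g v - v) < (e ^+ 2)%:C%C * dot v v) ->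
        exists2 w : V, w != 0 & forall g, rho g w = w.

Record action (G : groupType) (T : choiceType) := Action {
  act :> G -> T -> T;
  act1 : forall x, act 1%g x = x;
  actM : forall g h x, act (g * h)%g x = act g (act h x) }.

Section OrbitSpace.
Variables (G : groupType) (H : subgroup G) (T : choiceType) (a : action G T).

Definition orbit_rel : rel T := fun x y => `[< exists2 g, (H : set G) g & y = a g x >].

Fact orbit_rel_refl : reflexive orbit_rel.
Proof. by move=> x; apply/asboolP; exists 1%g; [exact: subgroup1|rewrite act1]. Qed.
Fact orbit_rel_sym : symmetric orbit_rel.
Proof.
suff S x y : orbit_rel x y -> orbit_rel y x by move=> x y; apply/idP/idP=> /S.
move=> /asboolP[g Hg ->]; apply/asboolP; exists g^-1%g; first exact: subgroupV.
by rewrite -actM mulVg act1.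
Qed.
Fact orbit_rel_trans : transitive orbit_rel.
Proof.
move=> y x z /asboolP[g Hg ->] /asboolP[h Hh ->]; apply/asboolP.
by exists (h * g)%g; [exact: subgroupM|rewrite actM].
Qed.
Canonical orbit_rel_equiv :=
  EquivRel orbit_rel orbit_rel_refl orbit_rel_sym orbit_rel_trans.

Definition orbit_space := {eq_quot orbit_rel}.
HB.instance Definition _ := Choice.on orbit_space.
HB.instance Definition _ := Quotient.on orbit_space.

Program Definition stabilizer (x : T) : subgroup G :=
  @Subgroup G [set g | (H : set G) g /\ a g x = x] _ _ _.
Next Obligation. by move=> x; split; [exact: subgroup1|exact: act1]. Qed.
Next Obligation.
move=> x g h [Hg gx] [Hh hx]; split; first exact: subgroupM.
by rewrite actM hx gx.
Qed.
Next Obligation.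
move=> x g [Hg gx]; split; first exact: subgroupV.
by rewrite -{1}gx -actM mulVg act1.
Qed.

End OrbitSpace.

Section ActionConstructions.
Variables (G1 G2 : groupType) (T1 T2 : choiceType).
Variables (a1 : action G1 T1) (a2 : action G2 T2).

Program Definition fst_action : action (G1 * G2)%type T1 :=
  @Action (G1 * G2)%type T1 (fun g => a1 g.1) _ _.
Next Obligation. exact: act1. Qed.
Next Obligation. by move=> *; exact: actM. Qed.

Program Definition prod_action : action (G1 * G2)%type (T1 * T2)%type :=
  @Action (G1 * G2)%type (T1 * T2)%type (fun g x => (a1 g.1 x.1, a2 g.2 x.2)) _ _.
Next Obligation. by move=> [x y]/=; rewrite !act1. Qed.
Next Obligation. by move=> g h [x y]/=; rewrite !actM. Qed.

End ActionConstructions.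

Program Definition sum_action (G : groupType) (T1 T2 : choiceType)
    (a1 : action G T1) (a2 : action G T2) : action G (T1 + T2)%type :=
  @Action G (T1 + T2)%type
    (fun g x => match x with inl y => inl (a1 g y) | inr y => inr (a2 g y) end) _ _.
Next Obligation. by move=> G T1 T2 a1 a2 [x|x]/=; rewrite act1. Qed.
Next Obligation. by move=> G T1 T2 a1 a2 g h [x|x]/=; rewrite actM. Qed.

Program Definition tag_action (G : groupType) (T : choiceType) (B : choiceType)
    (a : action G T) : action G (T * B)%type :=
  @Action G (T * B)%type (fun g x => (a g x.1, x.2)) _ _.
Next Obligation. by move=> G T B a [x b]/=; rewrite act1. Qed.
Next Obligation. by move=> G T B a g h [x b]/=; rewrite actM. Qed.

(* A directed edge e goes from gorg e to gorg (ginv e). *)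
Record graph := Graph {
  gV : choiceType;
  gE : choiceType;
  gorg : gE -> gV;
  ginv : gE -> gE }.

Record graph_action (G : groupType) (X : graph) := GraphAction {
  gactV : action G (gV X);
  gactE : action G (gE X);
  gact_org : forall g e, gorg (gactE g e) = gactV g (gorg e);
  gact_inv : forall g e, ginv (gactE g e) = gactE g (ginv e) }.

(* sqE and sqS are the directed edges and the directed squares. A directed
   square s is a closed path starting with sq_side s; sq_rot s is the same cycle
   started at its second edge and sq_refl s is the reverse path, so that sq_rot
   and sq_refl generate the dihedral group of order 8. The path of s is
   sq_side s, sq_side (sq_rot s), sq_side (sq_rot (sq_rot s)), and so on. The
   edges outside sq_hor are the vertical ones. *)
Record vh_data := VHData {
  sqV : choiceType;
  sqE : choiceType;
  sqS : choiceType;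
  sq_org : sqE -> sqV;
  sq_inv : sqE -> sqE;
  sq_side : sqS -> sqE;
  sq_rot : sqS -> sqS;
  sq_refl : sqS -> sqS;
  sq_hor : set sqE }.

Definition sq_term (X : vh_data) (e : sqE X) := sq_org (sq_inv e).

Record square_complex (X : vh_data) : Prop := SquareComplex {
  invK : forall e : sqE X, sq_inv (sq_inv e) = e;
  inv_neq : forall e : sqE X, sq_inv e <> e;
  side_rot : forall s : sqS X, sq_org (sq_side (sq_rot s)) = sq_term (sq_side s);
  side_refl : forall s : sqS X, sq_side (sq_refl s) = sq_inv (sq_side (iter 3 (@sq_rot X) s));
  rot4 : forall s : sqS X, iter 4 (@sq_rot X) s = s;
  refl2 : forall s : sqS X, sq_refl (sq_refl s) = s;
  refl_rot : forall s : sqS X, sq_refl (sq_rot s) = iter 3 (@sq_rot X) (sq_refl s);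
  dihedral_free : forall (s : sqS X) (i : 'I_4) (b : bool),
    iter i (@sq_rot X) (iter b (@sq_refl X) s) = s -> i = ord0 /\ b = false }.

(* The link of a vertex v has the directed edges of origin v as vertices; a
   directed square s with sq_org (sq_side s) = v is an edge of the link, from
   sq_side s to sq_side (sq_refl s), and sq_refl s is the inverse edge. *)
Definition corner (X : vh_data) (s : sqS X) (e f : sqE X) :=
  sq_side s = e /\ sq_side (sq_refl s) = f.

Record VH_complex (X : vh_data) : Prop := VHComplex {
  VH_square_complex : square_complex X;
  VH_inv : forall e : sqE X, sq_hor (sq_inv e) <-> sq_hor e;
  VH_bipartite : forall (s : sqS X) (e f : sqE X),
    corner s e f -> (sq_hor e <-> ~ sq_hor f) }.

Record VHT_complex (X : vh_data) : Prop := VHTComplex {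
  VHT_VH : VH_complex X;
  VHT_complete : forall e f : sqE X, sq_org e = sq_org f ->
    sq_hor e -> ~ sq_hor f -> exists! s : sqS X, corner s e f }.

Record finite_VHT1_complex (X : vh_data) : Prop := FiniteVHT1Complex {
  VHT1_VHT : VHT_complex X;
  VHT1_vertex : exists v : sqV X, forall w : sqV X, w = v;
  VHT1_finE : finite_set [set: sqE X];
  VHT1_finS : finite_set [set: sqS X] }.

(* The directed square (a, b, c) starts at (gorg a, gorg b), along a if c is
   true and along b otherwise. *)
Definition graph_prod (A B : graph) : vh_data := {|
  sqV := (gV A * gV B)%type;
  sqE := (gE A * gV B + gV A * gE B)%type;
  sqS := ((gE A * gE B) * bool)%type;
  sq_org := fun e => match e with
                  | inl (a, v) => (gorg a, v)
                  | inr (u, b) => (u, gorg b)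
                  end;
  sq_inv := fun e => match e with
                  | inl (a, v) => inl (ginv a, v)
                  | inr (u, b) => inr (u, ginv b)
                  end;
  sq_side := fun s => match s with
                   | ((a, b), true) => inl (a, gorg b)
                   | ((a, b), false) => inr (gorg a, b)
                   end;
  sq_rot := fun s => match s with
                  | ((a, b), true) => ((ginv a, b), false)
                  | ((a, b), false) => ((a, ginv b), true)
                  end;
  sq_refl := fun s => (s.1, ~~ s.2);
  sq_hor := [set e | if e is inl _ then True else False] |}.

Record vh_action (G : groupType) (X : vh_data) := VHAction {
  sactV : action G (sqV X);
  sactE : action G (sqE X);
  sactS : action G (sqS X);
  sact_org : forall g e, sq_org (sactE g e) = sactV g (sq_org e);
  sact_inv : forall g e, sq_inv (sactE g e) = sactE g (sq_inv e);
  sact_side : forall g s, sq_side (sactS g s) = sactE g (sq_side s);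
  sact_rot : forall g s, sq_rot (sactS g s) = sactS g (sq_rot s);
  sact_refl : forall g s, sq_refl (sactS g s) = sactS g (sq_refl s);
  sact_hor : forall g e, sq_hor (sactE g e) <-> sq_hor e }.

Program Definition graph_prod_action (G1 G2 : groupType) (A B : graph)
    (a : graph_action G1 A) (b : graph_action G2 B) :
    vh_action (G1 * G2)%type (graph_prod A B) :=
  @VHAction (G1 * G2)%type (graph_prod A B)
    (prod_action (gactV a) (gactV b))
    (sum_action (prod_action (gactE a) (gactV b))
                (prod_action (gactV a) (gactE b)))
    (tag_action bool (prod_action (gactE a) (gactE b))) _ _ _ _ _ _.
Next Obligation. by move=> G1 G2 A B a b g [[e v]|[v e]]/=; rewrite gact_org. Qed.
Next Obligation. by move=> G1 G2 A B a b g [[e v]|[v e]]/=; rewrite gact_inv. Qed.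
Next Obligation. by move=> G1 G2 A B a b g [[e f] []]/=; rewrite gact_org. Qed.
Next Obligation. by move=> G1 G2 A B a b g [[e f] []]/=; rewrite gact_inv. Qed.
Next Obligation. by []. Qed.
Next Obligation. by move=> G1 G2 A B a b g [e|e]. Qed.

(* The structure maps are computed on representatives of the orbits; by
   equivariance they do not depend on the choice. *)
Definition quotient_vh (G : groupType) (H : subgroup G) (X : vh_data)
    (a : vh_action G X) : vh_data := {|
  sqV := orbit_space H (sactV a);
  sqE := orbit_space H (sactE a);
  sqS := orbit_space H (sactS a);
  sq_org := fun e => \pi_(orbit_space H (sactV a)) (sq_org (repr e));
  sq_inv := fun e => \pi_(orbit_space H (sactE a)) (sq_inv (repr e));
  sq_side := fun s => \pi_(orbit_space H (sactE a)) (sq_side (repr s));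
  sq_rot := fun s => \pi_(orbit_space H (sactS a)) (sq_rot (repr s));
  sq_refl := fun s => \pi_(orbit_space H (sactS a)) (sq_refl (repr s));
  sq_hor := [set e | sq_hor (repr e)] |}.

Definition vertex_transitive (G : groupType) (H : subgroup G) (X : vh_data)
    (a : vh_action G X) :=
  forall v w : sqV X, exists2 g, (H : set G) g & w = sactV a g v.

(* The directed cells over the same geometric cell are e and sq_inv e, resp. the
   dihedral orbit of s. *)
Definition free_on_cells (G : groupType) (H : subgroup G) (X : vh_data)
    (a : vh_action G X) :=
  forall g, (H : set G) g -> g <> 1%g ->
    [/\ forall v : sqV X, sactV a g v <> v,
        forall e : sqE X, sactE a g e <> e /\ sactE a g e <> sq_inv e &
        forall (s : sqS X) (i : 'I_4) (b : bool),
          sactS a g s <> iter i (@sq_rot X) (iter b (@sq_refl X) s)].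

Record automaton := Automaton {
  alphabet : Type;
  states : Type;
  alphabet_fin : finite_set [set: alphabet];
  states_fin : finite_set [set: states];
  trans : alphabet -> states -> states;
  out : alphabet -> states -> alphabet }.

Fixpoint transducer (A : automaton) (q : states A) (w : seq (alphabet A)) :=
  if w is x :: w' then out x q :: transducer (trans x q) w' else [::].

Definition bijection (T : Type) := {f : T -> T | `[< bijective f >]}.

Section Bijections.
Variable T : Type.
HB.instance Definition _ := gen_eqMixin (bijection T).
HB.instance Definition _ := gen_choiceMixin (bijection T).

Lemma bijection_bij (f : bijection T) : bijective (sval f).
Proof. by case: f => f /= /asboolP. Qed.

Lemma bijection_inj (f g : bijection T) : sval f =1 sval g -> f = g.
Proof.
case: f g => [f fP] [g gP] /= /funext fg; subst g.
by congr exist; exact: Prop_irrelevance.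
Qed.

Definition bij_one : bijection T := exist _ id (asboolT (Bijective (frefl id) (frefl id))).
Definition bij_mul (f g : bijection T) : bijection T :=
  exist _ (sval f \o sval g)
    (asboolT (bij_comp (bijection_bij f) (bijection_bij g))).

Lemma bij_inv_subproof (f : bijection T) :
  exists g : bijection T, cancel (sval f) (sval g) /\ cancel (sval g) (sval f).
Proof.
have [g fK gK] := bijection_bij f.
by exists (exist _ g (asboolT (Bijective gK fK))).
Qed.
Definition bij_inv (f : bijection T) : bijection T := sval (cid (bij_inv_subproof f)).

Fact bij_mulA : associative bij_mul.
Proof. by move=> f g h; exact: bijection_inj. Qed.
Fact bij_mul1 : left_id bij_one bij_mul.
Proof. by move=> f; exact: bijection_inj. Qed.
Fact bij_mulr1 : right_id bij_one bij_mul.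
Proof. by move=> f; exact: bijection_inj. Qed.
Fact bij_mulV : left_inverse bij_one bij_inv bij_mul.
Proof.
move=> f; apply: bijection_inj => x /=.
exact: (svalP (cid (bij_inv_subproof f))).1.
Qed.
Fact bij_mulrV : right_inverse bij_one bij_inv bij_mul.
Proof.
move=> f; apply: bijection_inj => x /=.
exact: (svalP (cid (bij_inv_subproof f))).2.
Qed.
HB.instance Definition _ := isGroup.Build (bijection T)
  bij_mulA bij_mul1 bij_mulr1 bij_mulV bij_mulrV.
End Bijections.

Definition invertible_automaton (A : automaton) :=
  forall q : states A, bijective (@transducer A q).

Definition automaton_group (A : automaton) (Ai : invertible_automaton A) :
    subgroup (bijection (seq (alphabet A))) :=
  generated_subgroup (range (fun q : states A =>
    exist (fun f => `[< bijective f >]) (@transducer A q) (asboolT (Ai q))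
      : bijection (seq (alphabet A)))).

Section AT.
Variables (X : vh_data) (XP : finite_VHT1_complex X).
Local Notation hor := (set_type (@sq_hor X)).
Local Notation ver := (set_type (~` @sq_hor X)).

Let VHT := VHT1_VHT XP.
Let VH := VHT_VH VHT.
Let SC := VH_square_complex VH.

Lemma corner_ex (x : hor) (q : ver) : exists s : sqS X, corner s (val x) (val q).
Proof.
have [v Xv] := VHT1_vertex XP.
have := VHT_complete VHT; move=> /(_ (val x) (val q)).
case=> [|||s [? _]]; last by exists s.
- by rewrite [LHS]Xv [RHS]Xv.
- exact: set_mem (valP x).
- exact: set_mem (valP q).
Qed.
Definition corner_square (x : hor) (q : ver) : sqS X := sval (cid (corner_ex x q)).

Lemma horizontal_rot (s : sqS X) :
  sq_hor (sq_side (sq_rot s)) <-> ~ sq_hor (sq_side s).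
Proof.
have /(VH_bipartite VH) : corner (sq_rot s) (sq_side (sq_rot s)) (sq_side (sq_refl (sq_rot s))) by [].
by rewrite (side_refl SC) -iterSr (rot4 SC) (VH_inv VH).
Qed.

Lemma out_subproof (x : hor) (q : ver) :
  sq_inv (sq_side (sq_rot (sq_rot (corner_square x q)))) \in @sq_hor X.
Proof.
apply/mem_set/(VH_inv VH)/horizontal_rot => /horizontal_rot.
rewrite /corner_square; case: cid => s [sE _] /=; rewrite sE; apply.
exact: set_mem (valP x).
Qed.

Lemma trans_subproof (x : hor) (q : ver) :
  sq_side (sq_rot (corner_square x q)) \in ~` @sq_hor X.
Proof.
apply/mem_set => /horizontal_rot.
rewrite /corner_square; case: cid => s [sE _] /=; rewrite sE; apply.
exact: set_mem (valP x).
Qed.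

Lemma finite_edges (A : set (sqE X)) : finite_set [set: set_type A].
Proof.
rewrite -[X in finite_set X](preimage_setT (val : set_type A -> sqE X)).
by apply: finite_preimage (VHT1_finE XP) => ? ? _ _; exact: val_inj.
Qed.

(* corner_square x q is the square s with x = sq_side s and q = sq_side (sq_refl s)
   at the same origin. The edge sq_side (sq_rot s) is opposite to q and parallel to
   it, whereas sq_side (sq_rot (sq_rot s)) is opposite to x and antiparallel. *)
Definition automaton_T : automaton := {|
  alphabet := hor;
  states := ver;
  alphabet_fin := finite_edges _;
  states_fin := finite_edges _;
  trans := fun x q => exist (fun e => e \in ~` @sq_hor X) _ (trans_subproof x q);
  out := fun x q => exist (fun e => e \in @sq_hor X) _ (out_subproof x q) |}.

End AT.

(* The one-skeleton of the Bruhat-Tits building of PGL_3(K), for a field K with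
   valuation ring O and uniformizer pi: vertices are homothety classes of
   O-lattices in K ^ 3, and the building is the flag complex of the relation
   bt_adj, under which the classes of L and M are adjacent when
   pi L < M < L for suitable representatives. *)
Section Building.
Variables (K : fieldTopologicalType) (O : set K) (pi : K) (pi_neq0 : pi != 0).
Local Notation V := 'cV[K]_3.
Implicit Types (g h : GL3 K) (L M : set V) (C D : set (set V)) (c : K).

Definition lattice_of g : set V :=
  [set (g : 'M[K]_3) *m v | v in [set v : V | forall i, O (v i 0)]].
Definition scale_lattice c L : set V := [set c *: v | v in L].
Definition homothety_class L : set (set V) :=
  [set scale_lattice c L | c in [set c | c != 0]].
Definition move_lattice g L : set V := [set (g : 'M[K]_3) *m v | v in L].
Definition move_class g C : set (set V) := move_lattice g @` C.

Record bt_vertex := BTVertex {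
  bt_class :> set (set V);
  _ : `[< exists g, bt_class = homothety_class (lattice_of g) >] }.
HB.instance Definition _ := [isSub for bt_class].
HB.instance Definition _ := [Choice of bt_vertex by <:].

Lemma bt_vertexP (x : bt_vertex) :
  exists g, (x : set (set V)) = homothety_class (lattice_of g).
Proof. by case: x => C /= /asboolP. Qed.

Lemma move_scale g c L :
  move_lattice g (scale_lattice c L) = scale_lattice c (move_lattice g L).
Proof.
by rewrite /move_lattice /scale_lattice !image_comp; apply: eq_imagel => v _ /=;
  rewrite scalemxAr.
Qed.

Lemma scale_scale c d L :
  scale_lattice c (scale_lattice d L) = scale_lattice (c * d) L.
Proof.
by rewrite /scale_lattice image_comp; apply: eq_imagel => v _ /=; rewrite scalerA.
Qed.

Lemma move_move g h L :
  move_lattice g (move_lattice h L) = move_lattice (g * h)%g L.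
Proof.
by rewrite /move_lattice image_comp; apply: eq_imagel => v _ /=; rewrite mulmxA.
Qed.

Lemma move_homothety g L :
  move_class g (homothety_class L) = homothety_class (move_lattice g L).
Proof.
by rewrite /move_class /homothety_class image_comp; apply: eq_imagel => c _ /=;
  rewrite move_scale.
Qed.

Lemma move_lattice_of g h : move_lattice g (lattice_of h) = lattice_of (g * h)%g.
Proof. exact: move_move. Qed.

Lemma bt_scale (x : bt_vertex) c L : c != 0 ->
  bt_class x L -> bt_class x (scale_lattice c L).
Proof.
have [g ->] := bt_vertexP x => c0 [d /= d0 <-]; rewrite scale_scale.
by exists (c * d) => //=; rewrite mulf_neq0.
Qed.

Lemma move_class_proportional g h c (x : bt_vertex) : c != 0 ->
  (g : 'M[K]_3) = c *: (h : 'M[K]_3) -> move_class g x = move_class h x.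
Proof.
move=> c0 gE; have gL L : move_lattice g L = move_lattice h (scale_lattice c L).
  rewrite /move_lattice /scale_lattice image_comp; apply: eq_imagel => v _ /=.
  by rewrite gE -scalemxAl scalemxAr.
apply/seteqP; split=> [_ [L xL <-]|_ [L xL <-]].
  by rewrite gL; exists (scale_lattice c L) => //; exact: bt_scale.
exists (scale_lattice c^-1 L); first by apply: bt_scale; rewrite ?invr_neq0.
rewrite gL scale_scale mulfV// /scale_lattice; congr move_lattice.
by rewrite -[RHS]image_id; apply: eq_imagel => v _; rewrite scale1r.
Qed.

Fact bt_move_subproof g (x : bt_vertex) :
  `[< exists h, move_class g x = homothety_class (lattice_of h) >].
Proof.
apply/asboolP; have [h ->] := bt_vertexP x.
by exists (g * h)%g; rewrite move_homothety move_lattice_of.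
Qed.
Definition bt_move g (x : bt_vertex) : bt_vertex := BTVertex (bt_move_subproof g x).

Lemma bt_move_eq g h x :
  \pi_(PGL3 K) g = \pi_(PGL3 K) h -> bt_move g x = bt_move h x.
Proof.
move=> /PGL3_eqP[c c0 gh]; apply/val_inj; exact: move_class_proportional gh.
Qed.

Lemma bt_moveM g h x : bt_move (g * h)%g x = bt_move g (bt_move h x).
Proof.
apply/val_inj; rewrite /= /move_class image_comp; apply: eq_imagel => L _ /=.
by rewrite move_move.
Qed.

Lemma bt_move1 x : bt_move 1%g x = x.
Proof.
apply/val_inj; rewrite /= /move_class -[RHS]image_id; apply: eq_imagel => L _ /=.
by rewrite /move_lattice -[RHS]image_id; apply: eq_imagel => v _; rewrite mul1mx.
Qed.

Definition bt_act (x : PGL3 K) : bt_vertex -> bt_vertex := bt_move (repr x).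
Fact bt_act1 x : bt_act (1%g : PGL3 K) x = x.
Proof. by rewrite -[RHS]bt_move1; apply: bt_move_eq; rewrite reprK. Qed.
Fact bt_actM (g h : PGL3 K) x : bt_act (g * h)%g x = bt_act g (bt_act h x).
Proof. by rewrite /bt_act -bt_moveM; apply: bt_move_eq; rewrite reprK. Qed.
Definition bt_actV : action (PGL3 K) bt_vertex := Action bt_act1 bt_actM.

Definition bt_adj : rel bt_vertex := fun x y =>
  `[< exists L M, [/\ bt_class x L, bt_class y M,
        scale_lattice pi L `<` M & M `<` L] >].

Lemma scale_proper c L M : c != 0 -> L `<` M ->
  scale_lattice c L `<` scale_lattice c M.
Proof.
move=> c0 [LM nML]; split; first exact: image_subset.
move=> sML; apply: nML => v Mv.
have [|w Lw /(scalerI c0) <-//] := sML (c *: v); by exists v.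
Qed.

Lemma bt_adj_sym : symmetric bt_adj.
Proof.
suff S x y : bt_adj x y -> bt_adj y x by move=> x y; apply/idP/idP=> /S.
move=> /asboolP[L [M [xL yM piLM ML]]]; apply/asboolP.
exists M, (scale_lattice pi L); split=> //; first exact: bt_scale.
exact: scale_proper.
Qed.

Lemma move_proper g L M : L `<` M -> move_lattice g L `<` move_lattice g M.
Proof.
move=> [LM nML]; split; first exact: image_subset.
move=> sML; apply: nML => v Mv.
have [|w Lw /(congr1 (mulmx (invmx g)))] := sML ((g : 'M[K]_3) *m v); first by exists v.
by rewrite !mulmxA mulVmx ?GL3_unit// !mul1mx => <-.
Qed.

Lemma bt_act_adj (g : PGL3 K) x y : bt_adj x y -> bt_adj (bt_actV g x) (bt_actV g y).
Proof.
move=> /asboolP[L [M [xL yM piLM ML]]]; apply/asboolP.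
exists (move_lattice (repr g) L), (move_lattice (repr g) M); split.
- by exists L.
- by exists M.
- by rewrite -move_scale; exact: move_proper.
- exact: move_proper.
Qed.

Definition bt_edge := {e : bt_vertex * bt_vertex | bt_adj e.1 e.2}.

Fact bt_inv_subproof (e : bt_edge) : bt_adj (val e).2 (val e).1.
Proof. by rewrite bt_adj_sym; exact: valP e. Qed.
Definition bt_inv (e : bt_edge) : bt_edge :=
  exist (fun e => bt_adj e.1 e.2) ((val e).2, (val e).1) (bt_inv_subproof e).

Definition bt_graph : graph := {|
  gV := bt_vertex;
  gE := bt_edge;
  gorg := fun e => (val e).1;
  ginv := bt_inv |}.

Definition bt_act_edge (g : PGL3 K) (e : bt_edge) : bt_edge :=
  exist (fun e => bt_adj e.1 e.2) (bt_actV g (val e).1, bt_actV g (val e).2)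
    (bt_act_adj g (valP e)).
Fact bt_act_edge1 (e : bt_edge) : bt_act_edge (1%g : PGL3 K) e = e.
Proof. by apply/val_inj; case: e => [[x y] xy] /=; rewrite !bt_act1. Qed.
Fact bt_act_edgeM (g h : PGL3 K) e : bt_act_edge (g * h)%g e = bt_act_edge g (bt_act_edge h e).
Proof. by apply/val_inj; case: e => [[x y] xy] /=; rewrite !bt_actM. Qed.
Definition bt_actE : action (PGL3 K) bt_edge := Action bt_act_edge1 bt_act_edgeM.

Program Definition bt_action : graph_action (PGL3 K) bt_graph :=
  @GraphAction (PGL3 K) bt_graph bt_actV bt_actE _ _.
Next Obligation. by []. Qed.
Next Obligation. by move=> g e; apply/val_inj. Qed.

End Building.

Section PadicBuilding.
Variables (p : nat) (p_pr : prime p).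

Definition padic_ints : set (padic p_pr) := range (@padic_incl p p_pr).

Lemma padic_natE (n k : nat) :
  (n%:R : padic_int p_pr) k = ((n : int) %% (p ^ k)%N)%Z.
Proof.
elim: n => [|n IH] //; rewrite -natr1 -addn1 PoszD.
change ((((n%:R : padic_int p_pr) k + (1%R : padic_int p_pr) k) %% (p ^ k)%N)%Z
  = ((n%:Z + 1%:Z)%R %% (p ^ k)%N)%Z).
by rewrite IH modzDm.
Qed.

Fact padic_p_neq0 : (p%:R : padic p_pr) != 0.
Proof.
have -> : p%:R = padic_incl (p%:R : padic_int p_pr) by rewrite /padic_incl rmorph_nat.
rewrite /padic_incl tofrac_eq0; apply/eqP => /(congr1 (fun x : padic_int p_pr => x 2%N)).
rewrite padic_natE (padic_natE 0 2) mod0z modz_small.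
  by case=> p0; have := prime_gt0 p_pr; rewrite p0.
by rewrite /= ltz_nat -[X in (X < _)%N]expn1 ltn_exp2l ?prime_gt1.
Qed.

Definition Delta1 : graph := bt_graph padic_ints padic_p_neq0.
Definition Delta1_action : graph_action (PGL3 (padic p_pr)) Delta1 :=
  bt_action padic_ints padic_p_neq0.

End PadicBuilding.

Section Sigma.
Variables (p q : nat) (p_pr : prime p) (q_pr : prime q).
Local Notation Gp := (PGL3 (padic p_pr)).
Local Notation Gq := (PGL3 (padic q_pr)).

Definition building_product : vh_data := graph_prod (Delta1 p_pr) (Delta1 q_pr).
Definition building_product_action : vh_action (Gp * Gq)%type building_product :=
  graph_prod_action (Delta1_action p_pr) (Delta1_action q_pr).

Variable Gamma : subgroup (Gp * Gq)%type.

Definition Sigma : vh_data := quotient_vh Gamma building_product_action.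

Definition stabilizer_p (Op : gV (Delta1 p_pr)) : subgroup (Gp * Gq)%type :=
  stabilizer Gamma (fst_action Gq (gactV (Delta1_action p_pr))) Op.

End Sigma.

(* Main.v *)
(* Gamma is simply transitive on the vertices of Y. Given a vertex v of Delta_q, the
   images in Sigma of the edges of Delta_p x {v} label the edges of Delta_p, and
   words in X become edge paths of Delta_p issued from O_p. For an edge b from v to v',
   the transducer of the state [O_p, b] exchanges the labelling at v for the one at v',
   so that it is the action on paths of the element of Gamma_{O_p} mapping v' to v.
   As Delta_q is connected, G(A^T(Sigma)) is the image of Gamma_{O_p} in the
   bijections of the set of paths, and the kernel is {c in Gamma | c_1 = 1}.

   Irreducibility kills this kernel N: if N <> 1, a count in the link of a vertex shows
   that the commutant of N in M_3(Q_q) is scalar; hence the projection of Gamma to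
   PGL_3(Q_q) has finite vertex stabilizers, the kernels of both projections have
   finite index in the vertex stabilizers, and Gamma is commensurable with a product.

   The invariant measure of the stabilizer is the push-forward of the one of Gamma.
   Property (T) follows from simple transitivity on the vertices of Delta_q: links are
   incidence graphs of projective planes, whose spectral gap exceeds 1/2, and gradient
   descent for the Laplacian of the generators of type 1 turns almost invariant vectors
   into invariant ones. *)

Require Import Defs.
From HB Require Import structures.
From mathcomp Require Import all_boot all_order all_algebra.
From mathcomp Require Import all_classical all_reals all_analysis.
From mathcomp Require Import ring lra.

Set Implicit Arguments.
Unset Strict Implicit.
Unset Printing Implicit Defensive.
Import Order.TTheory GRing.Theory Num.Theory.
Local Open Scope classical_set_scope.
Local Open Scope quotient_scope.
Import numFieldNormedType.Exports.
Local Open Scope ring_scope.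

From mathcomp Require Import complex.
From mathcomp Require sesquilinear.
Import sesquilinear.

(** Both buildings are treated over an abstract discretely valued field. An edge is a pair of
    matrices with product [pi], whose residues carry the geometry of the link. Sums over the link
    run over nonzero vectors instead of projective points: over a residue field of q elements each
    point and each line is counted q - 1 times, whence the factors q^3 - 1, q^2 - 1 and q - 1.

    The main obstacle is the kernel N, which is handled without density or normal subgroup theorems.
    Modulo [pi] the commutant of N is an algebra C of 3 x 3 matrices. Conjugation by the generator
    with column w and row x shows that C w has at most q times as many elements as there are u with
    x u = 0 and u x in C; the reverse inequality holds for all non-incident w and x. Non-incidence
    is biregular, so equality holds for every non-incident pair and both sizes are constant. A
    nonscalar C then contains square-zero elements u x for every row x, and only scalars commute
    with all of them.

    For property (T), descent yields an invariant vector at a controlled distance of the given one;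
    the Kazhdan constant is the inverse square root of the descent constant. *)

(** [res] is a total function constrained on [O] only, with kernel [pi] times [O]. [dvr_bound] and
    [dvr_sep] together say that the valuation has rank one: powers of [pi] clear every denominator,
    and only 0 is divisible by all of them. *)
Record is_dvr (K : fieldTopologicalType) (O : set K) (pi : K) (F : finFieldType)
    (res : K -> F) : Prop := IsDVR {
  dvr1 : O 1;
  dvrB : forall x y, O x -> O y -> O (x - y);
  dvrM : forall x y, O x -> O y -> O (x * y);
  dvr_pi0 : pi != 0;
  dvr_res1 : res 1 = 1;
  dvr_resB : forall x y, O x -> O y -> res (x - y) = res x - res y;
  dvr_resM : forall x y, O x -> O y -> res (x * y) = res x * res y;
  dvr_surj : forall a, exists2 x, O x & res x = a;
  dvr_res0 : forall x, O x -> res x = 0 <-> O (pi^-1 * x);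
  dvr_total : forall x, O x \/ O x^-1;
  dvr_unit : forall x, O x -> res x != 0 -> O x^-1;
  dvr_bound : forall x, exists n, O (pi ^+ n * x);
  dvr_sep : forall x, (forall n, O (pi ^- n * x)) -> x = 0 }.

(** * Discrete valuation rings and residues of matrices *)

Section DVR.
Variables (K : fieldTopologicalType) (O : set K) (pi : K) (F : finFieldType).
Variables (res : K -> F) (D : is_dvr O pi res).

Lemma dvr0 : O 0.
Proof. by rewrite -(subrr 1); apply: (dvrB D); exact: (dvr1 D). Qed.
Lemma dvrN x : O x -> O (- x).
Proof. by move=> Ox; rewrite -sub0r; apply: (dvrB D dvr0 Ox). Qed.
Lemma dvrD x y : O x -> O y -> O (x + y).
Proof. by move=> Ox Oy; rewrite -[y]opprK; apply: (dvrB D) => //; exact: dvrN. Qed.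
Lemma dvrX x n : O x -> O (x ^+ n).
Proof.
by move=> Ox; elim: n => [|n IH]; rewrite ?expr0 ?exprS; [exact: (dvr1 D)|exact: (dvrM D Ox IH)].
Qed.
Lemma dvr_res_0 : res 0 = 0.
Proof. by rewrite -(subrr 1) (dvr_resB D) ?subrr//; exact: (dvr1 D). Qed.
Lemma dvr_resN x : O x -> res (- x) = - res x.
Proof. by move=> Ox; rewrite -sub0r (dvr_resB D) ?dvr_res_0 ?sub0r//; exact: dvr0. Qed.
Lemma dvr_resD x y : O x -> O y -> res (x + y) = res x + res y.
Proof.
by move=> Ox Oy; rewrite -[y in LHS]opprK (dvr_resB D) ?dvr_resN ?opprK//; exact: dvrN.
Qed.
Lemma dvr_sum (I : Type) (r : seq I) (P : pred I) (f : I -> K) :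
  (forall i, O (f i)) -> O (\sum_(i <- r | P i) f i).
Proof. by move=> Of; elim/big_rec: _ => [|i x _]; [exact: dvr0|exact: dvrD]. Qed.
Lemma dvr_res_sum (I : Type) (r : seq I) (P : pred I) (f : I -> K) :
  (forall i, O (f i)) -> res (\sum_(i <- r | P i) f i) = \sum_(i <- r | P i) res (f i).
Proof.
move=> Of; elim: r => [|i r IH]; first by rewrite !big_nil dvr_res_0.
by rewrite !big_cons; case: ifP => // _; rewrite dvr_resD ?IH//; exact: dvr_sum.
Qed.
Lemma dvr_prod (I : Type) (r : seq I) (P : pred I) (f : I -> K) :
  (forall i, O (f i)) -> O (\prod_(i <- r | P i) f i).
Proof.
by move=> Of; elim/big_rec: _ => [|i x _]; [exact: (dvr1 D)|exact: (dvrM D (Of i))].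
Qed.
Lemma dvr_res_prod (I : Type) (r : seq I) (P : pred I) (f : I -> K) :
  (forall i, O (f i)) -> res (\prod_(i <- r | P i) f i) = \prod_(i <- r | P i) res (f i).
Proof.
move=> Of; elim: r => [|i r IH]; first by rewrite !big_nil (dvr_res1 D).
by rewrite !big_cons; case: ifP => // _; rewrite (dvr_resM D) ?IH//; exact: dvr_prod.
Qed.
Lemma dvr_Opi : O pi.
Proof.
case: (dvr_total D pi) => // /[dup] Opi.
have /(dvr_res0 D) : O 1 by exact: (dvr1 D).
rewrite mulr1 => -[_ h] /h; rewrite (dvr_res1 D) => /eqP.
by rewrite oner_eq0.
Qed.
Lemma dvr_respi : res pi = 0.
Proof. by apply/(dvr_res0 D dvr_Opi); rewrite mulVf ?(dvr_pi0 D)//; exact: (dvr1 D). Qed.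
Lemma dvr_res_pi x : O x -> res (pi * x) = 0.
Proof. by move=> Ox; rewrite (dvr_resM D) ?dvr_respi ?mul0r//; exact: dvr_Opi. Qed.
Lemma dvr_resV x : O x -> O x^-1 -> x != 0 -> res x != 0.
Proof.
move=> Ox OVx x0; apply/eqP => rx; have := dvr_res1 D.
rewrite -(mulfV x0) (dvr_resM D)// rx mul0r => /esym/eqP.
by rewrite oner_eq0.
Qed.

(* Every nonzero element is a unit times a power of the uniformizer. *)
Lemma dvr_val x : x != 0 -> exists n u,
  [/\ O u, O u^-1, u != 0 & x = pi ^+ n * u \/ x = pi ^- n * u].
Proof.
move=> x0.
have [Ox|nOx] := pselect (O x).
  (* Some [pi ^- n * x] leaves [O] by [dvr_sep]; just before the first such [n] the element is a
     unit. *)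
  have exn : exists n, ~~ `[< O (pi ^- n * x) >].
    apply: contrapT => /forallNP h; move/eqP: x0; apply; apply: (dvr_sep D) => n.
    by apply: contrapT => h'; apply: (h n); apply/asboolPn.
  have [[|n]] := ex_minnP exn; first by rewrite expr0 invr1 mul1r => /asboolPn.
  move=> /asboolPn nO min.
  have On : O (pi ^- n * x).
    apply: contrapT => h; have := min n; rewrite ltnn => h'.
    by have : false by apply: h'; apply/asboolPn.
  exists n, (pi ^- n * x); split=> //.
  - apply: (dvr_unit D) => //; apply/eqP => /(dvr_res0 D On).
    by rewrite mulrA -invfM -exprS.
  - by rewrite mulf_neq0// invr_eq0 expf_neq0// (dvr_pi0 D).
  - by left; rewrite mulrA mulfV ?mul1r// expf_neq0// (dvr_pi0 D).
have exn : exists n, `[< O (pi ^+ n * x) >] by have [n ?] := dvr_bound D x; exists n; apply/asboolP.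
have [[|n]] := ex_minnP exn; first by rewrite expr0 mul1r => /asboolP.
move=> /asboolP On min.
exists n.+1, (pi ^+ n.+1 * x); split=> //.
- apply: (dvr_unit D) => //; apply/eqP => /(dvr_res0 D On).
  rewrite exprS -mulrA mulKf ?(dvr_pi0 D)// => h.
  by have := min n; rewrite ltnn => h'; have : false by apply: h'; apply/asboolP.
- by rewrite mulf_neq0// expf_neq0// (dvr_pi0 D).
- by right; rewrite mulrA mulVf ?mul1r// expf_neq0// (dvr_pi0 D).
Qed.

Definition intmx a b (m : 'M[K]_(a, b)) := forall i j, O (m i j).
Definition resmx a b (m : 'M[K]_(a, b)) : 'M[F]_(a, b) := map_mx res m.

Lemma intmxM a b c (m : 'M[K]_(a, b)) (n : 'M[K]_(b, c)) : intmx m -> intmx n -> intmx (m *m n).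
Proof. by move=> Om On i j; rewrite mxE; apply: dvr_sum => k; exact: (dvrM D (Om _ _) (On _ _)). Qed.
Lemma intmxD a b (m n : 'M[K]_(a, b)) : intmx m -> intmx n -> intmx (m + n).
Proof. by move=> Om On i j; rewrite mxE; exact: dvrD. Qed.
Lemma intmxB a b (m n : 'M[K]_(a, b)) : intmx m -> intmx n -> intmx (m - n).
Proof. by move=> Om On i j; rewrite !mxE; exact: (dvrB D). Qed.
Lemma intmxZ a b x (m : 'M[K]_(a, b)) : O x -> intmx m -> intmx (x *: m).
Proof. by move=> Ox Om i j; rewrite mxE; exact: (dvrM D Ox (Om _ _)). Qed.
Lemma intmx_scalar n x : O x -> intmx (x%:M : 'M[K]_n).
Proof. by move=> Ox i j; rewrite mxE; case: (i == j); [|exact: dvr0]. Qed.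
Lemma intmx1 n : intmx (1%:M : 'M[K]_n).
Proof. exact: (intmx_scalar (dvr1 D)). Qed.
Lemma intmx_tr a b (m : 'M[K]_(a, b)) : intmx m -> intmx m^T.
Proof. by move=> Om i j; rewrite mxE. Qed.
Lemma resmxM a b c (m : 'M[K]_(a, b)) (n : 'M[K]_(b, c)) : intmx m -> intmx n ->
  resmx (m *m n) = resmx m *m resmx n.
Proof.
move=> Om On; apply/matrixP => i j; rewrite !mxE dvr_res_sum; last first.
  by move=> k; exact: (dvrM D (Om _ _) (On _ _)).
by apply: eq_bigr => k _; rewrite !mxE (dvr_resM D).
Qed.
Lemma resmxD a b (m n : 'M[K]_(a, b)) : intmx m -> intmx n -> resmx (m + n) = resmx m + resmx n.
Proof. by move=> Om On; apply/matrixP => i j; rewrite !mxE dvr_resD. Qed.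
Lemma resmxZ a b x (m : 'M[K]_(a, b)) : O x -> intmx m -> resmx (x *: m) = res x *: resmx m.
Proof. by move=> Ox Om; apply/matrixP => i j; rewrite !mxE (dvr_resM D). Qed.
Lemma resmx_scalar n x : resmx (x%:M : 'M[K]_n) = (res x)%:M.
Proof. by apply/matrixP => i j; rewrite !mxE; case: (i == j); rewrite ?dvr_res_0. Qed.
Lemma resmx1 n : resmx (1%:M : 'M[K]_n) = 1%:M.
Proof. by rewrite resmx_scalar (dvr_res1 D). Qed.
Lemma resmx_tr a b (m : 'M[K]_(a, b)) : resmx m^T = (resmx m)^T.
Proof. by rewrite /resmx map_trmx. Qed.
Lemma resmx0P a b (m : 'M[K]_(a, b)) : intmx m ->
  resmx m = 0 <-> exists2 n, intmx n & m = pi *: n.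
Proof.
move=> Om; split=> [/matrixP m0|[n On ->]].
  exists (pi^-1 *: m); last by rewrite scalerA mulfV ?(dvr_pi0 D)// scale1r.
  move=> i j; rewrite mxE; apply/(dvr_res0 D (Om i j)).
  by have := m0 i j; rewrite !mxE.
by apply/matrixP => i j; rewrite !mxE dvr_res_pi.
Qed.
Lemma resmx_surj a b (m : 'M[F]_(a, b)) : exists2 n, intmx n & resmx n = m.
Proof.
pose f x := sval (cid2 (dvr_surj D x)).
exists (map_mx f m); first by move=> i j; rewrite mxE /f; case: cid2.
by apply/matrixP => i j; rewrite !mxE /f; case: cid2.
Qed.

Lemma det_int n (m : 'M[K]_n) : intmx m -> O (\det m).
Proof.
move=> Om; apply: dvr_sum => s; apply: (dvrM D); last exact: dvr_prod.
by rewrite -signr_odd; case: odd; rewrite ?expr1 ?expr0; [exact/dvrN/(dvr1 D)|exact: (dvr1 D)].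
Qed.
Lemma res_det n (m : 'M[K]_n) : intmx m -> res (\det m) = \det (resmx m).
Proof.
have Os (b : bool) : O ((-1) ^+ b).
  by case: b; rewrite ?expr1 ?expr0; [exact/dvrN/(dvr1 D)|exact: (dvr1 D)].
move=> Om; rewrite dvr_res_sum; last by move=> s; apply: (dvrM D) => //; exact: dvr_prod.
apply: eq_bigr => s _; rewrite (dvr_resM D)//; last exact: dvr_prod.
congr (_ * _); last by rewrite dvr_res_prod//; apply: eq_bigr => i _; rewrite mxE.
by case: (perm.odd_perm s); rewrite ?expr1 ?expr0 ?dvr_resN ?(dvr_res1 D)//; exact: (dvr1 D).
Qed.
(** Cramer's rule: the determinant is a unit of [O] and the cofactors are integral. *)
Lemma intmx_inv n (m : 'M[K]_n) : intmx m -> \det (resmx m) != 0 ->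
  m \in unitmx /\ intmx (invmx m).
Proof.
move=> Om; rewrite -res_det// => d0.
have dm0 : \det m != 0.
  by apply: contra_neq d0 => ->; rewrite dvr_res_0.
have um : m \in unitmx by rewrite unitmxE unitfE.
split=> // i j; rewrite /invmx um !mxE; apply: (dvrM D).
  by apply: (dvr_unit D) => //; exact: det_int.
rewrite /cofactor; apply: (dvrM D).
  by rewrite -signr_odd; case: odd; rewrite ?expr1 ?expr0; [exact/dvrN/(dvr1 D)|exact: (dvr1 D)].
by apply: det_int => k l; rewrite !mxE.
Qed.

(** Divide by an entry of least valuation. It is found by induction on a list of entries, since
    [dvr_total] makes divisibility a total preorder. *)
Lemma primitive a b (m : 'M[K]_(a, b)) : m != 0 ->
  exists c, [/\ c != 0, intmx (c *: m) & resmx (c *: m) != 0].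
Proof.
move=> m0.
suff [[i j] /= mij] : exists ij : 'I_a * 'I_b, m ij.1 ij.2 != 0 /\
    forall k l, O ((m ij.1 ij.2)^-1 * m k l).
  case: mij => mij h; exists (m i j)^-1; split; rewrite ?invr_eq0//.
    by move=> k l; rewrite mxE; exact: h.
  apply/eqP => /matrixP/(_ i j); rewrite !mxE mulVf// (dvr_res1 D) => /eqP.
  by rewrite oner_eq0.
suff : forall s : seq ('I_a * 'I_b), has (fun ij => m ij.1 ij.2 != 0) s ->
  exists2 ij, m ij.1 ij.2 != 0 & forall kl, kl \in s -> O ((m ij.1 ij.2)^-1 * m kl.1 kl.2).
  move=> /(_ (enum {: 'I_a * 'I_b})); case.
    apply/hasP; apply: contrapT => h; move/eqP: m0; apply; apply/matrixP => i j.
    rewrite mxE; apply/eqP; apply: contrapT => /negP mij; apply: h.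
    by exists (i, j); rewrite ?mem_enum.
  by move=> ij ij0 h; exists ij; split=> // k l; apply: (h (k, l)); rewrite mem_enum.
elim=> [//|[i j] s IH] /=.
have O1 := dvr1 D.
have [/IH[ij ij0 h] _|hs] := boolP (has (fun ij => m ij.1 ij.2 != 0) s); last first.
  rewrite orbF => mij; exists (i, j) => //= kl; rewrite inE => /orP[/eqP->|kls].
    by rewrite mulVf.
  have := hasPn hs _ kls; rewrite negbK => /eqP ->; rewrite mulr0; exact: dvr0.
have [Oij|] := dvr_total D ((m ij.1 ij.2)^-1 * m i j).
  by exists ij => // kl; rewrite inE => /orP[/eqP->|/h].
rewrite invfM invrK => Oij.
have [mij0|mij0] := eqVneq (m i j) 0.
  exists ij => // kl; rewrite inE => /orP[/eqP->|/h]//=.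
  by rewrite mij0 mulr0; exact: dvr0.
exists (i, j) => // kl; rewrite inE => /orP[/eqP->|/h Okl] /=; first by rewrite mulVf.
have -> : (m i j)^-1 * m kl.1 kl.2 = (m ij.1 ij.2 * (m i j)^-1) * ((m ij.1 ij.2)^-1 * m kl.1 kl.2).
  by rewrite [m _ _ * _]mulrC -mulrA mulVKf.
exact: (dvrM D Oij Okl).
Qed.

Lemma intmx_bound a b (m : 'M[K]_(a, b)) : exists n, intmx (pi ^+ n *: m).
Proof.
have [f Hf] := choice (fun ij : 'I_a * 'I_b => dvr_bound D (m ij.1 ij.2)).
exists (\sum_ij f ij)%N => i j; rewrite mxE (bigD1 (i, j))//= exprD mulrAC.
by apply: (dvrM D); [exact: (Hf (i, j))|exact/dvrX/dvr_Opi].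
Qed.

End DVR.

(** * Vertices and adjacency of the building *)

Lemma invmxM (R : comUnitRingType) n (A B : 'M[R]_n) : A \in unitmx -> B \in unitmx ->
  invmx (A *m B) = invmx B *m invmx A.
Proof.
move=> uA uB; have uAB : A *m B \in unitmx by rewrite unitmx_mul uA.
by apply: (can_inj (mulKmx uAB)); rewrite mulmxV// mulmxA mulmxK// mulmxV.
Qed.

Lemma mulmx_eq0_unitr (R : comUnitRingType) m n (A : 'M[R]_(m, n)) (B : 'M[R]_n) :
  B \in unitmx -> (A *m B == 0) = (A == 0).
Proof.
by move=> uB; apply/eqP/eqP => [AB|->]; rewrite ?mul0mx// -(mulmxK uB A) AB mul0mx.
Qed.
Lemma mulmx_eq0_unitl (R : comUnitRingType) m n (A : 'M[R]_(m, n)) (B : 'M[R]_m) :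
  B \in unitmx -> (B *m A == 0) = (A == 0).
Proof.
by move=> uB; apply/eqP/eqP => [AB|->]; rewrite ?mulmx0// -(mulKmx uB A) AB mulmx0.
Qed.

Section Building.
Variables (K : fieldTopologicalType) (O : set K) (pi : K) (F : finFieldType).
Variables (res : K -> F) (D : is_dvr O pi res).
Local Notation intmx := (intmx O).
Local Notation resmx := (resmx res).
Local Notation vertex := (bt_vertex O).

(** The group GL_n(O), which is the stabilizer of the standard lattice. *)
Definition isoK n (k : 'M[K]_n) := [/\ k \in unitmx, intmx k & intmx (invmx k)].

Lemma isoK1 n : isoK (1%:M : 'M[K]_n).
Proof. by split; rewrite ?unitmx1 ?invmx1; [|exact: (intmx1 D)|exact: (intmx1 D)]. Qed.
Lemma isoKV n (k : 'M[K]_n) : isoK k -> isoK (invmx k).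
Proof. by move=> [uk Ok Ovk]; split; rewrite ?unitmx_inv ?invmxK. Qed.
Lemma isoKP n (k : 'M[K]_n) : isoK k <-> intmx k /\ \det (resmx k) != 0.
Proof.
split=> [[uk Ok Ovk]|[Ok]]; last by move=> /(intmx_inv D Ok)[].
split=> //; rewrite -(res_det D)//; apply: (dvr_resV D).
- exact: (det_int D).
- by rewrite -det_inv; exact: (det_int D).
- by rewrite -unitfE -unitmxE.
Qed.
Lemma isoK_lift n (k : 'M[F]_n) : k \in unitmx -> exists2 l, isoK l & resmx l = k.
Proof.
move=> uk; have [l Ol lk] := resmx_surj D k; exists l => //.
by apply/isoKP; split=> //; rewrite lk -unitfE -unitmxE.
Qed.
Lemma isoK_res n (k : 'M[K]_n) : isoK k -> resmx k \in unitmx.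
Proof. by move=> /isoKP[_ dk]; rewrite unitmxE unitfE. Qed.

(** [lattice_of] for a bare matrix, so that scalar multiples can be inserted without a proof of
    invertibility. *)
Definition span_lattice (m : 'M[K]_3) : set 'cV[K]_3 :=
  [set m *m v | v in [set v : 'cV[K]_3 | forall i, O (v i 0)]].

Lemma scale_span c m : scale_lattice c (span_lattice m) = span_lattice (c *: m).
Proof.
by rewrite /scale_lattice /span_lattice image_comp; apply: eq_imagel => v _ /=; rewrite scalemxAl.
Qed.
Lemma span_sub (g h : 'M[K]_3) : h \in unitmx ->
  span_lattice g `<=` span_lattice h <-> intmx (invmx h *m g).
Proof.
move=> uh; split=> [gh i j|Ohg _ [v Ov <-]].
  have [|v Ov hv] := gh (g *m delta_mx j 0).
    exists (delta_mx j 0) => // k /=; rewrite mxE; case: (_ && _); [exact: (dvr1 D)|exact: (dvr0 D)].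
  have -> : (invmx h *m g) i j = v i 0.
    have -> : v = invmx h *m g *m delta_mx j 0 by rewrite -mulmxA -hv mulKmx.
    by rewrite -colE [RHS]mxE.
  exact: Ov.
exists (invmx h *m g *m v); last by rewrite !mulmxA mulmxV// mul1mx.
move=> i; apply: (intmxM D Ohg) => k l; rewrite ord1; exact: Ov.
Qed.

Fact vtx_subproof (g : GL3 K) :
  `[< exists h, homothety_class (lattice_of O g) = homothety_class (lattice_of O h) >].
Proof. by apply/asboolP; exists g. Qed.
Definition vtx (g : GL3 K) : vertex := BTVertex (vtx_subproof g).

Lemma vtx_surj (x : vertex) : exists g, x = vtx g.
Proof. by have [g xg] := bt_vertexP x; exists g; apply/val_inj. Qed.

Lemma act_vtx (g h : GL3 K) : bt_actV O (\pi_(PGL3 K) g) (vtx h) = vtx (g * h)%g.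
Proof.
rewrite /= /bt_act; have -> : bt_move (repr (\pi_(PGL3 K) g)) (vtx h) = bt_move g (vtx h).
  by apply: bt_move_eq; rewrite reprK.
by apply/val_inj; rewrite /= move_homothety move_lattice_of.
Qed.

Lemma unitGL (g : GL3 K) : (g : 'M[K]_3) \in unitmx. Proof. exact: GL3_unit. Qed.

(** Vertices are the cosets of the scalars times GL_3(O): equality of the two lattices up to a
    factor is a pair of inclusions, and [span_sub] turns these into the integrality of a matrix and
    of its inverse. *)
Lemma vtx_eq (g h : GL3 K) : vtx g = vtx h <->
  exists c k, [/\ c != 0, isoK k & (g : 'M[K]_3) = c *: (h *m k)].
Proof.
split=> [/(congr1 val) /= gh|[c [k [c0 kK gE]]]].
  have : homothety_class (lattice_of O g) (lattice_of O g).
    exists 1; first exact: oner_neq0.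
    by rewrite /lattice_of scale_span scale1r.
  rewrite gh => -[c /= c0]; rewrite scale_span => hg.
  have uch : c *: (h : 'M[K]_3) \in unitmx.
    by rewrite unitmxE detZ unitrM unitfE expf_neq0//= -unitmxE unitGL.
  have /span_sub := unitGL g => /(_ (c *: (h : 'M[K]_3))) [H1 _].
  have /span_sub := uch => /(_ g) [H2 _].
  exists c, (invmx (c *: (h : 'M[K]_3)) *m g); split=> //.
    split; first by rewrite unitmx_mul unitmx_inv uch unitGL.
      by apply: H2; rewrite hg.
    by rewrite invmxM ?unitmx_inv// ?unitGL// invmxK; apply: H1; rewrite hg.
  by rewrite scalemxAl mulmxA mulmxV// mul1mx.
apply/val_inj => /=.
have kE d : scale_lattice d (lattice_of O g) = scale_lattice (d * c) (lattice_of O h).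
  rewrite /lattice_of !scale_span; apply/seteqP; rewrite -scalerA gE scalemxAl.
  have [uk Ok Ovk] := kK.
  split=> [_ [v Ov <-]|_ [v Ov <-]].
    exists (k *m v); last by rewrite !(scalemxAl, mulmxA).
    by move=> i; apply: (intmxM D Ok) => a b; rewrite ord1.
  exists (invmx k *m v).
    by move=> i; apply: (intmxM D Ovk) => a b; rewrite ord1.
  by rewrite -!scalemxAl -!mulmxA mulKVmx.
apply/seteqP; split=> [_ [d d0 <-]|_ [d d0 <-]].
  by rewrite kE; exists (d * c) => //=; rewrite mulf_neq0.
by exists (d / c); rewrite /= ?mulf_neq0 ?invr_eq0// kE -mulrA mulVf// mulr1.
Qed.

(** The relative position of two adjacent vertices: [pi] O^3 < g O^3 < O^3. Strictness of the two
    inclusions is the nonvanishing of the residues. Keeping [h], which is [pi] g^-1, in the data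
    makes the reversal of an edge a swap. *)
Definition step_mx (g h : 'M[K]_3) :=
  [/\ intmx g, intmx h, g *m h = pi%:M, resmx g != 0 & resmx h != 0].

Lemma step_unit g h : step_mx g h -> g \in unitmx /\ h = pi *: invmx g.
Proof.
move=> [_ _ gh _ _]; have gu : g \in unitmx.
  have : g *m (pi^-1 *: h) = 1%:M by rewrite -scalemxAr gh scale_scalar_mx mulVf ?(dvr_pi0 D).
  by case/mulmx1_unit.
by split=> //; rewrite -[LHS](mulKmx gu) gh mul_mx_scalar.
Qed.
Lemma step_mx_sym g h : step_mx g h -> step_mx h g.
Proof.
move=> sgh; have [gu hE] := step_unit sgh; have [Og Oh gh g0 h0] := sgh; split=> //.
by rewrite hE -scalemxAl mulVmx// scalemx1.
Qed.
Lemma step_mx_tr g h : step_mx g h -> step_mx h^T g^T.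
Proof.
move=> [Og Oh gh g0 h0]; split; try exact: intmx_tr; rewrite ?resmx_tr ?trmx_eq0//.
by rewrite -trmx_mul gh tr_scalar_mx.
Qed.
Lemma step_mxr g h k : step_mx g h -> isoK k -> step_mx (g *m k) (invmx k *m h).
Proof.
move=> sgh [uk Ok Ovk]; have [Og Oh gh g0 h0] := sgh.
have urk := isoK_res (And3 uk Ok Ovk); have := isoK_res (isoKV (And3 uk Ok Ovk)) => urvk.
split; try exact: (intmxM D).
- by rewrite mulmxA mulmxK.
- by rewrite (resmxM D)// mulmx_eq0_unitr.
- by rewrite (resmxM D)// mulmx_eq0_unitl.
Qed.
Lemma step_mx_res g h : step_mx g h -> resmx g *m resmx h = 0.
Proof.
move=> [Og Oh gh _ _]; rewrite -(resmxM D)// gh (resmx_scalar D) (dvr_respi D).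
by apply/matrixP => i j; rewrite !mxE mul0rn.
Qed.

(** The residues of [g] and [h] form an exact pair: if X lifts [x] and g X = [pi] Y, then X = h Y
    because g h = [pi]. *)
Lemma step_exact g h n (x : 'M[F]_(3, n)) : step_mx g h -> resmx g *m x = 0 ->
  exists y, x = resmx h *m y.
Proof.
move=> sgh; have [Og Oh gh g0 h0] := sgh; have [gu hE] := step_unit sgh.
have [X OX <-] := resmx_surj D x; rewrite -(resmxM D)// => /(resmx0P D (intmxM D Og OX))[Y OY gXY].
exists (resmx Y); rewrite -(resmxM D)//; congr (map_mx res _).
by apply: (can_inj (mulKmx gu)); rewrite mulmxA gh mul_scalar_mx gXY.
Qed.

Lemma rank1P m n (A : 'M[F]_(m, n)) : (\rank A <= 1)%N -> A != 0 ->
  exists (w : 'cV_m) (x : 'rV_n), A = w *m x.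
Proof.
move=> r1 A0; have : (\rank A == 1)%N by rewrite eqn_leq r1 lt0n mxrank_eq0.
move=> /eqP rA; have := mulmx_base A; move: (col_base A) (row_base A).
by rewrite rA => w x <-; exists w, x.
Qed.

(** The two residues have product 0, so their ranks add up to at most 3 and one of them has rank 1.
    This is the distinction of the two types of directed edges. *)
Lemma step_type g h : step_mx g h ->
  (exists (w : 'cV_3) (x : 'rV_3), resmx g = w *m x) \/
  (exists (w : 'cV_3) (x : 'rV_3), resmx h = w *m x).
Proof.
move=> sgh; have [Og Oh gh g0 h0] := sgh.
have := mulmx0_rank_max (step_mx_res sgh).
have [r1 _|r1 r3] := leqP (\rank (resmx g)) 1; first by left; exact: rank1P.
right; apply: rank1P => //; rewrite leqNgt; apply/negP => r2.
by move: (leq_add r1 r2) => r4; have := leq_trans r4 r3.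
Qed.

(** The two products are the residues of [pi] g^-1 g' and [pi] g'^-1 g; their vanishing makes g^-1
    g' and its inverse integral. *)
Lemma step_same g h g' h' : step_mx g h -> step_mx g' h' ->
  resmx h *m resmx g' = 0 -> resmx h' *m resmx g = 0 -> isoK (invmx g *m g').
Proof.
move=> s s'; have [gu hE] := step_unit s; have [gu' hE'] := step_unit s'.
have [Og Oh _ _ _] := s; have [Og' Oh' _ _ _] := s'.
have int_ a b : intmx (pi *: invmx a) -> intmx b ->
    resmx (pi *: invmx a) *m resmx b = 0 -> intmx (invmx a *m b).
  move=> Oa Ob; rewrite -(resmxM D)// => /(resmx0P D (intmxM D Oa Ob))[n On].
  by rewrite -scalemxAl => /(scalerI (dvr_pi0 D)) ->.
rewrite hE hE' in Oh Oh' *; move=> h1 h2; split; first by rewrite unitmx_mul unitmx_inv gu.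
  exact: int_.
by rewrite invmxM ?unitmx_inv// invmxK; exact: int_.
Qed.

(** Makes residues of classes in PGL_3 meaningful: a primitive integral representative is unique up
    to a unit of [O]. *)
Lemma unit_scale a b c (m : 'M[K]_(a, b)) : intmx m -> resmx m != 0 ->
  intmx (c *: m) -> resmx (c *: m) != 0 -> [/\ O c, O c^-1, c != 0 & res c != 0].
Proof.
move=> Om m0 Ocm cm0; have c0 : c != 0.
  by apply: contra_neq cm0 => ->; rewrite scale0r; apply/matrixP => i j; rewrite !mxE (dvr_res_0 D).
have [Oc|Oc] := dvr_total D c.
  have rc : res c != 0 by apply: contra_neq cm0 => rc; rewrite (resmxZ D)// rc scale0r.
  by split=> //; exact: (dvr_unit D).
have OcK : O c.
  rewrite -[c]invrK; apply: (dvr_unit D) => //; apply: contra_neq m0 => rc.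
  by rewrite -[m](scale1r) -(mulVf c0) -scalerA (resmxZ D)// rc scale0r.
by split=> //; exact: (dvr_resV D).
Qed.

Definition adj := bt_adj (O := O) pi.

(** For the representatives L = d a O^3 and M = e b O^3 the step is g = (e / d) a^-1 b with h = [pi]
    (d / e) b^-1 a. Each inclusion says that one of them is integral, each strictness that one of
    them has a nonzero residue. *)
Lemma step_adj (a b : GL3 K) : adj (vtx a) (vtx b) <->
  exists c g h, [/\ c != 0, step_mx g h & (b : 'M[K]_3) = c *: (a *m g)].
Proof.
have Z0 (u : 'M[K]_3) d : u \in unitmx -> d != 0 -> d *: u \in unitmx.
  by move=> uu d0; rewrite unitmxE detZ unitrM unitfE expf_neq0//= -unitmxE.
split=> [/asboolP[L [M [[d /= d0 <-] [e /= e0 <-]]]]|[c [g [h [c0 s bE]]]]].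
  rewrite /lattice_of !scale_span scalerA => -[s1 n1] [s2 n2].
  have ua := unitGL a; have ub := unitGL b.
  have uda := Z0 _ _ ua d0; have ueb := Z0 _ _ ub e0.
  have upa : (pi * d) *: (a : 'M[K]_3) \in unitmx by apply: Z0; rewrite ?mulf_neq0// (dvr_pi0 D).
  move: s1 n1 s2 n2; rewrite !span_sub// !invmxZ//.
  set g := (e / d) *: (invmx a *m b); set h := (pi * d / e) *: (invmx b *m a).
  have -> : e^-1 *: invmx b *m ((pi * d) *: (a : 'M[K]_3)) = h.
    by rewrite -scalemxAl -scalemxAr scalerA mulrC.
  have -> : (pi * d)^-1 *: invmx a *m (e *: (b : 'M[K]_3)) = pi^-1 *: g.
    by rewrite -scalemxAl -scalemxAr !scalerA invfM; congr (_ *: _); ring.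
  have -> : d^-1 *: invmx a *m (e *: (b : 'M[K]_3)) = g.
    by rewrite -scalemxAl -scalemxAr !scalerA mulrC.
  have -> : e^-1 *: invmx b *m (d *: (a : 'M[K]_3)) = pi^-1 *: h.
    by rewrite -scalemxAl -scalemxAr !scalerA -mulrA mulKf ?(dvr_pi0 D)// mulrC.
  move=> Oh ng Og nh; exists (d / e), g, h; split; first by rewrite mulf_neq0 ?invr_eq0.
    split=> //.
    - rewrite /g /h -scalemxAl -scalemxAr scalerA -mulmxA mulKVmx// mulVmx// scalemx1.
      by congr (_ %:M); rewrite mulrAC -!mulrA; field; rewrite d0.
    - apply/eqP => /(resmx0P D Og)[n On gE]; apply: ng.
      by rewrite gE scalerA mulVf ?scale1r// (dvr_pi0 D).
    - apply/eqP => /(resmx0P D Oh)[n On hE]; apply: nh.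
      by rewrite hE scalerA mulVf ?scale1r// (dvr_pi0 D).
  rewrite /g -scalemxAr scalerA mulKVmx// -[LHS]scale1r; congr (_ *: _); field.
  by rewrite d0.
have [gu hE] := step_unit s; have [Og Oh gh g0 h0] := s.
have ua := unitGL a; have ub := unitGL b.
apply/asboolP; exists (span_lattice a), (span_lattice (a *m g)); split.
- by exists 1; [exact: oner_neq0|rewrite /= /lattice_of scale_span scale1r].
- exists c^-1; first by rewrite /= invr_eq0.
  by rewrite /lattice_of scale_span bE scalerA mulVf// scale1r.
- rewrite scale_span; have upa : pi *: (a : 'M[K]_3) \in unitmx by apply: Z0 (dvr_pi0 D).
  have uag : a *m g \in unitmx by rewrite unitmx_mul ua.
  split.
    by apply/(span_sub _ uag); rewrite invmxM// -scalemxAr -mulmxA mulVmx// mulmx1 -hE.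
  move=> /(span_sub _ upa); rewrite invmxZ// -scalemxAl mulKmx// => Opg.
  move/eqP: g0; apply; apply/(resmx0P D Og); exists (pi^-1 *: g) => //.
  by rewrite scalerA mulfV ?(dvr_pi0 D)// scale1r.
- have uag : a *m g \in unitmx by rewrite unitmx_mul ua.
  split; first by apply/(span_sub _ ua); rewrite mulKmx.
  move=> /(span_sub _ uag); rewrite invmxM// -mulmxA mulVmx// mulmx1 => Ovg.
  by move/eqP: h0; apply; apply/(resmx0P D Oh); exists (invmx g).
Qed.

End Building.

(** * Local finiteness and connectedness of the one-skeleton *)

Section BuildingGraph.
Variables (K : fieldTopologicalType) (O : set K) (pi : K) (F : finFieldType).
Variables (res : K -> F) (D : is_dvr O pi res).
Local Notation intmx := (intmx O).
Local Notation resmx := (resmx res).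
Local Notation isoK := (isoK O).
Local Notation vertex := (bt_vertex O).
Local Notation vtx := (vtx O).
Local Notation adj := (@adj K O pi).
Local Notation step_mx := (step_mx O pi res).
Local Notation o := (vtx 1%g).

Lemma adj_step g h (gu : g \in unitmx) : step_mx g h -> adj o (vtx (MkGL3 gu)).
Proof.
move=> s; apply/(step_adj D); exists 1, g, h; split; rewrite ?oner_neq0//.
by rewrite scale1r mul1mx.
Qed.

Lemma step_adj1 (x : vertex) : adj o x <->
  exists (a : GL3 K) h, step_mx a h /\ x = vtx a.
Proof.
split=> [|[a [h [s ->]]]]; last first.
  by case: a s => g gu s; exact: adj_step s.
have [b ->] := vtx_surj x; move=> /(step_adj D)[c [g [h [c0 s bE]]]].
have [gu _] := step_unit D s; exists (MkGL3 gu), h; split=> //.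
apply/(vtx_eq D); exists c, 1%:M; split=> //; first exact: (isoK1 D).
by rewrite bE /= mul1mx mulmx1.
Qed.

Lemma vtx_sub1 (a b : GL3 K) : vtx a = vtx b -> exists2 k : GL3 K, isoK k &
  \pi_(PGL3 K) a = \pi_(PGL3 K) (b * k)%g.
Proof.
move=> /(vtx_eq D)[c [k [c0 kK aE]]]; have [uk _ _] := kK.
by exists (MkGL3 uk) => //; apply/PGL3_eqP; exists c.
Qed.

Lemma vtx_isoK (a k : GL3 K) : isoK k -> vtx (a * k)%g = vtx a.
Proof.
move=> kK; apply/(vtx_eq D); exists 1, (k : 'M[K]_3).
by split; rewrite ?oner_neq0 ?scale1r.
Qed.

Lemma step_vtx_inj (a a' : GL3 K) h h' : step_mx a h -> step_mx a' h' ->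
  resmx h *m resmx a' = 0 -> resmx h' *m resmx a = 0 -> vtx a = vtx a'.
Proof.
move=> s s' h1 h2; have kK := step_same D s s' h1 h2.
apply/esym/(vtx_eq D); exists 1, (invmx a *m a'); split; rewrite ?oner_neq0//.
by rewrite scale1r mulKVmx// unitGL.
Qed.

(** A loop would make [g] scalar; being primitive it would be a unit, and the relation between the
    residues would force the residue of [h] to vanish. *)
Lemma adj_irrefl (x : vertex) : ~ adj x x.
Proof.
have [a ->] := vtx_surj x; move=> /(step_adj D)[c [g [h [c0 s /esym aE]]]].
have [Og Oh gh g0 h0] := s.
have gE : g = c^-1 *: 1%:M.
  have := congr1 (mulmx (invmx a)) aE; rewrite -scalemxAr mulKmx ?unitGL// mulVmx ?unitGL// => <-.
  by rewrite scalerA mulVf// scale1r.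
have [Oc Ovc _ rc] : [/\ O c^-1, O c^-1^-1, c^-1 != 0 & res c^-1 != 0].
  by apply: (unit_scale D (m := 1%:M : 'M[K]_3)); rewrite -?gE//;
    [exact: (intmx1 D)|rewrite (resmx1 D); apply: (@matrix_nonzero1 _ 2)].
move/eqP: h0; apply; have := step_mx_res D s.
rewrite gE (resmxZ D)//; last exact: (intmx1 D).
rewrite (resmx1 D) -scalemxAl mul1mx => /eqP; rewrite scaler_eq0 (negPf rc) => /eqP //.
Qed.

Lemma adj_act (s : PGL3 K) x y : adj x y -> adj (bt_actV O s x) (bt_actV O s y).
Proof. exact: bt_act_adj. Qed.

Lemma act_transitive (x y : vertex) : exists s : PGL3 K, y = bt_actV O s x.
Proof.
have [a ->] := vtx_surj x; have [b ->] := vtx_surj y.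
by exists (\pi_(PGL3 K) (b * a^-1)%g); rewrite act_vtx -mulgA mulVg mulg1.
Qed.

(** A neighbour of the base vertex is determined by the residue of its step matrix, and there are
    finitely many residues. *)
Lemma adj_finite (x : vertex) : finite_set [set y | adj x y].
Proof.
have [s ->] := act_transitive o x.
suff fo : finite_set [set y | adj o y].
  apply: sub_finite_set (finite_image (bt_actV O s) fo) => y xy.
  exists (bt_actV O s^-1%g y); last by rewrite -actM mulgV act1.
  by have := adj_act s^-1%g (xy : adj _ _); rewrite -actM mulVg act1.
(* A choice of one neighbour per residue; the default [o] stands for the residues that come from no
   edge. *)
pose f (m : 'M[F]_3) : vertex :=
  if pselect (exists y, exists (a : GL3 K) h, [/\ step_mx a h, resmx a = m & y = vtx a])
    is left e then sval (cid e) else o.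
have fin : finite_set (f @` [set: 'M[F]_3]) by exact/finite_image/finite_finset.
apply: sub_finite_set fin => y /step_adj1[a [h [sa ->]]].
exists (resmx a) => //; rewrite /f; case: pselect => [e|]; last first.
  by case; exists (vtx a), a, h.
case: cid => _ /= [b [h' [sb rba ->]]].
have sa' := step_mx_res D (step_mx_sym D sa); have sb' := step_mx_res D (step_mx_sym D sb).
by apply: (step_vtx_inj sb sa); rewrite ?rba// -rba.
Qed.

(** Connectedness to the base vertex in the form of an induction principle, with no explicit
    paths. *)
Definition reach (x : vertex) := forall P : vertex -> Prop, P o ->
  (forall y z, adj y z -> P y -> P z) -> P x.

Definition reachmx (m : 'M[K]_3) := exists2 a : GL3 K, (a : 'M[K]_3) = m & reach (vtx a).

(** Translate a path from [o] to the vertex of [n] by [m] and append it to a path from [o] to the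
    vertex of [m]. Reachability is thereby reduced to generators of GL_3(K). *)
Lemma reachmxM m n : reachmx m -> reachmx n -> reachmx (m *m n).
Proof.
move=> [a <- ra] [b <- rb]; exists (a * b)%g => // P Po Padj.
rewrite -act_vtx; apply: (rb (fun x => P (bt_actV O (\pi_(PGL3 K) a) x))).
  by rewrite act_vtx mulg1; apply: ra.
by move=> y z yz; apply: Padj; exact: adj_act.
Qed.
Lemma reachmx_isoK k : isoK k -> reachmx k.
Proof.
move=> kK; have [uk _ _] := kK; exists (MkGL3 uk) => // P Po _.
suff -> : vtx (MkGL3 uk) = o by [].
by rewrite -[MkGL3 uk]mul1g; apply: vtx_isoK.
Qed.
Lemma reachmx_step g h : step_mx g h -> reachmx g.
Proof.
move=> s; have [gu _] := step_unit D s; exists (MkGL3 gu) => // P Po Padj.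
by apply: Padj Po; exact: adj_step s.
Qed.
Lemma reachmxZ c m : c != 0 -> reachmx m -> reachmx (c *: m).
Proof.
move=> c0 [a <- ra]; have u : c *: (a : 'M[K]_3) \in unitmx.
  by rewrite unitmxE detZ unitrM unitfE expf_neq0//= -unitmxE unitGL.
exists (MkGL3 u) => //; suff -> : vtx (MkGL3 u) = vtx a by [].
by apply/(vtx_eq D); exists c, 1%:M; split; rewrite ?mulmx1//; exact: (isoK1 D).
Qed.

Definition diag1 (i : 'I_3) (x : K) : 'M[K]_3 := diag_mx (\row_j (if j == i then x else 1)).

Lemma diag1M i x y : diag1 i x *m diag1 i y = diag1 i (x * y).
Proof.
rewrite /diag1 mulmx_diag; congr diag_mx; apply/rowP => j; rewrite !mxE.
by case: ifP; rewrite ?mulr1.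
Qed.

Lemma diag1_int i x : O x -> intmx (diag1 i x).
Proof.
move=> Ox j k; rewrite !mxE; case: (j == k); rewrite ?mulr1n ?mulr0n; last exact: (dvr0 D).
by case: ifP => // _; exact: (dvr1 D).
Qed.

Lemma reachmx_diag1 i x : x != 0 -> reachmx (diag1 i x).
Proof.
have d1 : diag1 i 1 = 1%:M.
  by apply/matrixP => a b; rewrite !mxE if_same.
(* This diagonal matrix is itself a step; the partner matrix, rescaled by [pi^-1], gives the inverse
   power. *)
have sp : step_mx (diag1 i pi) (pi *: diag1 i pi^-1).
  have E : pi *: diag1 i pi^-1 = diag_mx (\row_j (if j == i then 1 else pi)).
    rewrite /diag1 -linearZ; congr diag_mx; apply/rowP => j; rewrite !mxE.
    by case: ifP; rewrite ?mulr1 ?mulfV ?(dvr_pi0 D).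
  split.
  - exact/diag1_int/(dvr_Opi D).
  - rewrite E => j k; rewrite !mxE; case: (j == k); rewrite ?mulr1n ?mulr0n; last exact: (dvr0 D).
    by case: ifP => _; [exact: (dvr1 D)|exact: (dvr_Opi D)].
  - by rewrite -scalemxAr diag1M mulfV ?(dvr_pi0 D)// d1 scalemx1.
  - have [j ji] : exists j : 'I_3, j != i.
      by exists (lift i ord0); rewrite eq_sym neq_lift.
    apply/eqP => /matrixP/(_ j j); rewrite !mxE eqxx (negPf ji) mulr1n (dvr_res1 D) => /eqP.
    by rewrite oner_eq0.
  - rewrite E; apply/eqP => /matrixP/(_ i i); rewrite !mxE !eqxx mulr1n (dvr_res1 D) => /eqP.
    by rewrite oner_eq0.
have r1 : reachmx (diag1 i pi) by exact: reachmx_step sp.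
have r2 : reachmx (diag1 i pi^-1).
  have := reachmx_step (step_mx_sym D sp).
  move=> /(@reachmxZ pi^-1); rewrite scalerA mulVf ?(dvr_pi0 D)// scale1r.
  by apply; rewrite invr_eq0 (dvr_pi0 D).
have rX y n : reachmx (diag1 i y) -> reachmx (diag1 i (y ^+ n)).
  move=> ry; elim: n => [|n IH]; last by rewrite exprS -diag1M; exact: reachmxM.
  by rewrite expr0 d1; apply: reachmx_isoK; exact: (isoK1 D).
move=> /(dvr_val D)[n [u [Ou Ovu u0 xE]]].
have ru : reachmx (diag1 i u).
  apply: reachmx_isoK; have ud : diag1 i u *m diag1 i u^-1 = 1%:M by rewrite diag1M mulfV.
  have [uu _] := mulmx1_unit ud; split=> //; first exact: diag1_int.
  suff -> : invmx (diag1 i u) = diag1 i u^-1 by exact: diag1_int.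
  by apply: (can_inj (mulKmx uu)); rewrite mulmxV.
case: xE => ->; rewrite -diag1M; apply: reachmxM => //; first exact: rX.
by rewrite -exprVn; exact: rX.
Qed.

Lemma reachmx_diag (d : 'rV[K]_3) : (forall i, d 0 i != 0) -> reachmx (diag_mx d).
Proof.
move=> d0; have -> : diag_mx d = diag1 0 (d 0 0) *m diag1 1 (d 0 1) *m diag1 ord_max (d 0 ord_max).
  rewrite /diag1 !mulmx_diag; congr diag_mx; apply/rowP => j; rewrite !mxE.
  by case: j => [[|[|[|j]]]] //= jP; rewrite ?mulr1 ?mul1r; congr (d _ _); apply/val_inj.
by do 2?[apply: reachmxM]; apply: reachmx_diag1.
Qed.

(* A unipotent triangular matrix becomes integral after conjugation by a power
   of diag(1, pi, pi ^ 2). *)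
Lemma reachmx_unipotent (U : 'M[K]_3) (b : bool) : (forall i, U i i = 1) ->
  (forall i j : 'I_3, (if b then j < i else i < j)%N -> U i j = 0) -> reachmx U.
Proof.
move=> U1 U0; have [n nU] := intmx_bound D U.
(* Consecutive exponents differ by [n], decreasing for an upper and increasing for a lower
   triangular [U], so that every nonzero off-diagonal entry gains at least [pi ^+ n]. *)
pose e (i : 'I_3) : nat := if b then (n * (2 - i))%N else (n * i)%N.
pose t : 'rV[K]_3 := \row_i pi ^+ e i; pose t' : 'rV[K]_3 := \row_i pi ^- e i.
have pi0 m : pi ^+ m != 0 by rewrite expf_neq0 ?(dvr_pi0 D).
have tt' : diag_mx t' *m diag_mx t = 1%:M.
  rewrite mulmx_diag -diag_const_mx; congr diag_mx; apply/rowP => i.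
  by rewrite !mxE mulVf.
have -> : U = diag_mx t' *m (diag_mx t *m U *m diag_mx t') *m diag_mx t.
  by rewrite !mulmxA tt' mul1mx -mulmxA tt' mulmx1.
have Et i : t 0 i != 0 by rewrite mxE.
have Et' i : t' 0 i != 0 by rewrite mxE invr_eq0.
apply: reachmxM (reachmx_diag Et); apply: reachmxM; first exact: reachmx_diag.
set V := _ *m _ *m _.
have VE i j : V i j = pi ^+ e i * U i j * pi ^- e j.
  by rewrite /V mul_mx_diag mxE mul_diag_mx !mxE.
have V1 i : V i i = 1 by rewrite VE U1 mulr1 mulfV.
have V0 (i j : 'I_3) : (if b then j < i else i < j)%N -> V i j = 0.
  by move=> ij; rewrite VE U0// mulr0 mul0r.
have OV : intmx V.
  move=> i j; have [->|ij] := eqVneq i j; first by rewrite V1; exact: (dvr1 D).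
  have [hij|hij] := boolP (if b then j < i else i < j)%N; first by rewrite V0//; exact: (dvr0 D).
  have eij : (e j + n <= e i)%N.
    have {}ij : i != j :> nat by [].
    move: hij; rewrite /e; move: (b) => b'; case: b' => /=; rewrite -leqNgt => ji.
      have {ji} : (i < j)%N by rewrite ltn_neqAle ij.
      rewrite -mulnSr leq_mul2l => ji; apply/orP; right.
      by case: i j ij ji => [[|[|[|i]]] //= iP] [[|[|[|j]]] //= jP].
    have {ji} : (j < i)%N by rewrite ltn_neqAle eq_sym ij.
    rewrite -mulnSr leq_mul2l => ji; apply/orP; right.
    by case: i j ij ji => [[|[|[|i]]] //= iP] [[|[|[|j]]] //= jP].
  rewrite VE -(subnKC eij) !exprD.
  have -> : pi ^+ e j * pi ^+ n * pi ^+ (e i - (e j + n)) * U i j * pi ^- e j =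
      pi ^+ (e i - (e j + n)) * (pi ^+ n * U i j) by field.
  apply: (dvrM D); first exact/(dvrX D)/(dvr_Opi D).
  by have := nU i j; rewrite mxE.
apply: reachmx_isoK; apply/(isoKP D); split=> //; rewrite -(res_det D)//.
suff -> : \det V = 1 by rewrite (dvr_res1 D) oner_neq0.
have detT (W : 'M[K]_3) : (forall i j : 'I_3, (i < j)%N -> W i j = 0) ->
    (forall i, W i i = 1) -> \det W = 1.
  move=> W0 W1; rewrite det_trig; last by apply/is_trig_mxP => i j; exact: W0.
  by rewrite big1.
have [bE|bE] := boolP b; last by apply: detT => // i j; move: (V0 i j); rewrite (negPf bE).
rewrite -det_tr; apply: detT => [i j ij|i]; rewrite mxE//.
by apply: V0; rewrite bE.
Qed.

(** LUP decomposition: the permutation lies in GL_3(O), the lower factor is unipotent, and the upper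
    one is a diagonal matrix times a unipotent one. *)
Lemma reachmx_unit (m : 'M[K]_3) : m \in unitmx -> reachmx m.
Proof.
move=> um; have Pp := @cormen_lup_perm K 2 m; have dL := @cormen_lup_detL K 2 m.
have Llow := @cormen_lup_lower K 2 m; have Uup := @cormen_lup_upper K 2 m.
case E : (@cormen_lup K 2 m) Pp dL Llow Uup => [[P L] U] /= /is_perm_mxP[s PE] dL Llow Uup.
have PmLU : P * (m : 'M[K]_(2.+1)) = L * U.
  suff : (@cormen_lup K 2 m).1.1 * (m : 'M[K]_(2.+1)) =
      (@cormen_lup K 2 m).1.2 * (@cormen_lup K 2 m).2 by rewrite E.
  by case: (@cormen_lup K 2 m) (@cormen_lup_correct K 2 m) => [[]].
have uL : L \in unitmx by rewrite unitmxE dL unitr1.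
have uP : P \in unitmx by rewrite PE unitmx_perm.
have PmLU' : P *m m = L *m U := PmLU.
have uU : U \in unitmx.
  by have := congr1 (fun A => A \in unitmx) PmLU'; rewrite !unitmx_mul uP uL um /= => <-.
have -> : m = invmx P *m (L *m U) by rewrite -PmLU' mulKmx.
apply: reachmxM.
  apply: reachmx_isoK; apply: isoKV; rewrite PE; apply/(isoKP D); split.
    by move=> i j; rewrite !mxE; case: (_ == _); [exact: (dvr1 D)|exact: (dvr0 D)].
  have -> : resmx (perm_mx s) = perm_mx s.
    by apply/matrixP => i j; rewrite !mxE; case: (_ == _); rewrite ?(dvr_res1 D) ?(dvr_res_0 D).
  by rewrite -unitfE -unitmxE unitmx_perm.
apply: reachmxM.
  apply: (@reachmx_unipotent _ false) => [i|i j ij]; first by rewrite Llow// eqxx.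
  by rewrite Llow ?(ltnW ij)// -[i == j]/(val i == val j) (ltn_eqF ij).
have U0 i : U i i != 0.
  move: uU; rewrite unitmxE -det_tr det_trig; last first.
    by apply/is_trig_mxP => k l kl; rewrite mxE Uup.
  rewrite unitfE => /prodf_neq0/(_ i isT); by rewrite mxE.
pose d : 'rV[K]_3 := \row_i U i i; pose d' : 'rV[K]_3 := \row_i (U i i)^-1.
have -> : U = diag_mx d *m (diag_mx d' *m U).
  rewrite mulmxA mulmx_diag -[LHS]mul1mx; congr (_ *m _); rewrite -diag_const_mx.
  by congr diag_mx; apply/rowP => i; rewrite !mxE mulfV.
apply: reachmxM; first by apply: reachmx_diag => i; rewrite mxE.
apply: (@reachmx_unipotent _ true) => [i|i j ij]; first by rewrite mul_diag_mx !mxE mulVf.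
by rewrite mul_diag_mx !mxE (Uup i j)// mulr0.
Qed.

Lemma bt_connected (x : vertex) : reach x.
Proof.
have [a ->] := vtx_surj x; have [b ba rb] := reachmx_unit (unitGL a).
suff -> : a = b by [].
exact/val_inj.
Qed.

Lemma bt_connected_from (x0 : vertex) (P : vertex -> Prop) : P x0 ->
  (forall y z, adj y z -> P y -> P z) -> forall x, P x.
Proof.
move=> Px0 Padj x; have [s sx] := act_transitive o x0.
have := @bt_connected (bt_actV O s^-1%g x) (fun y => P (bt_actV O s y)).
rewrite -sx -actM mulgV act1; apply=> // y z yz; apply: Padj.
exact: adj_act.
Qed.

End BuildingGraph.

(** * Faithfulness of the action and the link of a vertex *)

Section VertexStabilizers.
Variables (K : fieldTopologicalType) (O : set K) (pi : K) (F : finFieldType).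
Variables (res : K -> F) (D : is_dvr O pi res).
Local Notation intmx := (intmx O).
Local Notation resmx := (resmx res).
Local Notation isoK := (isoK O).
Local Notation vertex := (bt_vertex O).
Local Notation vtx := (vtx O).
Local Notation step_mx := (step_mx O pi res).
Local Notation o := (vtx 1%g).

(** Comparing determinants shows that [c ^+ 3] is a unit, and then so is [c]. *)
Lemma isoK_scale c (k l : 'M[K]_3) : c != 0 -> isoK k -> isoK l ->
  \det (c *: k) = \det l -> O c /\ O c^-1.
Proof.
move=> c0 [uk Ok Ovk] [ul Ol Ovl]; rewrite detZ => dE.
have dk0 : \det k != 0 by rewrite -unitfE -unitmxE.
have dl0 : \det l != 0 by rewrite -unitfE -unitmxE.
have O3 : O (c ^+ 3).
  have -> : c ^+ 3 = \det l * \det (invmx k) by rewrite det_inv -dE mulfK.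
  by apply: (dvrM D); exact: (det_int D).
have Ov3 : O (c ^- 3).
  have -> : c ^- 3 = \det k * \det (invmx l) by rewrite det_inv -dE; field; rewrite dk0 c0.
  by apply: (dvrM D); exact: (det_int D).
have [Oc|Oc] := dvr_total D c; split=> //.
  have -> : c^-1 = c ^+ 2 * c ^- 3 by field.
  by apply: (dvrM D) => //; exact: (dvrX D).
have -> : c = c^-1 ^+ 2 * c ^+ 3 by field.
by apply: (dvrM D) => //; exact: (dvrX D).
Qed.

(** An element of GL_3(O) that fixes a homothety class stabilizes the lattice itself: by
    determinants the homothety factor is a unit. *)
Lemma stab_all_int (a : GL3 K) : isoK a ->
  (forall x : vertex, bt_actV O (\pi_(PGL3 K) a) x = x) ->
  forall h : GL3 K, exists2 m, intmx m & (a : 'M[K]_3) *m h = (h : 'M[K]_3) *m m.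
Proof.
move=> aK afix h; have := afix (vtx h); rewrite act_vtx => /(vtx_eq D)[c [k [c0 kK ahE]]].
have [Oc _] : O c /\ O c^-1.
  apply: (isoK_scale c0 kK aK); have := congr1 determinant ahE.
  have dh : \det (h : 'M[K]_3) != 0 by rewrite -unitfE -unitmxE unitGL.
  by rewrite /= scalemxAr !det_mulmx [LHS]mulrC => /(mulfI dh) ->.
exists (c *: k); first by case: kK => _ Ok _; exact: (intmxZ D).
by rewrite -scalemxAr -ahE.
Qed.

(** All conjugates of a representative in GL_3(O) stay integral. Conjugation by diagonal matrices
    with an entry [pi ^+ n] makes the off-diagonal entries infinitely divisible, hence 0;
    conjugation by 1 + [pi ^- n] E_ij does the same to the differences of diagonal entries. *)
Lemma bt_faithful (s : PGL3 K) : (forall x : vertex, bt_actV O s x = x) -> s = 1%g.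
Proof.
move: s; elim/quotW => b bfix; have := bfix o; rewrite act_vtx mulg1.
move=> /vtx_sub1 -/(_ _ _ _ D)[a aK]; rewrite mul1g => abE; rewrite abE in bfix *.
have aint := stab_all_int aK bfix.
have a0 (i j : 'I_3) : i != j -> (a : 'M[K]_3) i j = 0.
  move=> ij; apply: (dvr_sep D) => n.
  have p0 : pi ^+ n != 0 by rewrite expf_neq0 ?(dvr_pi0 D).
  have uh : diag1 i (pi ^+ n) \in unitmx.
    apply: (mulmx1_unit (B := diag1 i (pi ^- n)) _).1.
    by rewrite diag1M mulfV// /diag1; apply/matrixP => k l; rewrite !mxE if_same.
  have [m Om /matrixP/(_ i j)] := aint (MkGL3 uh).
  rewrite /= mul_diag_mx mul_mx_diag !mxE eqxx eq_sym (negPf ij) mulr1 => ->.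
  by rewrite mulKf.
have aii (i j : 'I_3) : i != j -> (a : 'M[K]_3) i i = (a : 'M[K]_3) j j.
  move=> ij; apply/eqP; rewrite -subr_eq0; apply/eqP/(dvr_sep D) => n.
  have hv : (1%:M + pi ^- n *: delta_mx i j) *m (1%:M - pi ^- n *: delta_mx i j) = 1%:M :> 'M[K]_3.
    rewrite mulmxBr mulmx1 mulmxDl mul1mx -scalemxAl -scalemxAr mul_delta_mx_0//.
      by rewrite !scaler0 addr0 addrK.
    by rewrite eq_sym.
  have [uh _] := mulmx1_unit hv.
  have [m Om /matrixP E] := aint (MkGL3 uh).
  have := E j j; have := E i j; rewrite /= !mulmxDr !mulmxDl !mulmx1 !mul1mx -!scalemxAr -!scalemxAl.
  have dE (A : 'M[K]_3) k l : (A *m delta_mx i j) k l = A k i *+ (l == j).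
    rewrite mxE (bigD1 i)//= big1 ?addr0; last by move=> x xi; rewrite mxE (negPf xi) mulr0.
    by rewrite mxE eqxx /=; case: eqP => _; rewrite ?mulr1 ?mulr0.
  have dE' (A : 'M[K]_3) k l : (delta_mx i j *m A) k l = A j l *+ (k == i).
    rewrite mxE (bigD1 j)//= big1 ?addr0; last by move=> x xi; rewrite mxE (negPf xi) andbF mul0r.
    by rewrite mxE eqxx andbT; case: eqP => _; rewrite ?mul1r ?mul0r.
  have aE (A B : 'M[K]_3) k l : (A + B) k l = A k l + B k l by rewrite mxE.
  have sE c (A : 'M[K]_3) k l : (c *: A) k l = c * A k l by rewrite mxE.
  rewrite !aE !sE !dE !dE' !eqxx (eq_sym j i) (negPf ij).
  rewrite !mulr1n !mulr0n !mulr0 !addr0 (a0 i j ij) (a0 j i) 1?eq_sym// mulr0 addr0 add0r => mij ajj.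
  suff -> : pi ^- n * ((a : 'M[K]_3) i i - (a : 'M[K]_3) j j) = m i j by exact: Om.
  by rewrite mulrBr mij ajj addrK.
apply/PGL3_eqP; exists ((a : 'M[K]_3) 0 0); last first.
  apply/matrixP => i j; rewrite !mxE; have [->|ij] := eqVneq i j; last by rewrite mulr0 a0.
  by rewrite mulr1; have [->//|j0] := eqVneq j 0; exact: aii.
apply/eqP => a00; have := unitGL a; rewrite unitmxE unitfE => /eqP; apply.
suff -> : (a : 'M[K]_3) = 0 by rewrite det0.
apply/matrixP => i j; rewrite mxE; have [->|/a0//] := eqVneq i j.
by have [->//|j0] := eqVneq j 0; rewrite -a00; exact: aii.
Qed.

(** The vertices of diag([pi] ^ n, 1, 1) are distinct. An entry 1 on the diagonal makes the inverse
    of the homothety factor integral, and the determinant would then make a negative power of [pi]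
    integral. *)
Lemma bt_infinite : exists f : nat -> vertex, injective f.
Proof.
have uh n : diag1 0 (pi ^+ n) \in unitmx.
  apply: (mulmx1_unit (B := diag1 0 (pi ^- n)) _).1.
  rewrite diag1M mulfV ?expf_neq0 ?(dvr_pi0 D)// /diag1.
  by apply/matrixP => k l; rewrite !mxE if_same.
exists (fun n => vtx (MkGL3 (uh n))).
suff H m n : (m <= n)%N -> vtx (MkGL3 (uh m)) = vtx (MkGL3 (uh n)) -> m = n.
  by move=> m n; have [/H//|/ltnW/H + /esym/esym] := leqP m n; move=> + /esym => /[apply].
move=> mn /esym/(vtx_eq D)[c [k [c0 [uk Ok Ovk] /= E]]].
have [//|mn'] := eqVneq m n; have {mn mn'}mn : (m < n)%N by rewrite ltn_neqAle mn'.
have p0 i : pi ^+ i != 0 by rewrite expf_neq0 ?(dvr_pi0 D).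
have Ovc : O c^-1.
  have := congr1 (fun A : 'M[K]_3 => A 1 1) E; rewrite mul_diag_mx !mxE /= mulr1n mul1r => ck.
  suff -> : c^-1 = k 1 1 by exact: Ok.
  by apply: (mulfI c0); rewrite mulfV.
have detE i : \det (diag1 0 (pi ^+ i)) = pi ^+ i :> K.
  rewrite det_diag (bigD1 0)//= big1 => [|j j0]; rewrite !mxE ?(negPf j0)//.
  by rewrite eqxx mulr1.
have dk0 : \det k != 0 by rewrite -unitfE -unitmxE.
have [N nE] : exists N, n = (m + N.+1)%N by exists (n - m.+1)%N; rewrite addnS -addSn subnKC.
have := congr1 determinant E; rewrite detZ det_mulmx !detE nE exprD mulrCA => /(mulfI (p0 m)) dE.
have ON : O (pi ^- N.+1).
  rewrite dE invfM -exprVn -det_inv.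
  by apply: (dvrM D); [exact: (dvrX D)|exact: (det_int D)].
have : O (pi^-1 * 1).
  have -> : pi^-1 * 1 = pi ^+ N * pi ^- N.+1.
    by rewrite exprSr invfM mulrA mulfV// mul1r mulr1.
  by apply: (dvrM D) => //; exact/(dvrX D)/(dvr_Opi D).
by move=> /(dvr_res0 D (dvr1 D))/eqP; rewrite (dvr_res1 D) oner_eq0.
Qed.

(* s moves the base vertex to an adjacent vertex of the next type: it is represented
   by an integral matrix g with pi g^-1 integral and residue of rank one. Its column
   w and row x are then a point and a line of the projective plane over F, the link
   of the base vertex. *)
Definition type1 (s : PGL3 K) (w : 'cV[F]_3) (x : 'rV[F]_3) :=
  exists (a : GL3 K) h, [/\ \pi_(PGL3 K) a = s, step_mx a h & resmx a = w *m x].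

Lemma type1_neq0 s w x : type1 s w x -> w != 0 /\ x != 0.
Proof.
move=> [a [h [_ [_ _ _ + _] aE]]]; rewrite aE => wx0; split; apply: contra_neq wx0 => ->; first by rewrite mul0mx.
by rewrite mulmx0.
Qed.

Lemma rank1_eq m n (w w' : 'cV[F]_m) (x x' : 'rV[F]_n) : w *m x != 0 -> w' *m x' = w *m x ->
  exists c d, [/\ c != 0, d != 0, w' = c *: w & x' = d *: x].
Proof.
move=> wx0 E; have E0 := wx0; rewrite -E in E0.
have cv k (u : 'cV[F]_k) : u != 0 -> exists i, u i 0 != 0.
  move=> u0; apply: contrapT => /forallNP h; move/eqP: u0; apply; apply/colP => i.
  by rewrite mxE; apply/eqP; apply: contrapT => /negP/h.
have rv k (u : 'rV[F]_k) : u != 0 -> exists i, u 0 i != 0.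
  move=> u0; have [|i] := cv _ u^T; first by rewrite trmx_eq0.
  by rewrite mxE; exists i.
have wxE i j : w' i 0 * x' 0 j = w i 0 * x 0 j.
  by have := congr1 (fun A : 'M[F]_(m, n) => A i j) E; rewrite !mxE !big_ord1.
have [i w'i] : exists i, w' i 0 != 0 by apply: cv; apply: contra_neq E0 => ->; rewrite mul0mx.
have [j x'j] : exists j, x' 0 j != 0 by apply: rv; apply: contra_neq E0 => ->; rewrite mulmx0.
have : w i 0 * x 0 j != 0 by rewrite -wxE mulf_neq0.
rewrite mulf_eq0 negb_or => /andP[wi xj].
exists (x 0 j / x' 0 j), (w i 0 / w' i 0); split; rewrite ?mulf_neq0 ?invr_eq0//.
  by apply/colP => k; rewrite mxE; apply: (mulIf x'j); rewrite wxE; field.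
by apply/rowP => k; rewrite mxE; apply: (mulfI w'i); rewrite wxE; field.
Qed.

(** Complete [w] up to a scalar to a basis, lift it to [k] in GL_3(O), and take k diag(1, [pi],
    [pi]); here [P] and [Q] are the diagonal projections of ranks 1 and 2. *)
Lemma type1_ex (w : 'cV[F]_3) : w != 0 -> exists (a : GL3 K) h x, step_mx a h /\ resmx a = w *m x.
Proof.
move=> w0; have rw : \rank w = 1%N.
  by apply/eqP; rewrite eqn_leq rank_leq_col lt0n mxrank_eq0.
have uc : row_ebase w \in unitmx by exact: row_ebase_unit.
have uk := col_ebase_unit w; have wE := mulmx_ebase w; rewrite rw in wE.
have [k kK kE] := isoK_lift D uk; have [k_u Ok Ovk] := kK.
pose P : 'M[K]_3 := pid_mx 1; pose Q : 'M[K]_3 := copid_mx 1.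
have PP : P *m P = P by rewrite mul_pid_mx.
have PQ : P *m Q = 0 by rewrite mul_pid_mx_copid.
have QP : Q *m P = 0 by rewrite mul_copid_mx_pid.
have QQ : Q *m Q = Q by rewrite {1}/Q mulmxBl mul1mx PQ subr0.
have PQ1 : P + Q = 1%:M by rewrite addrC subrK.
have OP : intmx P by move=> i j; rewrite mxE; case: (_ && _); [exact: (dvr1 D)|exact: (dvr0 D)].
have OQ : intmx Q by apply: (intmxB D) => //; exact: (intmx1 D).
have rP : resmx P = pid_mx 1.
  by apply/matrixP => i j; rewrite !mxE; case: (_ && _); rewrite ?(dvr_res1 D) ?(dvr_res_0 D).
have rQ : resmx Q = copid_mx 1.
  by apply/matrixP => i j; rewrite !mxE; do 2!case: (_ == _); case: (_ < _)%N;
    rewrite /= ?subr0 ?subrr ?sub0r ?(dvr_resN D) ?(dvr_res1 D) ?(dvr_res_0 D)//; exact: (dvr1 D).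
pose g := k *m (P + pi *: Q); pose h := (pi *: P + Q) *m invmx k.
have Opi := dvr_Opi D.
have gh : g *m h = pi%:M.
  rewrite /g /h mulmxA -(mulmxA k) mulmxDr !mulmxDl -!scalemxAl -!scalemxAr PP PQ QP QQ.
  by rewrite !scaler0 !addr0 add0r -scalerDr PQ1 -scalemxAr mulmx1 -scalemxAl mulmxV// scalemx1.
have Og : intmx g by apply: (intmxM D) => //; apply: (intmxD D) => //; exact: (intmxZ D).
have Oh : intmx h by apply: (intmxM D) => //; apply: (intmxD D) => //; exact: (intmxZ D).
have kE0 : resmx k *m pid_mx 1 = w *m (invmx (row_ebase w) *m pid_mx 1) :> 'M[F]_3.
  rewrite kE mulmxA; have -> : w *m invmx (row_ebase w) = col_ebase w *m pid_mx 1.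
    by rewrite -[X in X *m _]wE mulmxK.
  by rewrite -mulmxA mul_pid_mx.
have rg : resmx g = w *m (invmx (row_ebase w) *m pid_mx 1).
  rewrite (resmxM D)//; last by apply: (intmxD D) => //; exact: (intmxZ D).
  rewrite (resmxD D)//; last exact: (intmxZ D).
  by rewrite (resmxZ D)// (dvr_respi D) scale0r addr0 rP -kE0.
have rh : resmx h = copid_mx 1 *m invmx (resmx k).
  have rkE : resmx (invmx k) = invmx (resmx k).
    have urk := isoK_res D kK; apply: (can_inj (mulKmx urk)).
    by rewrite mulmxV// -(resmxM D)// mulmxV// (resmx1 D).
  rewrite (resmxM D)//; last by apply: (intmxD D) => //; exact: (intmxZ D).
  by rewrite (resmxD D)//; [rewrite (resmxZ D)// (dvr_respi D) scale0r add0r rQ rkE|exact: (intmxZ D)].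
have gu : g \in unitmx.
  have : g *m (pi^-1 *: h) = 1%:M by rewrite -scalemxAr gh scale_scalar_mx mulVf ?(dvr_pi0 D).
  by case/mulmx1_unit.
exists (MkGL3 gu), h, (invmx (row_ebase w) *m pid_mx 1); split=> //; split=> //=.
- rewrite rg -kE0 mulmx_eq0_unitl; last exact: (isoK_res D kK).
  by apply/eqP => /matrixP/(_ 0 0)/eqP; rewrite !mxE oner_eq0.
- rewrite rh mulmx_eq0_unitr ?unitmx_inv; last exact: (isoK_res D kK).
  by apply/eqP => /matrixP/(_ 1 1)/eqP; rewrite !mxE /= subr0 oner_eq0.
Qed.

Lemma step_exactr g h n (u : 'M[F]_(n, 3)) : step_mx g h -> u *m resmx g = 0 ->
  exists y, u = y *m resmx h.
Proof.
move=> s /(congr1 trmx); rewrite trmx_mul trmx0 -resmx_tr => gu.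
have [y uE] := step_exact D (step_mx_sym D (step_mx_tr s)) gu.
by exists y^T; rewrite -[u]trmxK uE trmx_mul resmx_tr trmxK.
Qed.

(** Exactness turns the bound of the rank sum by 3 into an equality. *)
Lemma step_rank g h : step_mx g h -> (\rank (resmx g) + \rank (resmx h) = 3)%N.
Proof.
move=> s; apply/eqP; rewrite eqn_leq (mulmx0_rank_max (step_mx_res D s)) /=.
have [y yE] := step_exactr s (mulmx_ker (resmx g)).
have := mxrankM_maxr y (resmx h).
by rewrite -yE mxrank_ker leq_subLR.
Qed.

Section Type1.
Variables (a h : 'M[K]_3) (w : 'cV[F]_3) (x : 'rV[F]_3).
Hypotheses (s : step_mx a h) (aE : resmx a = w *m x).

Let wx0 : w *m x != 0. Proof. by rewrite -aE; case: s. Qed.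
Let w0 : w != 0. Proof. by apply: contra_neq wx0 => ->; rewrite mul0mx. Qed.
Let x0 : x != 0. Proof. by apply: contra_neq wx0 => ->; rewrite mulmx0. Qed.

Lemma rank1_inj n (u : 'M[F]_(n, 1)) : u *m x = 0 -> u = 0.
Proof.
move=> ux; apply/matrixP => i j; rewrite mxE ord1; apply/eqP; apply: contrapT => /negP ui.
move/eqP: x0; apply; apply/rowP => k; rewrite mxE; apply: (mulfI ui).
by have := congr1 (fun A : 'M[F]_(n, 3) => A i k) ux; rewrite !mxE big_ord1 mulr0.
Qed.
Lemma rank1_inj' n (u : 'M[F]_(1, n)) : w *m u = 0 -> u = 0.
Proof.
move=> wu; apply/matrixP => i j; rewrite mxE ord1; apply/eqP; apply: contrapT => /negP uj.
move/eqP: w0; apply; apply/colP => k; rewrite mxE; apply: (mulIf uj).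
by have := congr1 (fun A : 'M[F]_(3, n) => A k j) wu; rewrite !mxE big_ord1 mul0r.
Qed.

Lemma type1_rank : \rank (resmx a) = 1%N /\ \rank (resmx h) = 2%N.
Proof.
have r1 : \rank (resmx a) = 1%N.
  apply/eqP; rewrite eqn_leq lt0n mxrank_eq0 aE wx0 andbT.
  exact: leq_trans (mxrankM_maxr _ _) (rank_leq_row _).
by split=> //; have := step_rank s; rewrite r1 => -[].
Qed.

Lemma type1_hw : resmx h *m w = 0.
Proof. by apply: rank1_inj; rewrite -mulmxA -aE (step_mx_res D (step_mx_sym D s)). Qed.
Lemma type1_xh : x *m resmx h = 0.
Proof. by apply: rank1_inj'; rewrite mulmxA -aE (step_mx_res D s). Qed.

Lemma type1_kerh (z : 'cV[F]_3) : resmx h *m z = 0 -> exists c, z = c *: w.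
Proof.
move=> /(step_exact D (step_mx_sym D s))[y ->]; rewrite aE -mulmxA; exists ((x *m y) 0 0).
by rewrite {1}[x *m y]mx11_scalar mul_mx_scalar.
Qed.
Lemma type1_kerh' (z : 'rV[F]_3) : z *m resmx h = 0 -> exists c, z = c *: x.
Proof.
move=> /(step_exactr (step_mx_sym D s))[y ->]; rewrite aE mulmxA; exists ((y *m w) 0 0).
by rewrite {1}[y *m w]mx11_scalar mul_scalar_mx.
Qed.
Lemma type1_imh (z : 'rV[F]_3) : z *m w = 0 -> (z <= resmx h)%MS.
Proof.
move=> zw; have [|y ->] := step_exactr s (u := z); last exact: submxMl.
by rewrite aE mulmxA zw mul0mx.
Qed.

End Type1.

(** The row space of the residue of [h] is the annihilator of [w], and the left kernel of the
    residue of [h'] is the line of [x']. The product therefore loses one rank exactly when [x']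
    annihilates [w]. *)
Lemma type1_mulh a h (w : 'cV[F]_3) (x : 'rV[F]_3) a' h' (w' : 'cV[F]_3) (x' : 'rV[F]_3) :
   step_mx a h -> resmx a = w *m x ->
  step_mx a' h' -> resmx a' = w' *m x' ->
  (\rank (resmx h *m resmx h') == 1%N) = (x' *m w == 0) /\
  (0 < \rank (resmx h *m resmx h') < 3)%N.
Proof.
move=> s aE s' aE'; have [r1 r2] := type1_rank s aE; have [r1' r2'] := type1_rank s' aE'.
have kx : (kermx (resmx h') == x')%MS.
  apply/andP; split; last by apply/sub_kermxP; exact: type1_xh s' aE'.
  apply/row_subP => i; have [|c ->] := type1_kerh' s' aE' (z := row i (kermx (resmx h'))).
    by rewrite -row_mul mulmx_ker row0.
  exact: scalemx_sub.
have x'0 : x' != 0.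
  by have [_ _ _ + _] := s'; rewrite aE'; apply: contra_neq => ->; rewrite mulmx0.
have rx : \rank x' = 1%N by rewrite rank_rV x'0.
have := mxrank_mul_ker (resmx h) (resmx h'); rewrite r2 => rE.
have capE : \rank (resmx h :&: kermx (resmx h'))%MS = \rank (resmx h :&: x')%MS.
  exact/eqmx_rank/eqmxP/(cap_eqmx (eqmx_refl _) (eqmxP kx)).
have [xw|xw] := eqVneq (x' *m w) 0.
  have : (resmx h :&: x' == x')%MS.
    by rewrite capmxSr sub_capmx submx_refl (type1_imh s aE)//.
  move=> /eqmx_rank; rewrite rx -capE => cE; move: rE; rewrite cE addn1 => -[->].
  by rewrite eqxx.
have cap0 : \rank (resmx h :&: x')%MS = 0%N.
  apply/eqP; apply: contraNT xw; rewrite -lt0n => r0.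
  have /mxrank_leqif_sup[_] := capmxSr (resmx h) x'.
  rewrite rx eqn_leq r0 (leq_trans (mxrankS (capmxSr _ _))) ?rx// => /esym.
  move=> /submx_trans/(_ (capmxSl _ _))/submxP[y ->].
  by rewrite -mulmxA (type1_hw s aE) mulmx0.
by move: rE; rewrite capE cap0 addn0 => ->.
Qed.

End VertexStabilizers.

(** * Simply transitive groups *)

Section SimplyTransitive.
Variables (K : fieldTopologicalType) (O : set K) (pi : K) (F : finFieldType).
Variables (res : K -> F) (D : is_dvr O pi res).
Local Notation intmx := (intmx O).
Local Notation resmx := (resmx res).
Local Notation isoK := (isoK O).
Local Notation vertex := (bt_vertex O).
Local Notation vtx := (vtx O).
Local Notation adj := (@adj K O pi).
Local Notation step_mx := (step_mx O pi res).
Local Notation type1 := (type1 O pi res).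
Local Notation o := (vtx 1%g).
Local Notation piG := (\pi_(PGL3 K)).

Lemma PGL3_piMg (g h : GL3 K) : (piG g * piG h)%g = piG (g * h)%g.
Proof. exact: PGL3_piM. Qed.
Lemma PGL3_piVg (g : GL3 K) : (piG g)^-1%g = piG g^-1%g.
Proof. exact: PGL3_piV. Qed.

Lemma vtx_lift (s : PGL3 K) (a : GL3 K) : vtx a = bt_actV O s o ->
  exists2 k : GL3 K, isoK k & s = piG (a * k)%g.
Proof.
elim/quotW: s => b; rewrite act_vtx mulg1 => /esym/(vtx_sub1 D)[k kK ->].
by exists k.
Qed.

Lemma type1_inv s w x : type1 s w x -> exists (b : GL3 K) a,
  [/\ piG b = s^-1%g, step_mx b a & resmx a = w *m x].
Proof.
move=> [a [h [<- sa aE]]]; have [hu _] := step_unit D (step_mx_sym D sa).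
exists (MkGL3 hu), a; split=> //; last exact: step_mx_sym.
rewrite PGL3_piVg; apply/PGL3_eqP; exists pi; first exact: (dvr_pi0 D).
by have [_] := step_unit D sa.
Qed.

Lemma type1_uniq s w x w' x' : type1 s w x -> type1 s w' x' ->
  exists c d, [/\ c != 0, d != 0, w' = c *: w & x' = d *: x].
Proof.
move=> [a [h [aE sa ra]]] [a' [h' [a'E sa' ra']]].
have /PGL3_eqP[c c0 E] : piG a' = piG a by rewrite aE.
have [Oa _ _ a0 _] := sa; have [Oa' _ _ a'0 _] := sa'.
have [Oc _ _ rc] : [/\ O c, O c^-1, c != 0 & res c != 0].
  by apply: (unit_scale D Oa); rewrite -?E.
have E' : w' *m x' = (res c *: w) *m x by rewrite -ra' E (resmxZ D)// ra scalemxAl.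
have [|c' [d [c'0 d0 -> ->]]] := rank1_eq _ E'; first by rewrite -E' -ra'.
exists (c' * res c), d; split=> //; first by rewrite mulf_neq0.
by rewrite scalerA.
Qed.

Variable L : subgroup (PGL3 K).
Hypothesis Ltr : forall x y : vertex, exists2 s, (L : set _) s & y = bt_actV O s x.
Hypothesis Lfr : forall s, (L : set _) s -> forall x : vertex, bt_actV O s x = x -> s = 1%g.

Lemma act_inj (s t : PGL3 K) (x : vertex) : (L : set _) s -> (L : set _) t ->
  bt_actV O s x = bt_actV O t x -> s = t.
Proof.
move=> Ls Lt st; have E : (t^-1 * s)%g = 1%g.
  apply: (@Lfr _ _ x); first by apply: subgroupM => //; exact: subgroupV.
  by rewrite actM st -actM mulVg act1.
by rewrite -[LHS](mulVKg t) E mulg1.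
Qed.

Lemma type1_col_ex (w : 'cV[F]_3) : w != 0 -> exists s x, (L : set _) s /\ type1 s w x.
Proof.
move=> /(type1_ex D)[a [h [x [sa aE]]]]; have [s Ls sE] := Ltr o (vtx a).
have [k kK sE'] := vtx_lift sE; exists s, (x *m resmx k); split=> //.
exists (a * k)%g, (invmx k *m h); split=> //; first exact: (step_mxr D).
have [Oa _ _ _ _] := sa; have [_ Ok _] := kK.
by rewrite /= (resmxM D)// aE mulmxA.
Qed.

(** Transposition exchanges columns and rows but reverses the step, so [type1_ex] applied to the
    transpose of [x] yields the inverse of the desired element. *)
Lemma type1_row_ex (x : 'rV[F]_3) : x != 0 -> exists s w, (L : set _) s /\ type1 s w x.
Proof.
rewrite -trmx_eq0 => /(type1_ex D)[a [h [y [sa aE]]]].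
have sh := step_mx_tr sa; have [hu aTE] := step_unit D sh.
have [t Lt tE] := Ltr o (vtx (MkGL3 hu)); have [k kK tE'] := vtx_lift tE.
have sk := step_mx_sym D (step_mxr D sh kK); have [uk Ok Ovk] := kK.
have [ku _] := step_unit D sk.
exists t^-1%g, (resmx (invmx k) *m y^T); split; first exact: subgroupV.
exists (MkGL3 ku), (h^T *m k); split=> //=.
  rewrite tE' PGL3_piVg; apply/PGL3_eqP; exists pi; first exact: (dvr_pi0 D).
  by rewrite /= invmxM// aTE scalemxAr.
have [Oa _ _ _ _] := sa.
rewrite (resmxM D)//; last exact: intmx_tr.
by rewrite resmx_tr aE trmx_mul trmxK mulmxA.
Qed.

Lemma type1_col_inj s s' w x x' c : (L : set _) s -> (L : set _) s' ->
  type1 s w x -> type1 s' (c *: w) x' -> s = s'.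
Proof.
move=> Ls Ls' [a [h [aE sa ra]]] [a' [h' [a'E sa' ra']]].
apply: (act_inj (x := o)) => //; rewrite -aE -a'E !act_vtx !mulg1.
have := type1_hw D sa ra; have := type1_hw D sa' ra' => h'w hw.
have c0 : c != 0.
  have [_ _ _ + _] := sa'; rewrite ra'; apply: contra_neq => ->.
  by rewrite scale0r mul0mx.
apply: (step_vtx_inj D sa sa').
  by rewrite ra' -scalemxAl -scalemxAr mulmxA hw mul0mx scaler0.
by move: h'w; rewrite ra -scalemxAr => /eqP; rewrite scaler_eq0 (negPf c0) mulmxA => /eqP ->; rewrite mul0mx.
Qed.

(** The row of [s] determines the neighbour s^-1 o, just as the column determines s o. *)
Lemma type1_row_inj s s' w w' x c : (L : set _) s -> (L : set _) s' ->
  type1 s w x -> type1 s' w' (c *: x) -> s = s'.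
Proof.
move=> Ls Ls' t t'; have [b [a [bE sb ra]]] := type1_inv t.
have [b' [a' [b'E sb' ra']]] := type1_inv t'.
apply: invg_inj; apply: (act_inj (x := o)); try exact: subgroupV.
rewrite -bE -b'E !act_vtx !mulg1.
have := type1_xh D (step_mx_sym D sb) ra; have := type1_xh D (step_mx_sym D sb') ra' => x'b' xb.
have c0 : c != 0.
  have [_ _ _ _] := sb'; rewrite ra'; apply: contra_neq => ->.
  by rewrite scale0r mulmx0.
apply: (step_vtx_inj D sb sb').
  move: x'b'; rewrite -scalemxAl => /eqP; rewrite scaler_eq0 (negPf c0) => /eqP.
  by rewrite ra -mulmxA => ->; rewrite mulmx0.
by rewrite ra' -mulmxA -scalemxAl xb scaler0 mulmx0.
Qed.

(* Three neighbours of type 1 close up to a triangle exactly when the point w lies on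
   the line x': the incidence geometry of the link can be read in the group L. *)
Lemma type1_triangle s w x s' w' x' : (L : set _) s -> (L : set _) s' ->
  type1 s w x -> type1 s' w' x' ->
  x' *m w = 0 <-> exists s'' w'' x'', [/\ (L : set _) s'', type1 s'' w'' x'' & (s'' * s' * s)%g = 1%g].
Proof.
move=> Ls Ls' [a [h [aE sa ra]]] [a' [h' [a'E sa' ra']]].
have [rk1 /andP[rk0 rk3]] := type1_mulh D sa ra sa' ra'.
have [au hE] := step_unit D sa; have [au' hE'] := step_unit D sa'.
have [Oa Oh ah _ _] := sa; have [Oa' Oh' ah' _ _] := sa'.
have Ohh : intmx (h *m h') by exact: (intmxM D).
have rhh : resmx (h *m h') = resmx h *m resmx h' by rewrite (resmxM D).
have hhE : h *m h' = (pi * pi) *: invmx (a' *m a).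
  by rewrite hE hE' invmxM// -scalemxAl -scalemxAr scalerA.
have uaa : a' *m a \in unitmx by rewrite unitmx_mul au'.
split=> [/eqP|[s'' [w'' [x'' [Ls'' [a'' [h'' [a''E sa'' ra'']]] sss]]]]].
  rewrite -rk1 => /eqP {}rk1.
  have xw : x' *m w = 0.
    by apply/eqP; have [<- _] := type1_mulh D sa ra sa' ra'; rewrite rk1.
  have Oaa : intmx (a' *m a) by exact: (intmxM D).
  have : resmx (a' *m a) = 0.
    by rewrite (resmxM D)// ra ra' -mulmxA (mulmxA x') xw mul0mx mulmx0.
  move=> /(resmx0P D Oaa)[m Om mE].
  (* Incidence makes a' a divisible by [pi], say a' a = [pi] m; then [h *m h'] and [m] form the
     third side of the triangle. *)
  have hhm : (h *m h') *m m = pi%:M.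
    have := mulVmx uaa; rewrite {2}mE -scalemxAr hhE -scalemxAl => E.
    by rewrite -scalerA E scalemx1.
  have hh0 : resmx (h *m h') != 0.
    by rewrite rhh -mxrank_eq0 -lt0n.
  have sm : step_mx (h *m h') m.
    split=> //; apply/eqP => /(resmx0P D Om)[n On nE].
    have hhn : (h *m h') *m n = 1%:M.
      by apply: (scalerI (dvr_pi0 D)); rewrite scalemxAr -nE hhm scalemx1.
    have : resmx (h *m h') \in unitmx.
      apply: (mulmx1_unit (B := resmx n) _).1.
      by rewrite -(resmxM D)// hhn (resmx1 D).
    by rewrite -row_free_unit /row_free rhh rk1.
  have [uhh _] := step_unit D sm.
  have [w'' [x'' wxE]] : exists (w : 'cV[F]_3) (x : 'rV[F]_3), resmx (h *m h') = w *m x.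
    by apply: rank1P => //; rewrite rhh rk1.
  exists (s' * s)^-1%g, w'', x''; split; first by exact/subgroupV/subgroupM.
    exists (MkGL3 uhh), m; split=> //.
    rewrite -aE -a'E PGL3_piMg PGL3_piVg; apply/PGL3_eqP.
    by exists (pi * pi); rewrite ?mulf_neq0 ?(dvr_pi0 D).
  by rewrite -mulgA mulVg.
(* Conversely the third side is proportional to [h *m h']; both are primitive, so their residues
   have the same rank, namely 1. *)
have : piG a'' = (s' * s)^-1%g.
  by rewrite a''E; apply: (mulIg (s' * s)%g); rewrite mulVg mulgA.
rewrite -aE -a'E PGL3_piMg PGL3_piVg => /PGL3_eqP[c c0 cE].
have [Oa'' _ _ a''0 _] := sa''.
have d0 : (pi * pi) / c != 0 by rewrite !mulf_neq0 ?invr_eq0 ?(dvr_pi0 D).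
have hhE' : h *m h' = ((pi * pi) / c) *: (a'' : 'M[K]_3).
  by rewrite cE scalerA mulfVK// hhE.
have hh0 : resmx (h *m h') != 0.
  by rewrite rhh -mxrank_eq0 -lt0n.
have [Od _ _ rd] : [/\ O (pi * pi / c), O (pi * pi / c)^-1, pi * pi / c != 0 & res (pi * pi / c) != 0].
  by apply: (unit_scale D Oa'' a''0); rewrite -hhE'.
apply/eqP; rewrite -rk1 -rhh hhE' (resmxZ D)// (eqmx_scale _ rd).
by have [-> _] := type1_rank D sa'' ra''.
Qed.

Lemma adj_type1 s : (L : set _) s -> adj o (bt_actV O s o) ->
  exists w x, type1 s w x \/ type1 s^-1%g w x.
Proof.
move=> Ls /(step_adj1 D)[a [h [sa /esym/vtx_lift[k kK sE]]]].
have sk := step_mxr D sa kK.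
have [[w [x wxE]]|[w [x wxE]]] := step_type D sk; exists w, x; [left|right].
  by exists (a * k)%g, (invmx k *m h).
have [uh _] := step_unit D (step_mx_sym D sk); have [_ hE] := step_unit D sk.
exists (MkGL3 uh), (a *m k); split=> //=; last exact: (step_mx_sym D).
by rewrite sE PGL3_piVg; apply/PGL3_eqP; exists pi; first exact: (dvr_pi0 D).
Qed.

(** Adjacent vertices t o and u o differ by t^-1 u, which is of type 1 or the inverse of such an
    element; connectedness of the building does the rest. *)
Lemma type1_generate (H : set (PGL3 K)) : H 1%g ->
  (forall s t, H s -> H t -> H (s * t)%g) -> (forall s, H s -> H s^-1%g) ->
  (forall s w x, (L : set _) s -> type1 s w x -> H s) -> forall s, (L : set _) s -> H s.
Proof.
move=> H1 HM HV Ht1.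
have HE : forall x : vertex, exists t, [/\ (L : set _) t, H t & x = bt_actV O t o].
  move=> x; apply: (@bt_connected _ _ _ _ _ D x
    (fun x => exists t, [/\ (L : set _) t, H t & x = bt_actV O t o])).
    by exists 1%g; split; rewrite ?act1//; exact: subgroup1.
  move=> {x} y z yz [t [Lt Ht yE]]; have [u Lu zE] := Ltr o z; exists u; split=> //.
  have Ltu : (L : set _) (t^-1 * u)%g by apply: subgroupM => //; exact: subgroupV.
  have : adj o (bt_actV O (t^-1 * u)%g o).
    have := adj_act t^-1%g yz; rewrite yE zE -!actM mulVg act1; exact.
  move=> /(adj_type1 Ltu)[w [x [t1|t1]]].
    by rewrite -(mulVKg t u); apply: HM => //; exact: Ht1 t1.
  rewrite -(mulVKg t u); apply: HM => //; rewrite -[(_ * _)%g]invgK; apply: HV.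
  by apply: Ht1 t1; exact: subgroupV.
move=> s Ls; have [t [Lt Ht st]] := HE (bt_actV O s o).
by rewrite (act_inj Ls Lt st).
Qed.

End SimplyTransitive.

(** * Spectral gap and property (T) *)

Section DescentConstants.
Variable R : realType.

(** Factor by which one step u - B u / 2 lowers the energy: the loss is at least half of the squared
    norm of B u, hence at least k / 2 times the energy. The cap at 1 keeps the rate positive. *)
Definition descent_rate (k : R) : R := 1 - Num.min k 1 / 2.
(** With r the rate and t = (1 - r) / 2, the iterates stay within squared distance (1 + 1 / t) / (1
    - r) times the initial energy; the factor 4 leaves room for the passage to the limit. *)
Definition descent_const (k : R) : R :=
  4 * ((1 + ((1 - descent_rate k) / 2)^-1) / (1 - descent_rate k)).

Lemma descent_rate_lt k : 0 < k -> 0 < descent_rate k /\ descent_rate k < 1.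
Proof.
move=> k0; have [k1 k1'] : 0 < Num.min k 1 /\ Num.min k 1 <= 1.
  by rewrite lt_min k0 ltr01 ge_min lexx orbT.
by rewrite /descent_rate; split; lra.
Qed.
Lemma descent_const_gt0 k : 0 < k -> 0 < descent_const k.
Proof.
move=> /descent_rate_lt[_ r1]; have r0 : 0 < 1 - descent_rate k by rewrite subr_gt0.
by rewrite mulr_gt0// divr_gt0// addr_gt0// invr_gt0 divr_gt0.
Qed.

End DescentConstants.

(** * The real inner product and gradient descent *)

Section RealForm.
Variables (R : realType) (V : lmodType R[i]) (dot : {dot V for Num.conj}).

Definition rdot (u v : V) : R := Re (dot u v).
Definition rscale (r : R) (u : V) : V := r%:C%C *: u.

Lemma Re_add (x y : R[i]) : Re (x + y) = Re x + Re y. Proof. by case: x y => [? ?] [? ?]. Qed.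
Lemma Re_conj (x : R[i]) : Re (Num.conj x) = Re x. Proof. by case: x. Qed.
Lemma Re_rmul (r : R) (x : R[i]) : Re (r%:C%C * x) = r * Re x.
Proof. by case: x => a b /=; rewrite mul0r subr0. Qed.

Lemma rdotDl u v w : rdot (u + v) w = rdot u w + rdot v w.
Proof. by rewrite /rdot linearDl Re_add. Qed.
Lemma rdotC u v : rdot u v = rdot v u.
Proof. by rewrite /rdot hermC expr0 mul1r Re_conj. Qed.
Lemma rdotZl r u v : rdot (rscale r u) v = r * rdot u v.
Proof. by rewrite /rdot linearZl_LR Re_rmul. Qed.
Lemma dotE u : dot u u = (rdot u u)%:C%C.
Proof.
have := dnorm_ge0 dot u; rewrite /rdot; case: (dot u u) => a b.
by rewrite lecE /= => /andP[/eqP -> _].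
Qed.
Lemma rdot_ge0 u : 0 <= rdot u u.
Proof. by have := dnorm_ge0 dot u; rewrite dotE ler0c. Qed.
Lemma rdot_eq0 u : rdot u u = 0 -> u = 0.
Proof. by move=> u0; apply/eqP; rewrite -(dnorm_eq0 dot) dotE u0. Qed.
Lemma rdotDr u v w : rdot u (v + w) = rdot u v + rdot u w.
Proof. by rewrite rdotC rdotDl !(rdotC _ u). Qed.
Lemma rdotZr r u v : rdot u (rscale r v) = r * rdot u v.
Proof. by rewrite rdotC rdotZl rdotC. Qed.
Lemma rscaleN1 u : - u = rscale (-1) u.
Proof. by rewrite /rscale -scaleN1r; congr (_ *: _); apply/eqP; rewrite eq_complex /= oppr0 !eqxx. Qed.
Lemma rdotNl u v : rdot (- u) v = - rdot u v.
Proof. by rewrite rscaleN1 rdotZl mulN1r. Qed.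
Lemma rdotNr u v : rdot u (- v) = - rdot u v.
Proof. by rewrite rdotC rdotNl rdotC. Qed.
Lemma rdotBl u v w : rdot (u - v) w = rdot u w - rdot v w.
Proof. by rewrite rdotDl rdotNl. Qed.
Lemma rdotBr u v w : rdot u (v - w) = rdot u v - rdot u w.
Proof. by rewrite rdotDr rdotNr. Qed.
Lemma rdot0l u : rdot 0 u = 0.
Proof. by rewrite -(subrr u) rdotBl subrr. Qed.
Lemma rdot_suml (I : Type) (r : seq I) (P : pred I) (f : I -> V) v :
  rdot (\sum_(i <- r | P i) f i) v = \sum_(i <- r | P i) rdot (f i) v.
Proof. by apply: (big_morph (fun u => rdot u v)) => [? ?|]; [exact: rdotDl|exact: rdot0l]. Qed.
Lemma rdot_sumr (I : Type) (r : seq I) (P : pred I) (f : I -> V) v :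
  rdot v (\sum_(i <- r | P i) f i) = \sum_(i <- r | P i) rdot v (f i).
Proof. by rewrite rdotC rdot_suml; apply: eq_bigr => i _; rewrite rdotC. Qed.

Lemma rnormD u v : rdot (u + v) (u + v) = rdot u u + 2 * rdot u v + rdot v v.
Proof. by rewrite !rdotDl !rdotDr (rdotC v u); ring. Qed.
Lemma rnormB u v : rdot (u - v) (u - v) = rdot u u - 2 * rdot u v + rdot v v.
Proof. by rewrite !rdotBl !rdotBr (rdotC v u); ring. Qed.

(** Expand the squared norm of t u - v and divide by t. *)
Lemma rnormD_le t u v : 0 < t ->
  rdot (u + v) (u + v) <= (1 + t) * rdot u u + (1 + t^-1) * rdot v v.
Proof.
move=> t0; have := rdot_ge0 (rscale t u - v).
rewrite rnormB !rdotZl rdotZr => h; rewrite rnormD -subr_ge0.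
have -> : (1 + t) * rdot u u + (1 + t^-1) * rdot v v - (rdot u u + 2 * rdot u v + rdot v v)
  = t^-1 * (t * (t * rdot u u) - 2 * (t * rdot u v) + rdot v v) by field; rewrite gt_eqF.
by rewrite mulr_ge0// invr_ge0 ltW.
Qed.

(* Gradient descent v, v - B v / 2, ... for the energy rdot (B v) v. *)
Lemma descent (k : R) : 0 < k -> hilbert_complete dot -> forall B : V -> V,
  (forall u v, B (u - v) = B u - B v) ->
  (forall r u, B (rscale r u) = rscale r (B u)) ->
  (forall u v, rdot (B u) v = rdot u (B v)) ->
  (forall u, 0 <= rdot (B u) u <= 2 * rdot u u) ->
  (forall u, k * rdot (B u) u <= rdot (B u) (B u)) ->
  forall v, exists w, rdot (B w) w = 0 /\ rdot (w - v) (w - v) <= descent_const k * rdot (B v) v.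
Proof.
move=> k0; pose r := descent_rate k; pose t := (1 - r) / 2.
have [k1 k1'] : 0 < Num.min k 1 /\ Num.min k 1 <= 1 by rewrite lt_min k0 ltr01 ge_min lexx orbT.
have [r0 r1] := descent_rate_lt k0; rewrite -/r in r0 r1.
have t0 : 0 < t by rewrite /t; lra.
have tr : (1 + t) * r <= 1 - (1 - r) / 2.
  by rewrite /t; nra.
pose C := (1 + t^-1) / (1 - r).
have C0 : 0 < C by rewrite divr_gt0// ?subr_gt0// addr_gt0// invr_gt0.
have CE4 : descent_const k = 4 * C by [].
rewrite CE4.
move=> hc B raddfB BZ BC B2 Bk v.
have B0 : B 0 = 0 by rewrite -[X in B X](subrr 0) raddfB subrr.
have raddfD u w : B (u + w) = B u + B w.
  by rewrite -[X in B (u + X)]opprK raddfB -(sub0r w) raddfB B0 sub0r opprK.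
pose E u := rdot (B u) u.
pose s u := u - rscale 2^-1 (B u).
have EsE u : E (s u) = E u - rdot (B u) (B u) + 4^-1 * E (B u).
  rewrite /E /s raddfB BZ !rdotBl !rdotBr !rdotZl !rdotZr (BC (B u) u).
  by rewrite /=; lra.
(* Nonnegativity of the energy after one step bounds the gradient by the energy. *)
have BB u : rdot (B u) (B u) <= 2 * E u.
  have /andP[+ _] := B2 (s u); rewrite -/(E _) EsE; have /andP[_] := B2 (B u); rewrite -/(E _).
  by move: (E _) (E _) (rdot _ _) => *; lra.
have Es u : E (s u) <= r * E u.
  have kE : Num.min k 1 * E u <= rdot (B u) (B u).
    apply: le_trans (Bk u); apply: ler_wpM2r; first by have /andP[] := B2 u.
    by rewrite ge_min lexx.
  rewrite EsE; have /andP[_] := B2 (B u); rewrite -/(E _) /r /descent_rate => h.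
  move: h kE; move: (E (B u)) (E u) (rdot _ _) (Num.min k 1) => a b c d *; lra.
pose x n := iter n s v.
have E0 n : 0 <= E (x n) by have /andP[] := B2 (x n).
(* Telescoping with weight t at each step: the energy shrinks by r, and (1 + t) r stays far enough
   below 1 for the same constant to be inherited. *)
have xE n m : rdot (x (n + m)%N - x m) (x (n + m)%N - x m) <= C * E (x m).
  elim: n m => [|n IH] m; first by rewrite add0n subrr rdot0l mulr_ge0// ltW.
  rewrite addSnnS; have -> : x (n + m.+1)%N - x m = (x (n + m.+1)%N - x m.+1) + (x m.+1 - x m).
    by rewrite addrA subrK.
  apply: le_trans (rnormD_le _ _ t0) _.
  have h1 : rdot (x m.+1 - x m) (x m.+1 - x m) <= 2^-1 * E (x m).
    have -> : x m.+1 - x m = - rscale 2^-1 (B (x m)).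
      by rewrite /x iterS /s addrAC subrr sub0r.
    rewrite rdotNl rdotNr opprK rdotZl rdotZr; have := BB (x m); lra.
  have h2 := IH m.+1; have h3 := Es (x m); rewrite -[s _]/(x m.+1) in h3.
  have tV : 0 < t^-1 by rewrite invr_gt0.
  have CE : C * (1 - r) = 1 + t^-1 by rewrite /C mulfVK// subr_eq0 gt_eqF.
  have h4 : (1 + t) * rdot (x (n + m.+1)%N - x m.+1) (x (n + m.+1)%N - x m.+1)
      <= (1 + t) * (C * (r * E (x m))).
    rewrite ler_pM2l ?addr_gt0//; apply: le_trans h2 _.
    by rewrite ler_pM2l.
  have h5 : (1 + t^-1) * rdot (x m.+1 - x m) (x m.+1 - x m) <= (1 + t^-1) * (2^-1 * E (x m)).
    by rewrite ler_pM2l// addr_gt0.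
  have h6 : (1 + t) * (C * (r * E (x m))) + (1 + t^-1) * (2^-1 * E (x m)) <= C * E (x m).
    rewrite -CE; have -> : (1 + t) * (C * (r * E (x m))) + C * (1 - r) * (2^-1 * E (x m))
      = C * E (x m) * ((1 + t) * r + (1 - r) / 2) by field.
    have h7 : 0 <= C * E (x m) by rewrite mulr_ge0// ltW.
    by rewrite -[leRHS]mulr1 ler_wpM2l//; lra.
  lra.
have EX n : E (x n) <= r ^+ n * E v.
  elim: n => [|n IH]; first by rewrite expr0 mul1r.
  apply: le_trans (Es _) _; rewrite exprS -mulrA; by apply: ler_wpM2l => //; exact: ltW.
have small e : 0 < e -> exists N, forall n, (N <= n)%N -> E (x n) < e.
  move=> e0; have [N NE] : exists N, r ^+ N * E v < e.
    have rn : `|r| < 1 by rewrite gtr0_norm.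
    have [N _ NP] : \forall n \near \oo, `|geometric (E v) r n| < e.
      by apply: (cvgr0_norm_lt (fun _ => _ : R^o)) => //; exact: cvg_geometric.
    by exists N; rewrite mulrC; apply: le_lt_trans (ler_norm _) (NP N (leqnn _)).
  exists N => n Nn; apply: le_lt_trans (EX n) _; apply: le_lt_trans NE.
  apply: ler_wpM2r; first exact: (E0 0%N).
  by apply: ler_wiXn2l => //; exact: ltW.
have symx m n : rdot (x m - x n) (x m - x n) = rdot (x n - x m) (x n - x m).
  by rewrite -opprB rdotNl rdotNr opprK.
have [|l lP] := hc x.
  move=> e e0; have [e1 eE] : 0 < Re e /\ e = (Re e)%:C%C.
    by move: e0; case: e => a b; rewrite ltcE /= => /andP[/eqP -> ->].
  have [|N NP] := small (Re e / C); first by rewrite divr_gt0.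
  exists N => m n Nm Nn; rewrite dotE eE ltcR.
  have H i j : (N <= i)%N -> rdot (x (j + i)%N - x i) (x (j + i)%N - x i) < Re e.
    by move=> Ni; apply: le_lt_trans (xE j i) _; rewrite mulrC -ltr_pdivlMr//; exact: NP.
  have [mn|/ltnW nm] := leqP m n.
    by rewrite symx -(subnK mn); exact: H.
  by rewrite -(subnK nm); exact: H.
have lim e : 0 < e -> exists n, rdot (x n - l) (x n - l) < e /\ E (x n) < e.
  move=> e0; have [|N NP] := lP e%:C%C; first by rewrite ltcR.
  have [M MP] := small e e0; exists (maxn N M); split; last exact/MP/leq_maxr.
  by rewrite -ltcR -dotE; exact/NP/leq_maxl.
(* The parallelogram inequality for the energy plays the role of continuity: it bounds the energy of
   the limit by those of an iterate and of the difference. *)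
have par u w : E (u + w) <= 2 * E u + 2 * E w.
  have /andP[+ _] := B2 (u - w); rewrite /E raddfB raddfD.
  by rewrite !(rdotDl, rdotDr, rdotNl, rdotNr) => h; lra.
exists l; split.
  apply/eqP; rewrite eq_le (andP (B2 l)).1 andbT; apply/ler_addgt0Pr => e e0; rewrite add0r.
  have [|n [n1 n2]] := lim (e / 8); first by rewrite divr_gt0.
  have := par (x n) (l - x n); rewrite addrC subrK => h.
  have /andP[_] := B2 (l - x n); rewrite -/(E _) -(opprB (x n)) rdotNl rdotNr opprK => h2.
  rewrite -/(E _); rewrite -(opprB (x n)) in h; lra.
apply/ler_addgt0Pr => e e0.
have [|n [n1 n2]] := lim (e / 2); first by rewrite divr_gt0.
have h1 := xE n 0%N; rewrite addn0 in h1.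
have := @rnormD_le 1 (l - x n) (x n - v) ltr01; rewrite addrA subrK invr1.
rewrite -(opprB (x n)) rdotNl rdotNr opprK => h2.
have := E0 0%N; rewrite /E /= in h1 * => h3; have : 0 <= C * rdot (B v) v by rewrite mulr_ge0// ltW.
move=> h4; apply: le_trans h2 _; rewrite [x _]/= in h1; lra.
Qed.

End RealForm.

(** * A Poincaré inequality on the projective plane over a finite field *)

Section Plane.
Variables (F : finFieldType).
Local Notation q := #|F|.

Lemma card_ker k (A : 'M[F]_(3, k)) : #|[set x : 'rV[F]_3 | x *m A == 0]%SET| = (q ^ (3 - \rank A))%N.
Proof.
pose B := row_base (kermx A).
have rB : row_free B by exact: row_base_free.
have -> : [set x : 'rV[F]_3 | x *m A == 0]%SET = [set y *m B | y : 'rV[F]_(\rank (kermx A))]%SET.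
  apply/setP => x; rewrite inE -sub_kermx -(eq_row_base (kermx A)).
  apply/submxP/imsetP => [[y ->]|[y _ ->]]; by exists y.
rewrite card_imset ?card_mx ?mul1n ?mxrank_ker//.
exact: row_free_inj.
Qed.

Lemma card_ker0 k (A : 'M[F]_(3, k)) :
  #|[pred x : 'rV[F]_3 | (x != 0) && (x *m A == 0)]| = (q ^ (3 - \rank A)).-1.
Proof.
rewrite -(card_ker A) (cardsD1 0) inE mul0mx eqxx add1n /=.
by apply: eq_card => x; rewrite !inE.
Qed.

Lemma rank_par (w w' : 'cV[F]_3) : w != 0 -> w' != 0 ->
  \rank (row_mx w w') = (if [exists c, w' == c *: w] then 1 else 2)%N.
Proof.
move=> w0 w'0; rewrite -mxrank_tr tr_row_mx -addsmxE.
have rw : \rank w^T = 1%N by rewrite rank_rV trmx_eq0 w0.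
have rw' : \rank w'^T = 1%N by rewrite rank_rV trmx_eq0 w'0.
case: ifPn => [/existsP[c /eqP ->]|npar].
  rewrite -[RHS]rw; apply: eqmx_rank; apply/eqmxP; apply: addsmx_idPl.
  by rewrite linearZ /= scalemx_sub.
apply/eqP; rewrite eqn_leq; apply/andP; split.
  by rewrite (leq_trans (mxrank_adds_leqif _ _))// rw rw'.
rewrite ltnNge; apply: contra npar => r1.
have /mxrank_leqif_sup[_] := addsmxSl w^T w'^T.
rewrite rw eqn_leq r1 andbT -{1}rw mxrankS ?addsmxSl// => /esym.
move=> /(submx_trans (addsmxSr _ _))/sub_rVP[c cE]; apply/existsP; exists c.
by apply/eqP/trmx_inj; rewrite cE linearZ.
Qed.

Lemma sum_par (V : nmodType) (w : 'cV[F]_3) (u : 'cV[F]_3 -> V) : w != 0 ->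
  (forall c, c != 0 -> u (c *: w) = u w) ->
  \sum_(w' | (w' != 0) && [exists c, w' == c *: w]) u w' = u w *+ q.-1.
Proof.
move=> w0 uw; have [i wi] : exists i, w i 0 != 0.
  apply: contrapT => /forallNP h; move/eqP: w0; apply; apply/colP => i.
  by rewrite mxE; apply/eqP; apply: contrapT => /negP/h.
rewrite (reindex_onto (fun c => c *: w) (fun w' => w' i 0 / w i 0)); last first.
  by move=> w' /andP[_ /existsP[c /eqP ->]]; rewrite mxE mulfK.
rewrite (eq_bigl (predC1 0)) => [|c]; last first.
  rewrite /= mxE mulfK// eqxx andbT scaler_eq0 negb_or w0 andbT.
  by case: (c != 0) => //=; apply/existsP; exists c.
rewrite (eq_bigr (fun _ => u w)) => [|c c0]; last exact: uw.
by rewrite sumr_const cardC1.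
Qed.

Variable R : realType.
Local Notation qR := (q%:R : R).
Definition inc (x : 'rV[F]_3) (w : 'cV[F]_3) : R := (x *m w == 0)%:R.

Lemma q_gt1 : (1 < q)%N. Proof. exact: card_finNzRing_gt1. Qed.

Lemma count_rows : \sum_(x : 'rV[F]_3 | x != 0) 1 = qR ^+ 3 - 1.
Proof.
rewrite sumr_const cardC1 card_mx mul1n -natrX -[in RHS](prednK (_ : 0 < q ^ 3)%N).
  by rewrite -natr1 addrK.
by rewrite expn_gt0 (ltnW q_gt1).
Qed.
Lemma count_cols : \sum_(x : 'cV[F]_3 | x != 0) 1 = qR ^+ 3 - 1.
Proof.
rewrite sumr_const cardC1 card_mx -natrX -[in RHS](prednK (_ : 0 < q ^ 3)%N).
  by rewrite -natr1 addrK muln1.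
by rewrite expn_gt0 (ltnW q_gt1).
Qed.

Lemma sum_ker k (A : 'M[F]_(3, k)) :
  \sum_(x : 'rV[F]_3 | x != 0) (x *m A == 0)%:R = qR ^+ (3 - \rank A) - 1.
Proof.
rewrite (eq_bigr (fun x => if x *m A == 0 then 1 else 0)) => [|x _]; last by case: eqP.
rewrite -big_mkcondr sumr_const card_ker0 -natrX -[in RHS](prednK (_ : 0 < q ^ _)%N).
  by rewrite -natr1 addrK.
by rewrite expn_gt0 (ltnW q_gt1).
Qed.

Lemma sum_inc w : w != 0 -> \sum_(x | x != 0) inc x w = qR ^+ 2 - 1.
Proof. by move=> w0; rewrite sum_ker -mxrank_tr rank_rV trmx_eq0 w0. Qed.

Lemma sum_inc' x : x != 0 -> \sum_(w | w != 0) inc x w = qR ^+ 2 - 1.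
Proof.
move=> x0; rewrite -(@sum_inc x^T) ?trmx_eq0//.
rewrite [RHS](reindex (@trmx F 3 1)); last by exists trmx => ? _; rewrite trmxK.
apply: eq_big => [w|w _]; first by rewrite trmx_eq0.
by rewrite /inc -trmx_mul trmx_eq0.
Qed.

(** The rows killed by both columns form a space of dimension 2 for proportional columns and 1
    otherwise: two distinct points lie on exactly one line. *)
Lemma sum_inc2 w w' : w != 0 -> w' != 0 -> \sum_(x | x != 0) inc x w * inc x w' =
  qR - 1 + (if [exists c, w' == c *: w] then qR ^+ 2 - qR else 0).
Proof.
move=> w0 w'0; transitivity (\sum_(x : 'rV[F]_3 | x != 0) (x *m row_mx w w' == 0)%:R : R).
  apply: eq_bigr => x _; rewrite /inc mul_mx_row -natrM mulnb.
  congr (_ %:R); congr (nat_of_bool _).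
  apply/andP/eqP => [[/eqP -> /eqP ->]|/eqP]; first by rewrite row_mx0.
  by rewrite row_mx_eq0 => /andP[].
by rewrite sum_ker rank_par//; case: ifP => _ /=; ring.
Qed.

Section Poincare.
Variables (V : lmodType R[i]) (dot : {dot V for Num.conj}).
Local Notation b := (rdot dot).
Variables (f : 'cV[F]_3 -> V) (g : 'rV[F]_3 -> V).
Hypothesis fZ : forall c w, c != 0 -> w != 0 -> f (c *: w) = f w.

Let N : R := qR ^+ 3 - 1.
Let Dg : R := qR ^+ 2 - 1.
(** The second singular value of the incidence matrix: sqrt q for the plane itself, times q - 1
    because each point is counted q - 1 times. *)
Let alpha : R := Num.sqrt qR * (qR - 1).
Let Fs := \sum_(w | w != 0) f w.
Let Gs := \sum_(x | x != 0) g x.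
Let h x := \sum_(w | w != 0) rscale (inc x w) (f w).

Lemma qR_gt1 : 1 < qR. Proof. by rewrite ltr1n q_gt1. Qed.

Lemma sum_hh : \sum_(x | x != 0) b (h x) (h x) =
  (qR - 1) * b Fs Fs + (qR ^+ 2 - qR) * (qR - 1) * \sum_(w | w != 0) b (f w) (f w).
Proof.
transitivity (\sum_(w | w != 0) \sum_(w' | w' != 0)
    (\sum_(x | x != 0) inc x w * inc x w') * b (f w) (f w')).
  under eq_bigr => x _ do (rewrite rdot_suml; under eq_bigr => w _ do rewrite rdot_sumr).
  rewrite exchange_big; apply: eq_bigr => w _; rewrite exchange_big; apply: eq_bigr => w' _.
  by rewrite mulr_suml; apply: eq_bigr => x _; rewrite rdotZl rdotZr mulrA.
rewrite rdot_suml mulr_sumr [X in _ + X]mulr_sumr -big_split /=; apply: eq_bigr => w w0.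
rewrite rdot_sumr mulr_sumr.
have -> : (qR ^+ 2 - qR) * (qR - 1) * b (f w) (f w) =
    \sum_(w' | (w' != 0) && [exists c, w' == c *: w]) (qR ^+ 2 - qR) * b (f w) (f w').
  rewrite (sum_par (u := fun w' => (qR ^+ 2 - qR) * b (f w) (f w')) w0) => [|c c0]; last by rewrite fZ.
  by rewrite -[RHS]mulr_natr -subn1 natrB ?(ltnW q_gt1)//; ring.
rewrite big_mkcondr -big_split; apply: eq_bigr => w' w'0 /=.
by rewrite sum_inc2//; case: ifP => _; ring.
Qed.

Lemma sum_h v : \sum_(x | x != 0) b (h x) v = Dg * b Fs v.
Proof.
under eq_bigr do rewrite rdot_suml.
rewrite exchange_big rdot_suml mulr_sumr; apply: eq_bigr => w w0.
by rewrite /Dg -(sum_inc w0) mulr_suml; apply: eq_bigr => x _; rewrite rdotZl.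
Qed.

(** Completing the square: the sum over x of the squared norms of (h x - mean) - [alpha] (g x -
    mean) is nonnegative. The mean of h is [Dg / N] times [Fs], since every point lies on [Dg]
    rows. *)
Lemma poincare :
  2 * (\sum_(x | x != 0) \sum_(w | w != 0) inc x w * b (f w) (g x)) <=
  2 * (Dg / N) * b Fs Gs + alpha *
    (\sum_(w | w != 0) b (f w) (f w) - b Fs Fs / N +
     (\sum_(x | x != 0) b (g x) (g x) - b Gs Gs / N)).
Proof.
have q1 := qR_gt1; have q0 : 0 < qR by apply: lt_trans q1.
have N0 : 0 < N by rewrite subr_gt0 exprn_egt1.
have a0 : 0 < alpha by rewrite mulr_gt0 ?sqrtr_gt0// subr_gt0.
have a2 : alpha ^+ 2 = qR * (qR - 1) ^+ 2 by rewrite exprMn sqr_sqrtr// ltW.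
set S := \sum_(x | x != 0) \sum_(w | w != 0) _.
have SE : S = \sum_(x | x != 0) b (h x) (g x).
  by apply: eq_bigr => x _; rewrite rdot_suml; apply: eq_bigr => w _; rewrite rdotZl.
set Sf := \sum_(w | w != 0) _; set Sg := \sum_(x | x != 0) b _ _.
pose y x := (h x - rscale (Dg / N) Fs) - rscale alpha (g x - rscale N^-1 Gs).
have : 0 <= \sum_(x | x != 0) b (y x) (y x) by apply: sumr_ge0 => x _; exact: rdot_ge0.
have -> : \sum_(x | x != 0) b (y x) (y x) =
  (\sum_(x | x != 0) b (h x) (h x)) + alpha ^+ 2 * Sg
  + - (2 * alpha) * (\sum_(x | x != 0) b (h x) (g x))
  + - (2 * (Dg / N)) * (\sum_(x | x != 0) b (h x) Fs)
  + 2 * alpha * N^-1 * (\sum_(x | x != 0) b (h x) Gs)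
  + 2 * alpha * (Dg / N) * (\sum_(x | x != 0) b (g x) Fs)
  + - (2 * alpha ^+ 2 * N^-1) * (\sum_(x | x != 0) b (g x) Gs)
  + ((Dg / N) ^+ 2 * b Fs Fs - 2 * alpha * (Dg / N) * N^-1 * b Fs Gs
     + alpha ^+ 2 * N^-1 ^+ 2 * b Gs Gs) * (\sum_(x : 'rV[F]_3 | x != 0) 1).
  rewrite !mulr_sumr -!big_split /=; apply: eq_bigr => x _; rewrite /y.
  rewrite !(rdotBl, rdotBr, rdotZl, rdotZr) (rdotC _ (g x) (h x)) (rdotC _ Fs (h x)) (rdotC _ Gs (h x)).
  by rewrite (rdotC _ Fs (g x)) (rdotC _ Gs (g x)) (rdotC _ Gs Fs); ring.
rewrite -SE sum_hh !sum_h -!rdot_suml -/Gs count_rows -/N -/Sf (rdotC _ Gs Fs).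
move: S Sf Sg (b Fs Fs) (b Fs Gs) (b Gs Gs) SE => S' Sf' Sg' ff fg gg _.
(* Separation of [sum_hh] into the part of mean zero, scaled by [alpha ^+ 2], and the constant
   part. *)
have E1 : (qR - 1) * ff + (qR ^+ 2 - qR) * (qR - 1) * Sf' =
     alpha ^+ 2 * (Sf' - ff / N) + Dg ^+ 2 / N * ff.
  by rewrite a2 /Dg /N; field; rewrite -/N gt_eqF.
rewrite E1; set e := (e in 0 <= e -> _).
have -> : e = alpha * (2 * (Dg / N) * fg + alpha * (Sf' - ff / N + (Sg' - gg / N)) - 2 * S').
  by rewrite /e; field; rewrite gt_eqF.
by rewrite pmulr_rge0// subr_ge0.
Qed.

End Poincare.
End Plane.

(** * Property (T) from generators indexed by points and lines *)

Section PropertyT.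
Variables (R : realType) (F : finFieldType) (G : groupType).
Variables (phi : 'cV[F]_3 -> G) (chi : 'rV[F]_3 -> G).
Local Notation q := #|F|.
Local Notation qR := (q%:R : R).
Hypothesis phiZ : forall c w, c != 0 -> w != 0 -> phi (c *: w) = phi w.
Hypothesis phi_chi : perm_eq [seq phi w | w <- enum (predC1 0)] [seq chi x | x <- enum (predC1 0)].
Hypothesis triangle : forall x w, x != 0 -> w != 0 ->
  #|[pred w' : 'cV[F]_3 | (w' != 0) && (phi w' * chi x * phi w == 1)%g]| =
  (if x *m w == 0 then q.-1 else 0%N).
Hypothesis phi_gen : forall P : G -> Prop, P 1%g ->
  (forall g h, P g -> P h -> P (g * h)%g) -> (forall g, P g -> P g^-1%g) ->
  (forall w, w != 0 -> P (phi w)) -> forall g, P g.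

Lemma sum_phi_chi (V : nmodType) (u : G -> V) :
  \sum_(w | w != 0) u (phi w) = \sum_(x | x != 0) u (chi x).
Proof.
transitivity (\sum_(g <- [seq phi w | w <- enum (predC1 0)]) u g).
  by rewrite big_map big_enum; apply: eq_bigl.
by rewrite (perm_big _ phi_chi) big_map big_enum; apply: eq_bigl.
Qed.

Section Representation.
Variables (V : lmodType R[i]) (dot : {dot V for Num.conj}) (rho : unitary_rep G dot).
Local Notation b := (rdot dot).
Let N : R := qR ^+ 3 - 1.
Let Dg : R := qR ^+ 2 - 1.

Lemma rho_dot g u v : b (rho g u) (rho g v) = b u v.
Proof. by rewrite /rdot rep_dot. Qed.
Lemma rho_adj g u v : b (rho g u) v = b u (rho g^-1%g v).
Proof. by rewrite -(rho_dot g^-1%g) -repM mulVg rep1. Qed.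

Definition fsum v := \sum_(w | w != 0) rho (phi w) v.
Definition bsum v := \sum_(w | w != 0) rho (phi w)^-1%g v.
(** The Laplacian normalized by the [2 * N] generators and inverses, counted with multiplicity. *)
Definition lapl v := v - rscale (2 * N)^-1 (fsum v + bsum v).

Lemma fbsum u v : b (fsum u) v = b u (bsum v).
Proof. by rewrite rdot_suml rdot_sumr; apply: eq_bigr => w _; exact: rho_adj. Qed.

Let N0 : 0 < N.
Proof. by rewrite subr_gt0 exprn_egt1// qR_gt1. Qed.

Lemma laplB u v : lapl (u - v) = lapl u - lapl v.
Proof.
have fB : fsum (u - v) = fsum u - fsum v.
  by rewrite /fsum -sumrB; apply: eq_bigr => w _; rewrite linearB.
have bB : bsum (u - v) = bsum u - bsum v.
  by rewrite /bsum -sumrB; apply: eq_bigr => w _; rewrite linearB.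
have E : fsum u - fsum v + (bsum u - bsum v) = (fsum u + bsum u) - (fsum v + bsum v).
  by rewrite opprD addrACA.
rewrite /lapl fB bB E /rscale scalerBr opprB [X in _ + X]addrC addrACA; congr (_ + _).
by rewrite opprB addrC.
Qed.
Lemma laplZ r u : lapl (rscale r u) = rscale r (lapl u).
Proof.
have fZ : fsum (rscale r u) = rscale r (fsum u).
  by rewrite /fsum /rscale scaler_sumr; apply: eq_bigr => w _; rewrite linearZ.
have bZ : bsum (rscale r u) = rscale r (bsum u).
  by rewrite /bsum /rscale scaler_sumr; apply: eq_bigr => w _; rewrite linearZ.
rewrite /lapl fZ bZ /rscale -scalerDr !scalerA scalerBr; congr (_ - _).
by rewrite scalerA mulrC.
Qed.
Lemma laplE u v : b (lapl u) v = b u v - (2 * N)^-1 * (b (fsum u) v + b (bsum u) v).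
Proof. by rewrite /lapl rdotBl rdotZl rdotDl. Qed.
Lemma lapl_sym u v : b (lapl u) v = b u (lapl v).
Proof.
rewrite [RHS]rdotC !laplE (rdotC _ v u) (fbsum u v) (rdotC _ (bsum u)) -(fbsum v u).
by rewrite (rdotC _ u (bsum v)) [X in _ - _ * X]addrC.
Qed.
Lemma lapl_energy u : b (lapl u) u =
  (2 * N)^-1 * \sum_(w | w != 0) b (u - rho (phi w) u) (u - rho (phi w) u).
Proof.
under eq_bigr => w _ do rewrite rnormB rho_dot.
have -> : \sum_(w | w != 0) (b u u - 2 * b u (rho (phi w) u) + b u u) =
    2 * b u u * (\sum_(w : 'cV[F]_3 | w != 0) 1) - 2 * b u (fsum u).
  rewrite rdot_sumr !mulr_sumr -sumrB; apply: eq_bigr => w _; ring.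
rewrite count_cols -/N laplE (rdotC _ (bsum u)) -fbsum (rdotC _ (fsum u)).
by field; rewrite gt_eqF.
Qed.
Lemma lapl_bound u : 0 <= b (lapl u) u <= 2 * b u u.
Proof.
apply/andP; split.
  rewrite lapl_energy mulr_ge0 ?invr_ge0 ?mulr_ge0 ?(ltW N0)//.
  by apply: sumr_ge0 => w _; exact: rdot_ge0.
have h w : - b u u <= b u (rho (phi w) u).
  by have := rdot_ge0 dot (u + rho (phi w) u); rewrite rnormD rho_dot; lra.
have : - b u u * N <= b u (fsum u).
  rewrite /N -count_cols mulr_sumr rdot_sumr; apply: ler_sum => w _.
  by rewrite mulr1.
rewrite laplE (rdotC _ (bsum u)) -fbsum (rdotC _ (fsum u)) -ler_pdivlMr//.
have -> : (2 * N)^-1 * (b u (fsum u) + b u (fsum u)) = b u (fsum u) / N by field; rewrite gt_eqF.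
by lra.
Qed.

(** For an incident pair the product chi x phi w is the inverse of some phi w', so the inner product
    depends on w' alone. Each w' arises equally often, which reduces a sum over edges of the link to
    a sum over generators. *)
Lemma triangle_sum v : \sum_(x | x != 0) \sum_(w | w != 0)
    inc R x w * b (rho (phi w) v) (rho (chi x)^-1%g v) = Dg * b (fsum v) v.
Proof.
have q1 : 0 < qR - 1 by rewrite subr_gt0 qR_gt1.
have qE : (q.-1)%:R = qR - 1 by rewrite -subn1 natrB// ltnW// q_gt1.
have tri x w : x != 0 -> w != 0 -> (qR - 1) * inc R x w =
    \sum_(w' | w' != 0) (phi w' * chi x * phi w == 1)%g%:R.
  move=> x0 w0; rewrite (eq_bigr (fun w' => if (phi w' * chi x * phi w == 1)%g then 1 else 0)).
    rewrite -big_mkcondr sumr_const triangle// /inc; case: ifP => _; rewrite ?mulr0//.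
    by rewrite mulr1 qE.
  by move=> w' _; case: ifP.
(* Write phi w' = chi x1 and rotate the relation cyclically: the count for fixed w' becomes [tri]
   for the row x1. *)
have c2 w' : w' != 0 -> \sum_(x | x != 0) \sum_(w | w != 0)
    (phi w' * chi x * phi w == 1)%g%:R = (qR - 1) * Dg :> R.
  move=> w'0.
  rewrite -(sum_phi_chi (fun g => \sum_(w | w != 0) (phi w' * g * phi w == 1)%g%:R)).
  have [x1 x10 x1E] : exists2 x, x != 0 & phi w' = chi x.
    have : phi w' \in [seq phi w | w <- enum (predC1 0)] by apply: map_f; rewrite mem_enum.
    by rewrite (perm_mem phi_chi) => /mapP[x]; rewrite mem_enum => x0 E; exists x.
  rewrite /Dg -(sum_inc' R x10) mulr_sumr; apply: eq_bigr => w1 w10.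
  rewrite tri// x1E; apply: eq_bigr => w _; congr (_ %:R); congr (nat_of_bool _).
  apply/eqP/eqP => E.
    by apply: (mulgI (phi w)^-1%g); rewrite mulg1 -[RHS]mul1g -E !mulgA mulVg mul1g mulgK.
  by rewrite -(mulVg (phi w)) -[X in _ = (_ * X)%g]mul1g -E !mulgA mulVg mul1g.
have q10 : qR - 1 != 0 by rewrite gt_eqF.
apply: (mulfI q10); rewrite mulr_sumr.
transitivity (\sum_(x | x != 0) \sum_(w | w != 0) \sum_(w' | w' != 0)
    (phi w' * chi x * phi w == 1)%g%:R * b v (rho (phi w') v)).
  apply: eq_bigr => x x0; rewrite mulr_sumr; apply: eq_bigr => w w0.
  rewrite mulrA tri// mulr_suml; apply: eq_bigr => w' _.
  case: eqP => [E|_]; last by rewrite !mul0r.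
  rewrite !mul1r rdotC rho_adj invgK -repM.
  have -> : (chi x * phi w = (phi w')^-1)%g by apply: (mulgI (phi w')); rewrite mulgA E mulgV.
  by rewrite -rho_adj rdotC.
under eq_bigr do rewrite exchange_big.
rewrite exchange_big rdot_suml !mulr_sumr; apply: eq_bigr => w' w'0.
under eq_bigr do rewrite -mulr_suml.
by rewrite -mulr_suml c2// (rdotC _ v) mulrA.
Qed.

Let lam : R := Num.sqrt qR / (qR + 1).

(* lam = sqrt q / (q + 1) is the second eigenvalue of the incidence graph of the
   projective plane over F; it is less than 1/2. *)
Lemma lapl_gap v : (1 - 2 * lam) * b (lapl v) v <= (1 - lam) * b (lapl v) (lapl v).
Proof.
have q1 := qR_gt1 F R; have q0 : 0 < qR by apply: lt_trans q1.
have D0 : 0 < Dg by rewrite subr_gt0 exprn_egt1.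
have phiZ' c w : c != 0 -> w != 0 -> rho (phi (c *: w)) v = rho (phi w) v.
  by move=> c0 w0; rewrite phiZ.
have := poincare dot (f := fun w => rho (phi w) v) (fun x => rho (chi x)^-1%g v) phiZ'.
rewrite triangle_sum -/N -/Dg -/(fsum v).
have -> : \sum_(x | x != 0) rho (chi x)^-1%g v = bsum v.
  by rewrite -(sum_phi_chi (fun g => rho g^-1%g v)).
under eq_bigr do rewrite rho_dot; under [X in _ + (X - _)]eq_bigr do rewrite rho_dot.
have -> : \sum_(w : 'cV[F]_3 | w != 0) b v v = N * b v v.
  by rewrite /N -count_cols mulr_suml; apply: eq_bigr => w _; rewrite mul1r.
have -> : \sum_(w : 'rV[F]_3 | w != 0) b v v = N * b v v.
  by rewrite /N -count_rows mulr_suml; apply: eq_bigr => w _; rewrite mul1r.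
have -> : Num.sqrt qR * (qR - 1) = lam * Dg.
  by rewrite /lam /Dg; field; rewrite gt_eqF// addr_gt0.
rewrite laplE /lapl !rdotBl !rdotBr !rdotZl !rdotZr !rdotDl !rdotDr.
rewrite (rdotC _ v (fsum v)) (rdotC _ v (bsum v)) (rdotC _ (bsum v) (fsum v)).
rewrite (rdotC _ (bsum v) v) -(fbsum v v).
have := rdot_ge0 dot (fsum v - bsum v); rewrite rnormB.
move: (b (fsum v) (fsum v)) (b (fsum v) (bsum v)) (b (bsum v) (bsum v)) (b (fsum v) v) (b v v).
move=> ff fg gg fv vv h1 h2.
have l0 : 0 <= lam by rewrite divr_ge0 ?sqrtr_ge0// addr_ge0// ltW.
rewrite -subr_ge0 in h2; rewrite -subr_ge0.
set e := (X in 0 <= X) in h2; set e' := (X in 0 <= X).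
(* The gap is a positive multiple of the Poincaré defect plus one of the squared norm of
   [fsum v - bsum v]. *)
have -> : e' = e / (2 * Dg * N) + (1 + lam) / 4 / N ^+ 2 * (ff - 2 * fg + gg).
  by rewrite /e /e'; field; rewrite !gt_eqF.
have N2 : 0 <= N ^+ 2 by rewrite exprn_ge0// ltW.
apply: addr_ge0; apply: mulr_ge0 => //.
  by rewrite invr_ge0 !mulr_ge0// ltW.
by rewrite !mulr_ge0 ?invr_ge0// addr_ge0.
Qed.

Lemma lapl0_inv v : b (lapl v) v = 0 -> forall g, rho g v = v.
Proof.
rewrite lapl_energy => /eqP; rewrite mulf_eq0 invr_eq0 mulf_eq0 pnatr_eq0 (gt_eqF N0) /= => /eqP.
move=> /psumr_eq0P h; apply: phi_gen; first exact: rep1.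
- by move=> g k gv kv; rewrite repM kv.
- by move=> g gv; rewrite -[in LHS]gv -repM mulVg rep1.
- move=> w w0; apply/esym/eqP; rewrite -subr_eq0; apply/eqP/(rdot_eq0 (dot := dot)).
  by apply: h => // ? _; exact: rdot_ge0.
Qed.

End Representation.

(** If every generator moves v by less than C^(-1/2) times its norm, the energy of v is at most its
    squared norm over 2 C. Descent then ends within half the squared norm of v, so its limit is
    invariant and nonzero. The gap is positive because (sqrt q - 1)^2 > 0. *)
Theorem plane_property_T : property_T R G.
Proof.
have q1 := qR_gt1 F R; have q0 : 0 < qR by apply: lt_trans q1.
pose lam : R := Num.sqrt qR / (qR + 1).
have lam2 : 2 * lam < 1.
  rewrite /lam mulrA ltr_pdivrMr ?addr_gt0// mul1r.
  have s1 : Num.sqrt qR != 1.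
    apply/eqP => s1; have := sqr_sqrtr (ltW q0); rewrite s1 expr1n => q1'.
    by rewrite -q1' ltxx in q1.
  have : 0 < (Num.sqrt qR - 1) ^+ 2 by rewrite exprn_even_gt0//= subr_eq0.
  by rewrite sqrrB sqr_sqrtr ?(ltW q0)// expr1n mulr1; lra.
have l1 : 0 < 1 - lam by lra.
have k0 : 0 < (1 - 2 * lam) / (1 - lam) by rewrite divr_gt0// subr_gt0.
exists [seq phi w | w <- enum (predC1 0)].
set k := (_ / _) in k0; have C0 := descent_const_gt0 k0; set C := descent_const k in C0.
exists (Num.sqrt C^-1); split; first by rewrite sqrtr_gt0 invr_gt0.
move=> V dot hc rho [v v0 vP]; have vv : 0 < rdot dot v v.
  rewrite lt_neqAle rdot_ge0 andbT eq_sym; apply: contra_neq v0; exact: rdot_eq0.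
have gap u : k * rdot dot (lapl rho u) u <= rdot dot (lapl rho u) (lapl rho u).
  by rewrite /k mulrAC ler_pdivrMr// [leRHS]mulrC; exact: lapl_gap.
have [w [w0 wv]] := descent k0 hc (laplB rho) (laplZ rho) (lapl_sym rho) (lapl_bound rho) gap v.
exists w; last exact: lapl0_inv w0.
apply/eqP => w00; move: wv; rewrite w00 sub0r rdotNl rdotNr opprK leNgt => /negP; apply.
have N0 : 0 < qR ^+ 3 - 1 by rewrite subr_gt0 exprn_egt1.
have : rdot dot (lapl rho v) v <= 2^-1 * (C^-1 * rdot dot v v).
  rewrite lapl_energy invfM -mulrA ler_pM2l// ler_pdivrMl//.
  rewrite -count_cols mulr_suml; apply: ler_sum => u u0; rewrite mul1r.
  have := vP (phi u); have us : phi u \in [seq phi w | w <- enum (predC1 0)].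
    by apply: map_f; rewrite mem_enum.
  move=> /(_ us); rewrite !dotE -rmorphM ltcR sqr_sqrtr ?invr_ge0 ?(ltW C0)// => /ltW.
  by rewrite -(opprB v) rdotNl rdotNr opprK.
move=> h; apply: (@le_lt_trans _ _ (C * (2^-1 * (C^-1 * rdot dot v v)))); first by rewrite ler_pM2l.
by rewrite mulrCA mulVKf ?gt_eqF//; lra.
Qed.

End PropertyT.

Lemma subgroup_valP (G : groupType) (L : subgroup G) (s : subgroup_type L) : (L : set _) (val s).
Proof. exact: set_mem (valP s). Qed.

(** * Generators of a group simply transitive on the vertices *)

Section BuildingT.
Variables (R : realType).
Variables (K : fieldTopologicalType) (O : set K) (pi : K) (F : finFieldType).
Variables (res : K -> F) (D : is_dvr O pi res).
Local Notation vertex := (bt_vertex O).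
Local Notation type1 := (type1 O pi res).
Variable L : subgroup (PGL3 K).
Hypothesis Ltr : forall x y : vertex, exists2 s, (L : set _) s & y = bt_actV O s x.
Hypothesis Lfr : forall s, (L : set _) s -> forall x : vertex, bt_actV O s x = x -> s = 1%g.
Local Notation H := (subgroup_type L).

(** The default 1 serves the zero vector; every other column occurs. *)
Definition col_elt (w : 'cV[F]_3) : H :=
  if pselect (exists s : H, exists x, type1 (val s) w x) is left e then sval (cid e) else 1%g.
Definition row_elt (x : 'rV[F]_3) : H :=
  if pselect (exists s : H, exists w, type1 (val s) w x) is left e then sval (cid e) else 1%g.

Lemma col_eltP w : w != 0 -> exists x, type1 (val (col_elt w)) w x.
Proof.
move=> w0; rewrite /col_elt; case: pselect => [e|]; first exact: svalP (cid e).
have [s [x [Ls t]]] := type1_col_ex D Ltr w0.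
by case; exists (exist _ s (mem_set Ls)), x.
Qed.
Lemma row_eltP x : x != 0 -> exists w, type1 (val (row_elt x)) w x.
Proof.
move=> x0; rewrite /row_elt; case: pselect => [e|]; first exact: svalP (cid e).
have [s [w [Ls t]]] := type1_row_ex D Ltr x0.
by case; exists (exist _ s (mem_set Ls)), w.
Qed.

Lemma col_eltZ s w x c : (L : set _) s -> type1 s w x -> c != 0 -> val (col_elt (c *: w)) = s.
Proof.
move=> Ls t c0; have [w0 _] := type1_neq0 t.
have [|x' t'] := @col_eltP (c *: w); first by rewrite scaler_eq0 negb_or c0.
apply/esym; apply: (type1_col_inj D Lfr Ls _ t t'); exact: subgroup_valP.
Qed.
Lemma col_elt_eq s w x : (L : set _) s -> type1 s w x -> val (col_elt w) = s.
Proof. by move=> Ls t; rewrite -[w]scale1r; apply: (col_eltZ Ls t); rewrite oner_neq0. Qed.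
Lemma row_eltZ s w x c : (L : set _) s -> type1 s w x -> c != 0 -> val (row_elt (c *: x)) = s.
Proof.
move=> Ls t c0; have [_ x0] := type1_neq0 t.
have [|w' t'] := @row_eltP (c *: x); first by rewrite scaler_eq0 negb_or c0.
apply/esym; apply: (type1_row_inj D Lfr Ls _ t t'); exact: subgroup_valP.
Qed.

Lemma card_line m n (w : 'M[F]_(m, n)) : w != 0 ->
  #|[pred w' | (w' != 0) && [exists c, w' == c *: w]]| = #|F|.-1.
Proof.
move=> w0; rewrite -(cardC1 (0 : F)); rewrite -[RHS](card_in_imset (f := fun c => c *: w)).
  apply: eq_card => w'; rewrite inE; apply/andP/imsetP.
    move=> [w'0 /existsP[c /eqP cE]]; exists c => //; rewrite inE /=.
    by apply: contra_neq w'0 => c0; rewrite cE c0 scale0r.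
  move=> [c c0 ->]; rewrite scaler_eq0 negb_or w0 andbT; split=> //.
  by apply/existsP; exists c.
move=> c d _ _ /eqP; rewrite -subr_eq0 -scalerBl scaler_eq0 (negPf w0) orbF subr_eq0.
by move/eqP.
Qed.

Lemma card_col_elt s w x : (L : set _) s -> type1 s w x ->
  #|[pred w' : 'cV[F]_3 | (w' != 0) && (val (col_elt w') == s)]| = #|F|.-1.
Proof.
move=> Ls t; have [w0 _] := type1_neq0 t; rewrite -(card_line w0); apply: eq_card => w'.
rewrite !inE; case: eqVneq => //= w'0; apply/eqP/existsP => [sE|[c /eqP cE]].
  have [x' t''] := col_eltP w'0; have t' : type1 s w' x' by rewrite -sE; exact: t''.
  by have [c [d [_ _ -> _]]] := type1_uniq D t t'; exists c.
rewrite cE; apply: (col_eltZ Ls t); apply: contra_neq w'0 => c0.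
by rewrite cE c0 scale0r.
Qed.
Lemma card_row_elt s w x : (L : set _) s -> type1 s w x ->
  #|[pred x' : 'rV[F]_3 | (x' != 0) && (val (row_elt x') == s)]| = #|F|.-1.
Proof.
move=> Ls t; have [_ x0] := type1_neq0 t; rewrite -(card_line x0); apply: eq_card => x'.
rewrite !inE; case: eqVneq => //= x'0; apply/eqP/existsP => [sE|[c /eqP cE]].
  have [w' t''] := row_eltP x'0; have t' : type1 s w' x' by rewrite -sE; exact: t''.
  by have [c [d [_ _ _ ->]]] := type1_uniq D t t'; exists d.
rewrite cE; apply: (row_eltZ Ls t); apply: contra_neq x'0 => c0.
by rewrite cE c0 scale0r.
Qed.

Lemma count_enum (T : finType) (A p : pred T) :
  count p (enum A) = #|[pred x | A x && p x]|.
Proof.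
rewrite -sum1_count -sum1_card big_enum_cond; exact: eq_bigl.
Qed.

(** An element of type 1 has exactly q - 1 columns and q - 1 rows, the multiples of one of each; any
    other element has none. *)
Lemma col_row_perm : perm_eq [seq col_elt w | w <- enum (predC1 (0 : 'cV[F]_3))]
  [seq row_elt x | x <- enum (predC1 (0 : 'rV[F]_3))].
Proof.
apply/allP => s _ /=; rewrite !count_map !count_enum; apply/eqP.
have [[w [x t]]|nt] := pselect (exists w x, type1 (val s) w x).
  have Ls := subgroup_valP s.
  have valE (u : H) : (u == s) = (val u == val s).
    by apply/eqP/eqP => [->//|E]; exact: val_inj.
  transitivity #|F|.-1.
    rewrite -(card_col_elt Ls t); apply: eq_card => w'.
    by rewrite [LHS]inE [RHS]inE -valE.
  rewrite -(card_row_elt Ls t); apply: eq_card => x'.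
  by rewrite [LHS]inE [RHS]inE -valE.
rewrite !eq_card0// => [x|w]; rewrite !inE /=; apply/negP => /andP[x0 /eqP E]; apply: nt.
  by have [w t] := row_eltP x0; rewrite E in t; exists w, x.
by have [x t] := col_eltP x0; rewrite E in t; exists w, x.
Qed.

Lemma col_row_triangle (x : 'rV[F]_3) (w : 'cV[F]_3) : x != 0 -> w != 0 ->
  #|[pred w' : 'cV[F]_3 | (w' != 0) && (col_elt w' * row_elt x * col_elt w == 1)%g]| =
  (if x *m w == 0 then #|F|.-1 else 0%N).
Proof.
move=> x0 w0; have [w1 t1] := row_eltP x0; have [x1 t] := col_eltP w0.
have tri := type1_triangle D (subgroup_valP (col_elt w)) (subgroup_valP (row_elt x)) t t1.
case: ifPn => [/eqP/tri[s [w2 [x2 [Ls t2 sE]]]]|xw].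
  rewrite -(card_col_elt Ls t2); apply: eq_card => w'; rewrite !inE; congr (_ && _).
  apply/eqP/eqP => E; last by apply/val_inj; rewrite /= E.
  have /(congr1 val) /= := E; rewrite -sE => /mulIg/mulIg //.
apply: eq_card0 => w'; rewrite !inE; apply/negP => /andP[w'0 /eqP E].
have [x' t'] := col_eltP w'0; move/eqP: xw; apply; apply/tri.
exists (val (col_elt w')), w', x'; split=> //; first exact: subgroup_valP.
by have /(congr1 val) := E.
Qed.

Theorem building_property_T : property_T R H.
Proof.
apply: (@plane_property_T R F H col_elt row_elt).
- move=> c w c0 w0; apply/val_inj; have [x t] := col_eltP w0.
  exact: (col_eltZ (subgroup_valP _) t).
- exact: col_row_perm.
- exact: col_row_triangle.
move=> P P1 PM PV Pw s.
have [u E Pu] : exists2 u : H, val s = val u & P u; last by rewrite (val_inj E : s = u).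
apply: (@type1_generate _ _ _ _ _ D L Ltr Lfr (fun t => exists2 u : H, t = val u & P u)).
- by exists 1%g.
- by move=> _ _ [u -> Pu] [v -> Pv]; exists (u * v)%g => //; exact: PM.
- by move=> _ [u -> Pu]; exists u^-1%g => //; exact: PV.
- move=> t w x Lt t1; exists (col_elt w); first by rewrite (col_elt_eq Lt t1).
  by apply: Pw; have [] := type1_neq0 t1.
- exact: subgroup_valP.
Qed.

End BuildingT.

(** * Normal subgroups and commutants *)

Section Scalars.
Variable K : fieldType.

Lemma nz_col m (x : 'cV[K]_m) : x != 0 -> exists i, x i 0 != 0.
Proof.
move=> u0; apply: contrapT => /forallNP h; move/eqP: u0; apply; apply/colP => i.
by rewrite mxE; apply/eqP; apply: contrapT => /negP/h.
Qed.
Lemma nz_row m (x : 'rV[K]_m) : x != 0 -> exists i, x 0 i != 0.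
Proof.
move=> x0; have [|i] := @nz_col _ x^T; first by rewrite trmx_eq0.
by rewrite mxE; exists i.
Qed.

Lemma row_eigen_scalar n (m : 'M[K]_n.+1) :
  (forall x : 'rV[K]_n.+1, exists k, x *m m = k *: x) -> m = (m 0 0)%:M.
Proof.
move=> h; have mE i : exists k, row i m = k *: delta_mx 0 i.
  by have [k] := h (delta_mx 0 i); rewrite -rowE => ->; exists k.
have off i j : i != j -> m i j = 0.
  move=> ij; have [k] := mE i => /rowP/(_ j); rewrite !mxE eqxx eq_sym (negPf ij) => ->.
  by rewrite mulr0.
apply/matrixP => i j; rewrite mxE; have [<-|/off//] := eqVneq i j.
have [k kE] := h (const_mx 1); have d l : m l l = k.
  have := congr1 (fun A : 'rV[K]_n.+1 => A 0 l) kE; rewrite !mxE mulr1 (bigD1 l)//= mxE mul1r.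
  by rewrite big1 ?addr0// => a al; rewrite off// mulr0.
by rewrite !d mulr1n.
Qed.

Lemma col_eigen_scalar n (m : 'M[K]_n.+1) :
  (forall x : 'cV[K]_n.+1, exists k, m *m x = k *: x) -> m = (m 0 0)%:M.
Proof.
move=> h; apply: trmx_inj; rewrite tr_scalar_mx {1}(@row_eigen_scalar _ m^T) ?mxE// => x.
by have [k kE] := h x^T; exists k; rewrite -[x in LHS]trmxK -trmx_mul kE linearZ /= trmxK.
Qed.

End Scalars.

Section Commutant.
Variables (R : realType).
Variables (K : fieldTopologicalType) (O : set K) (pi : K) (F : finFieldType).
Variables (res : K -> F) (D : is_dvr O pi res).
Local Notation intmx := (intmx O).
Local Notation resmx := (resmx res).
Local Notation vertex := (bt_vertex O).
Local Notation type1 := (type1 O pi res).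
Local Notation piG := (\pi_(PGL3 K)).
Local Notation q := #|F|.
Variables L N : subgroup (PGL3 K).
Hypothesis Ltr : forall x y : vertex, exists2 s, (L : set _) s & y = bt_actV O s x.
Hypothesis Lfr : forall s, (L : set _) s -> forall x : vertex, bt_actV O s x = x -> s = 1%g.
Hypothesis NL : forall s n, (L : set _) s -> (N : set _) n -> (N : set _) (s * n * s^-1)%g.
Hypothesis N1 : exists2 n, (N : set _) n & n <> 1%g.

Definition commutant (c : 'M[K]_3) := forall g : GL3 K, (N : set _) (piG g) -> c *m g = g *m c.

Lemma commutantD c d : commutant c -> commutant d -> commutant (c + d).
Proof. by move=> Cc Cd g Ng; rewrite mulmxDl mulmxDr Cc// Cd. Qed.
Lemma commutantZ k c : commutant c -> commutant (k *: c).
Proof. by move=> Cc g Ng; rewrite -scalemxAl -scalemxAr Cc. Qed.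
Lemma commutant_scalar k : commutant k%:M.
Proof. by move=> g _; rewrite scalar_mxC. Qed.

Lemma commutantJ (g : GL3 K) c : (L : set _) (piG g) -> commutant c ->
  commutant (invmx g *m c *m g).
Proof.
move=> Lg Cc n Nn; have ug := unitGL g.
have : (N : set _) (piG (g * n * g^-1)%g).
  by have := NL Lg Nn; rewrite PGL3_piVg (PGL3_piMg g n) PGL3_piMg.
move=> /Cc /= /(congr1 (fun A => invmx g *m A *m g)).
by rewrite !mulmxA mulVmx// mul1mx !mulmxKV// => ->; rewrite !mulmxA.
Qed.

(** Subtract the scalar of the corner entry and make the difference primitive: its residue is
    nonzero with a zero corner, hence not scalar. *)
Lemma nonscalar_reduction (m : 'M[K]_3) : m <> (m 0 0)%:M -> exists a b,
  intmx (a *: m + b%:M) /\ resmx (a *: m + b%:M) <> (resmx (a *: m + b%:M) 0 0)%:M.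
Proof.
move=> ns; have [|a [a0 Oa ra]] := primitive D (m := m - (m 0 0)%:M).
  by rewrite subr_eq0; apply/eqP.
exists a, (- (a * m 0 0)); have -> : a *: m + (- (a * m 0 0))%:M = a *: (m - (m 0 0)%:M).
  by rewrite scalerBr scale_scalar_mx raddfN.
split=> // E; move/eqP: ra; apply; rewrite E.
by rewrite !mxE eqxx mulr1n subrr mulr0 (dvr_res_0 D) raddf0.
Qed.

(* The residues of the integral elements of the commutant: a subalgebra of M_3(F). *)
Definition redcomm (m : 'M[F]_3) := exists c, [/\ intmx c, commutant c & resmx c = m].

Lemma redcommD m n : redcomm m -> redcomm n -> redcomm (m + n).
Proof.
move=> [c [Oc Cc <-]] [d [Od Cd <-]]; exists (c + d); split.
- exact: (intmxD D).
- exact: commutantD.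
- by rewrite (resmxD D).
Qed.
Lemma redcommZ k m : redcomm m -> redcomm (k *: m).
Proof.
move=> [c [Oc Cc <-]]; have [y Oy <-] := dvr_surj D k; exists (y *: c); split.
- exact: (intmxZ D).
- exact: commutantZ.
- by rewrite (resmxZ D).
Qed.
Lemma redcomm1 : redcomm 1%:M.
Proof.
exists 1%:M; split; [exact: (intmx1 D)|exact: commutant_scalar|exact: (resmx1 D)].
Qed.

(** [orb w] is the image of [w] under the algebra [redcomm]; [nilp x] below parametrizes the
    square-zero elements u x of that algebra with given row [x]. *)
Definition orb (w : 'cV[F]_3) : {pred 'cV[F]_3} := [pred z | `[< exists2 m, redcomm m & z = m *m w >]].
Definition nilp (x : 'rV[F]_3) : {pred 'cV[F]_3} :=
  [pred u | (x *m u == 0) && `[< redcomm (u *m x) >]].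

(* u + k w is the image of w under (x w)^-1 u x + k, for u in nilp x and k in F. *)
Lemma nilp_orb x w : x *m w != 0 -> (q * #|nilp x| <= #|orb w|)%N.
Proof.
move=> xw; pose f (uk : 'cV[F]_3 * F) := uk.1 + uk.2 *: w.
rewrite mulnC -cardX -(card_in_image (f := f)).
  apply/subset_leq_card/fintype.subsetP => z; move/fintype.imageP => [[u k] ukP ->].
  have /andP[/= /andP[/eqP xu /asboolP ux] _] := ukP; apply/asboolP.
  have xwE : x *m w = ((x *m w) 0 0)%:M by exact: mx11_scalar.
  have xw0 : (x *m w) 0 0 != 0.
    by apply: contra_neq xw => xw0; rewrite xwE xw0 raddf0.
  exists (((x *m w) 0 0)^-1 *: (u *m x) + k *: 1%:M).
    by apply: redcommD; apply: redcommZ => //; exact: redcomm1.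
  rewrite mulmxDl -!scalemxAl mul1mx -mulmxA {2}xwE mul_mx_scalar scalerA mulVf//.
  by rewrite scale1r.
move=> [u k] [u' k'] ukP ukP'; rewrite /f /= => E.
have /andP[/= /andP[/eqP xu _] _] := ukP; have /andP[/= /andP[/eqP xu' _] _] := ukP'.
have /eqP : (k - k') *: (x *m w) = 0.
  have := congr1 (mulmx x) E; rewrite !mulmxDr xu xu' !add0r -!scalemxAr => /eqP.
  by rewrite -subr_eq0 -scalerBl => /eqP.
rewrite scaler_eq0 (negPf xw) orbF subr_eq0 => /eqP kk; move: E; rewrite kk => /addIr ->.
by [].
Qed.

(* For a lift a of s and h = pi a^-1, an integral c in the commutant with residue m
   gives h c a, in the commutant, with residue (h m w) x; so the residue of h maps
   orb w to nilp x, and its kernel is the line of w. *)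
Lemma orb_nilp s w x d : (L : set _) s -> type1 s w x -> d != 0 ->
  (#|orb w| <= q * #|nilp (d *: x)|)%N.
Proof.
move=> Ls [a [h [aE sa ra]]] d0; have [Oa Oh _ _ _] := sa; have [au hE] := step_unit D sa.
pose H := resmx h.
have Hnilp z : z \in orb w -> H *m z \in nilp (d *: x).
  move=> /asboolP[m [c [Oc Cc <-]] ->]; apply/andP; split.
    by rewrite -scalemxAl !mulmxA (type1_xh D sa ra) !mul0mx scaler0.
  apply/asboolP; rewrite -scalemxAr; apply: redcommZ.
  exists (h *m c *m a); split.
  - by do 2?apply: (intmxM D).
  - rewrite hE -!scalemxAl; apply: commutantZ; apply: commutantJ => //.
    by rewrite aE.
  - rewrite !(resmxM D)// ?ra ?mulmxA//; by do 1?apply: (intmxM D).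
have fib z z' : H *m z = H *m z' -> exists k, z' = z + k *: w.
  move=> E; have [|k kE] := type1_kerh D sa ra (z := z' - z).
    by rewrite mulmxBr -/H E subrr.
  by exists k; rewrite -kE addrC subrK.
rewrite -sum1_card (partition_big (mulmx H) (mem (nilp (d *: x))))//=.
rewrite mulnC -sum_nat_const; apply: leq_sum => u _.
have [[z zP]|nz] := pselect (exists z, (z \in orb w) && (H *m z == u)); last first.
  by rewrite big1// => z zP; case: nz; exists z.
have fi : injective (fun k : F => z + k *: w).
  move=> k k' /addrI/eqP; rewrite -subr_eq0 -scalerBl scaler_eq0 subr_eq0.
  have -> : (w == 0) = false.
    by apply/eqP => w0; have [_ _ _ + _] := sa; rewrite ra w0 mul0mx eqxx.
  by rewrite orbF => /eqP.
rewrite sum1_card -(fintype.card_image fi F).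
apply/subset_leq_card/fintype.subsetP => z' /andP[_ /eqP z'u].
have /andP[_ /eqP zu] := zP; have [|k ->] := fib z z'; first by rewrite zu.
by apply/fintype.imageP; exists k.
Qed.

Let f (w : 'cV[F]_3) : R := #|orb w|%:R.
Let g (x : 'rV[F]_3) : R := (q * #|nilp x|)%:R.

(** [orb_nilp] is summed over the pairs (w, x) carried by the same element of [L]; each column and
    each row occurs in q - 1 of them. *)
Lemma sum_orb_nilp : \sum_(w | w != 0) f w <= \sum_(x | x != 0) g x.
Proof.
have q1 : 0 < (q.-1)%:R :> R by rewrite ltr0n -subn1 subn_gt0 q_gt1.
pose E w x : R := (val (col_elt O pi res L w) == val (row_elt O pi res L x))%:R.
have sumE (I : finType) (A : pred I) (n : nat) (p : pred I) :
    #|[pred i | A i && p i]| = n -> \sum_(i | A i) (p i)%:R = n%:R :> R.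
  move=> <-; rewrite (eq_bigr (fun i => if p i then 1 else 0)) => [|i _]; last by case: ifP.
  by rewrite -big_mkcondr sumr_const.
have sE1 w : w != 0 -> \sum_(x | x != 0) E w x = (q.-1)%:R.
  move=> w0; have [x t] := col_eltP D Ltr w0.
  rewrite -(card_row_elt D Ltr Lfr (subgroup_valP _) t) /E; apply: sumE.
  by apply: eq_card => x'; rewrite [LHS]inE [RHS]inE; apply: andb_id2l => _; exact: eq_sym.
have sE2 x : x != 0 -> \sum_(w | w != 0) E w x = (q.-1)%:R.
  move=> x0; have [w t] := row_eltP D Ltr x0.
  by rewrite -(card_col_elt D Ltr Lfr (subgroup_valP _) t) /E; exact: sumE.
rewrite -(ler_pM2l q1) !mulr_sumr.
have -> : \sum_(w | w != 0) (q.-1)%:R * f w = \sum_(w | w != 0) \sum_(x | x != 0) E w x * f w.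
  by apply: eq_bigr => w w0; rewrite -mulr_suml sE1.
have -> : \sum_(x | x != 0) (q.-1)%:R * g x = \sum_(w | w != 0) \sum_(x | x != 0) E w x * g x.
  by rewrite exchange_big; apply: eq_bigr => x x0; rewrite -mulr_suml sE2.
apply: ler_sum => w w0; apply: ler_sum => x x0; rewrite /E; case: eqP; last by rewrite !mul0r.
move=> wx; rewrite !mul1r ler_nat.
have [x1 t1] := col_eltP D Ltr w0; have [w2 t2] := row_eltP D Ltr x0; rewrite -wx in t2.
have [c [d [c0 d0 _ ->]]] := type1_uniq D t1 t2.
exact: (orb_nilp (subgroup_valP _) t1 d0).
Qed.

(** Over non-incident pairs the differences are nonnegative by [nilp_orb]. Their sum is not positive
    by [sum_orb_nilp], because each column misses as many rows as each row misses columns. So every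
    difference vanishes. *)
Lemma orb_eq_nilp w x : x *m w != 0 -> f w = g x.
Proof.
have fg w' x' : x' != 0 -> w' != 0 -> 0 <= (1 - inc R x' w') * (f w' - g x').
  move=> x0 w0; rewrite /inc; case: eqP => [_|/eqP xw]; first by rewrite subrr mul0r.
  by rewrite subr0 mul1r subr_ge0 ler_nat; exact: nilp_orb.
have s0 : \sum_(w' | w' != 0) \sum_(x' | x' != 0) (1 - inc R x' w') * (f w' - g x') = 0.
  apply/eqP; rewrite eq_le; apply/andP; split; last first.
    by apply: sumr_ge0 => w' w0; apply: sumr_ge0 => x' x0; exact: fg.
  under eq_bigr => w' _ do (under eq_bigr => x' _ do rewrite mulrBr; rewrite sumrB).
  rewrite sumrB subr_le0.
  pose M : R := (q%:R ^+ 3 - 1) - (q%:R ^+ 2 - 1).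
  have M0 : 0 <= M by rewrite /M opprB addrA subrK subr_ge0 ler_weXn2l// ltW// qR_gt1.
  have -> : \sum_(w' | w' != 0) \sum_(x' | x' != 0) (1 - inc R x' w') * f w' =
      M * \sum_(w' | w' != 0) f w'.
    by rewrite mulr_sumr; apply: eq_bigr => w' w0; rewrite -mulr_suml sumrB sum_inc// count_rows.
  rewrite exchange_big.
  have -> : \sum_(x' | x' != 0) \sum_(w' | w' != 0) (1 - inc R x' w') * g x' =
      M * \sum_(x' | x' != 0) g x'.
    by rewrite mulr_sumr; apply: eq_bigr => x' x0; rewrite -mulr_suml sumrB sum_inc'// count_cols.
  by apply: ler_wpM2l => //; exact: sum_orb_nilp.
move=> xw; have w0 : w != 0 by apply: contra_neq xw => ->; rewrite mulmx0.
have x0 : x != 0 by apply: contra_neq xw => ->; rewrite mul0mx.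
have h : \sum_(x' | x' != 0) (1 - inc R x' w) * (f w - g x') = 0.
  by apply: (psumr_eq0P _ s0) => // w' w'0; apply: sumr_ge0 => x' x'0; exact: fg.
have : (1 - inc R x w) * (f w - g x) = 0.
  by apply: (psumr_eq0P _ h) => // x' x'0; exact: fg.
by rewrite /inc (negPf xw) subr0 mul1r => /eqP; rewrite subr_eq0 => /eqP.
Qed.

(* If the residual commutant is not scalar, some w has a large orbit, hence by
   orb_eq_nilp all spaces nilp x are nonzero; their elements commute with the
   residue of a nonscalar element of N, so that every row is an eigenvector of it. *)
Theorem commutant_is_scalar c : commutant c -> c = (c 0 0)%:M.
Proof.
move=> Cc; apply: contrapT => cns.
have [a [b [Ocab rcab]]] := nonscalar_reduction cns.
set m := resmx _ in rcab; have Cm : redcomm m.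
  exists (a *: c + b%:M); split=> //; apply: commutantD; last exact: commutant_scalar.
  exact: commutantZ.
have [s Ns s1] := N1; elim/quotW: s Ns s1 => n Nn n1.
have nns : (n : 'M[K]_3) <> ((n : 'M[K]_3) 0 0)%:M.
  move=> nE; apply: n1; apply/PGL3_eqP; exists ((n : 'M[K]_3) 0 0); last first.
    by rewrite [LHS]nE -scalemx1.
  apply/eqP => n00; have := unitGL n; rewrite nE n00 raddf0 unitmxE det0 unitr0 //.
have [a' [b' [On rn]]] := nonscalar_reduction nns.
set A := resmx _ in rn; apply: rn; apply: row_eigen_scalar => x'.
have comA k : redcomm k -> k *m A = A *m k.
  move=> [d [Od Cd <-]]; rewrite -!(resmxM D)//; congr (map_mx res _).
  by rewrite mulmxDr mulmxDl -scalemxAr -scalemxAl Cd// scalar_mxC.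
have [->|x'0] := eqVneq x' 0; first by exists 0; rewrite mul0mx scaler0.
have [w [w0 wm]] : exists w : 'cV[F]_3, w != 0 /\ forall k, m *m w <> k *: w.
  apply: contrapT => /forallNP h; apply: rcab; apply: col_eigen_scalar => w.
  have [->|w0] := eqVneq w 0; first by exists 0; rewrite mulmx0 scaler0.
  by apply: contrapT => /forallNP h'; apply: (h w).
(* The orbit contains all multiples of [w] and also [m *m w], which is not one of them. *)
have fw : q%:R < f w.
  rewrite ltr_nat; have ki : injective (fun k : F => k *: w).
    by move=> k k' /eqP; rewrite -subr_eq0 -scalerBl scaler_eq0 (negPf w0) orbF subr_eq0 => /eqP.
  rewrite -(fintype.card_image ki F); apply/proper_card/properP; split.
    apply/fintype.subsetP => z; move/fintype.imageP => [k _ ->]; apply/asboolP.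
    by exists (k *: 1%:M); [exact/redcommZ/redcomm1|rewrite -scalemxAl mul1mx].
  exists (m *m w); first by apply/asboolP; exists m.
  by apply/negP => /fintype.imageP[k _ /wm].
have [x xw] : exists x : 'rV[F]_3, x *m w != 0.
  have [i wi] := nz_col w0; exists (delta_mx 0 i); rewrite -rowE.
  by apply: contra_neq wi => /rowP/(_ 0); rewrite !mxE.
(* Two nonzero rows always miss a common column, so the sizes agree along the chain from [w] through
   [x] and [w'] to [x']. *)
have [w' [xw' x'w']] : exists w' : 'cV[F]_3, x *m w' != 0 /\ x' *m w' != 0.
  have [i x'i] := nz_row x'0; pose w2 : 'cV[F]_3 := delta_mx i 0.
  have x'w2 : x' *m w2 != 0.
    by rewrite -colE; apply: contra_neq x'i => /colP/(_ 0); rewrite !mxE.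
  have [x'w|x'w] := eqVneq (x' *m w) 0; last by exists w.
  have [xw2|xw2] := eqVneq (x *m w2) 0; last by exists w2.
  by exists (w + w2); rewrite !mulmxDr x'w xw2 addr0 add0r.
have : q%:R < g x' by rewrite -(orb_eq_nilp x'w') (orb_eq_nilp xw') -(orb_eq_nilp xw).
rewrite ltr_nat -{1}[q]muln1 ltn_pmul2l ?(ltnW (q_gt1 F))// => n1'.
have [u u0 uP] : exists2 u, u != 0 & u \in nilp x'.
  have : (0 < #|[predD1 nilp x' & 0%R]|)%N.
    move: n1'; rewrite (cardD1 0); case: (0 \in nilp x') => /=; rewrite ?add0n//.
    exact: leq_trans.
  by case/card_gt0P => u /andP[u0 uP]; exists u.
have /andP[_ /asboolP/comA E] := uP; have [i ui] := nz_col u0.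
exists ((u i 0)^-1 * (A *m u) i 0); apply/rowP => j; rewrite [RHS]mxE.
have out (v : 'cV[F]_3) (y : 'rV[F]_3) : (v *m y) i j = v i 0 * y 0 j.
  by rewrite mxE big_ord1.
have E' : u i 0 * (x' *m A) 0 j = (A *m u) i 0 * x' 0 j.
  by rewrite -!out mulmxA E mulmxA.
by rewrite -mulrA -E' mulKf.
Qed.

End Commutant.

(** * Finiteness of vertex stabilizers *)

Section FiniteStabilizer.
Variables (R : realType).
Variables (K : fieldTopologicalType) (O : set K) (pi : K) (F : finFieldType).
Variables (res : K -> F) (D : is_dvr O pi res).
Local Notation vertex := (bt_vertex O).
Local Notation vtx := (vtx O).
Local Notation adj := (@adj K O pi).
Local Notation o := (vtx 1%g).
Local Notation piG := (\pi_(PGL3 K)).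
Local Notation stab := [set s : PGL3 K | bt_actV O s o = o].

(** Induction along a path: the stabilizer acts on a locally finite graph. *)
Lemma vertex_orbit_finite (x : vertex) : finite_set [set bt_actV O s x | s in stab].
Proof.
apply: (@bt_connected _ _ _ _ _ D x (fun x => finite_set [set bt_actV O s x | s in stab])).
  by apply: sub_finite_set (finite_set1 o) => _ [s sE <-].
move=> {x} y z yz fy.
apply: (@sub_finite_set _ _ (\bigcup_(y' in [set bt_actV O s y | s in stab]) [set z | adj y' z])).
  by move=> _ [s sE <-]; exists (bt_actV O s y); [exists s|exact: adj_act].
by apply: bigcup_finite => // y' _; exact: (adj_finite D).
Qed.

(** A matrix is given by its class in PGL_3 up to a scalar, and its determinant fixes the cube of
    that scalar. *)
Lemma cube_roots_finite (d : K) : finite_set [set c : K | c ^+ 3 = d].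
Proof.
have [[c1 c1E]|nc] := pselect (exists c : K, c ^+ 3 = d); last first.
  by apply: sub_finite_set (finite_set0 K) => c cE; case: nc; exists c.
have fac c : c ^+ 3 = d -> c = c1 \/ c ^+ 2 + c * c1 + c1 ^+ 2 = 0.
  rewrite -c1E => /eqP; rewrite -subr_eq0.
  have -> : c ^+ 3 - c1 ^+ 3 = (c - c1) * (c ^+ 2 + c * c1 + c1 ^+ 2) by ring.
  by rewrite mulf_eq0 subr_eq0 => /orP[/eqP|/eqP]; [left|right].
have [[c2 c2E]|nc] := pselect (exists c : K, c ^+ 2 + c * c1 + c1 ^+ 2 = 0); last first.
  apply: sub_finite_set (finite_set1 c1) => c /fac[//|cE].
  by case: nc; exists c.
apply: (@sub_finite_set _ _ ([set c1] `|` [set c2] `|` [set - (c2 + c1)])).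
  move=> c /fac[->|cE]; first by left; left.
  have : (c - c2) * (c + (c2 + c1)) = 0.
    rewrite -[RHS](subrr 0) -{1}cE -c2E; ring.
  by move/eqP; rewrite mulf_eq0 subr_eq0 addr_eq0 => /orP[/eqP|/eqP]; [left; right|right].
by rewrite !finite_setU; do !split; exact: finite_set1.
Qed.

Variables L N P : subgroup (PGL3 K).
Hypothesis Ltr : forall x y : vertex, exists2 s, (L : set _) s & y = bt_actV O s x.
Hypothesis Lfr : forall s, (L : set _) s -> forall x : vertex, bt_actV O s x = x -> s = 1%g.
Hypothesis NsubL : forall n, (N : set _) n -> (L : set _) n.
Hypothesis LsubP : forall s, (L : set _) s -> (P : set _) s.
Hypothesis NP : forall s n, (P : set _) s -> (N : set _) n -> (N : set _) (s * n * s^-1)%g.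
Hypothesis N1 : exists2 n, (N : set _) n & n <> 1%g.

(** Take finitely many lifts whose span has maximal dimension: it contains every other lift, and
    commuting is a linear condition. *)
Lemma finite_commutant : exists ms : seq (GL3 K),
  (forall g, g \in ms -> (N : set _) (piG g)) /\
  forall c : 'M[K]_3, (forall g, g \in ms -> c *m g = (g : 'M[K]_3) *m c) -> commutant N c.
Proof.
pose V (ms : seq (GL3 K)) : {vspace 'M[K]_3} := <<[seq GL3_mx g | g <- ms]>>%VS.
pose A n := `[< exists ms, (forall g, g \in ms -> (N : set _) (piG g)) /\ \dim (V ms) = n >].
have A0 : exists n, A n by exists (\dim (V [::])); apply/asboolP; exists [::].
have Ab n : A n -> (n <= \dim {:'M[K]_3})%N.
  by move=> /asboolP[ms [_ <-]]; apply: dimvS; exact: subvf.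
case: (ex_maxnP A0 Ab) => n /asboolP[ms [msN dn]] nmax.
exists ms; split=> // c cms g Ng.
have gV : (g : 'M[K]_3) \in V ms.
  have sV : (V ms <= V (g :: ms))%VS by rewrite /V /= span_cons addvSr.
  have : (V (g :: ms) == V ms).
    rewrite eq_sym eqEdim sV dn; apply: nmax; apply/asboolP; exists (g :: ms); split=> //.
    by move=> k; rewrite inE => /orP[/eqP ->//|]; exact: msN.
  by move=> /eqP <-; apply: memv_span; rewrite mem_head.
have gV' : GL3_mx g \in <<in_tuple [seq GL3_mx g | g <- ms]>>%VS := gV.
rewrite (coord_span gV') mulmx_sumr mulmx_suml; apply: eq_bigr => i _.
rewrite -scalemxAr -scalemxAl; congr (_ *: _).
have /mapP[k kms ->] : (in_tuple [seq GL3_mx g | g <- ms])`_i \in [seq GL3_mx g | g <- ms].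
  by apply: mem_nth.
exact: cms.
Qed.

Definition conjmx3 (s : PGL3 K) (g : GL3 K) : 'M[K]_3 := repr s *m g *m invmx (repr s).

(** The conjugate lies in [N], hence in [L], and moves [o] into the finite orbit of g o. By freeness
    finitely many classes remain, and the determinant leaves finitely many matrices in each. *)
Lemma conj_finite (g : GL3 K) : (N : set _) (piG g) ->
  finite_set [set conjmx3 s g | s in (P : set _) `&` stab].
Proof.
move=> Ng.
pose B := [set t : PGL3 K | (L : set _) t /\ [set bt_actV O s (bt_actV O (piG g) o) | s in stab] (bt_actV O t o)].
have fB : finite_set B.
  have := vertex_orbit_finite (bt_actV O (piG g) o).
  set E := [set _ | _ in _] => fE.
  pose e x := xget 1%g [set t | (L : set _) t /\ bt_actV O t o = x].
  apply: sub_finite_set (finite_image e fE) => t [Lt Et].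
  exists (bt_actV O t o) => //; rewrite /e.
  have := xgetPex 1%g (P := [set t' | (L : set _) t' /\ bt_actV O t' o = bt_actV O t o]) => -[|Le eE].
    by exists t.
  exact: (act_inj Lfr Le Lt eE).
apply: (@sub_finite_set _ _ (\bigcup_(t in B)
    [set c *: (repr t : 'M[K]_3) | c in [set c | c ^+ 3 = \det g / \det (repr t)]])).
  move=> _ [s [Ps so] <-].
  have ur := unitGL (repr s).
  exists (s * piG g * s^-1)%g.
    split; first by apply: NsubL; exact: NP.
    exists s => //; rewrite !actM; congr (bt_actV O s (bt_actV O _ _)).
    by rewrite -{2}so -actM mulVg act1.
  have sE : (s * piG g * s^-1)%g = piG (repr s * g * (repr s)^-1)%g.
    by rewrite -{1 2}[s]reprK PGL3_piVg (PGL3_piMg (repr s) g) PGL3_piMg.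
  set b := repr (s * piG g * s^-1)%g.
  have [c c0 cE] : exists2 c : K, c != 0 & (repr s * g * (repr s)^-1 : GL3 K)%g = c *: (b : 'M[K]_3) :> 'M[K]_3.
    by apply/PGL3_eqP; rewrite /b reprK sE.
  exists c; last by rewrite -cE.
  have db : \det (b : 'M[K]_3) != 0 by rewrite -unitfE -unitmxE unitGL.
  have := congr1 determinant cE; rewrite /= !det_mulmx detZ det_inv => dE.
  apply: (mulIf db); rewrite mulfVK// -dE mulrAC mulfV ?mul1r//.
  by rewrite -unitfE -unitmxE.
apply: bigcup_finite => // t _; exact/finite_image/cube_roots_finite.
Qed.

(* N spans a subalgebra with scalar commutant, so that an element of P is determined
   up to finitely many scalars by its conjugation action on finitely many elements of
   N; the conjugates by vertex stabilizers are in N, hence in L, and move the base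
   vertex to one of finitely many vertices. *)
Theorem stab_finite : finite_set ((P : set _) `&` stab).
Proof.
have [ms [msN msC]] := finite_commutant.
set S := _ `&` _.
have fS : finite_set [set [seq conjmx3 s g | g <- ms] | s in S].
  elim: ms msN {msC} => [|g ms IH] msN.
    by apply: sub_finite_set (finite_set1 [::]) => _ [s _ <-].
  have f1 := conj_finite (msN g (mem_head _ _)).
  have f2 : finite_set [set [seq conjmx3 s g | g <- ms] | s in S].
    by apply: IH => k kms; apply: msN; rewrite inE kms orbT.
  apply: sub_finite_set (finite_image2 cons f1 f2) => _ [s Ss <-] /=.
  by exists (conjmx3 s g); [exists s|exists [seq conjmx3 s g | g <- ms]; [exists s|]].
pose e l := xget 1%g [set s | S s /\ [seq conjmx3 s g | g <- ms] = l].
apply: sub_finite_set (finite_image e fS) => s Ss.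
exists [seq conjmx3 s g | g <- ms]; first by exists s.
have := xgetPex 1%g (P := [set t | S t /\ [seq conjmx3 t g | g <- ms] = [seq conjmx3 s g | g <- ms]]).
case; first by exists s.
rewrite -/(e _); move: (e _) => t St /eq_in_map tE.
have ut := unitGL (repr t).
have us := unitGL (repr s).
have : commutant N (invmx (repr s) *m repr t).
  apply: msC => g gms; have := tE g gms; rewrite /conjmx3.
  move=> /(congr1 (fun A => invmx (repr s) *m A *m repr t)).
  by rewrite !mulmxA mulmxKV// mulVmx// mul1mx => ->.
have NL s' n : (L : set _) s' -> (N : set _) n -> (N : set _) (s' * n * s'^-1)%g.
  by move=> /LsubP; exact: NP.
move=> /(commutant_is_scalar R D Ltr Lfr NL N1); set c := _ 0 0 => cE.
have tsE : (repr t : 'M[K]_3) = c *: (repr s : 'M[K]_3).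
  by rewrite -(mulKVmx us (repr t)) cE mul_mx_scalar.
rewrite -[t]reprK -[s]reprK; apply/PGL3_eqP; exists c => //.
apply/eqP => c0; move: ut; rewrite tsE c0 scale0r unitmxE det0 unitr0 //.
Qed.

End FiniteStabilizer.

(** * The fields of p-adic numbers *)

Section PadicDVR.
Variables (p : nat) (p_pr : prime p).
Local Notation Zp := (padic_int p_pr).
Local Notation incl := (@padic_incl p p_pr).
Local Notation Fp := 'F_p.

Lemma frac_decomp (S : idomainType) (x : {fraction S}) :
  exists a b : S, b != 0 /\ x = tofrac a / tofrac b.
Proof.
elim/quotW: x => r; exists (frac r).1, (frac r).2; split; first exact: denom_ratioP.
have d0 : tofrac (frac r).2 != 0 by rewrite tofrac_eq0 denom_ratioP.
apply: (mulIf d0); rewrite mulfVK//; unlock FracField.tofrac.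
rewrite -[LHS]FracField.pi_mul; apply/eqmodP.
rewrite /= FracField.equivfE /FracField.mulf !numden_Ratio ?oner_neq0 ?mulr1 ?denom_ratioP//.
by rewrite mulrC.
Qed.

Let p0 : (0 < p)%N := prime_gt0 p_pr.

Lemma intr_Fp_eq0 (a : int) : ((a%:~R : Fp) == 0) = (p %| a)%Z.
Proof. by rewrite (dvdz_pcharf (pchar_Fp p_pr)). Qed.

Lemma intr_modFp (a : int) : ((a %% p)%Z%:~R : Fp) = a%:~R.
Proof.
apply/eqP; rewrite -subr_eq0 -intrB intr_Fp_eq0 -eqz_mod_dvd; apply/eqP.
exact: modz_mod.
Qed.

Lemma padic_mod1 (z : Zp) n : (z n.+1 %% p)%Z = z 1%N.
Proof. by have := padic_modm z n 1; rewrite expn1 add1n. Qed.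

Lemma padic_at0 (z : Zp) : z 0%N = 0.
Proof. by rewrite -(padic_mod z 0) expn0 modz1. Qed.

Lemma padic_addE (x y : Zp) n : (x + y) n = ((x n + y n) %% (p ^ n)%N)%Z. Proof. by []. Qed.
Lemma padic_oppE (x : Zp) n : (- x) n = ((- x n) %% (p ^ n)%N)%Z. Proof. by []. Qed.
Lemma padic_mulE (x y : Zp) n : (x * y) n = ((x n * y n) %% (p ^ n)%N)%Z. Proof. by []. Qed.
Lemma padic_1E n : (1 : Zp) n = (1 %% (p ^ n)%N)%Z. Proof. by []. Qed.
Lemma padic_0E n : (0 : Zp) n = 0. Proof. by rewrite [LHS]mod0z. Qed.

Definition zres (z : Zp) : Fp := (z 1%N)%:~R.

Lemma zres1 : zres 1 = 1. Proof. by rewrite /zres padic_1E expn1 intr_modFp. Qed.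
Lemma zresB x y : zres (x - y) = zres x - zres y.
Proof.
by rewrite /zres padic_addE expn1 intr_modFp rmorphD padic_oppE expn1 /= intr_modFp rmorphN.
Qed.
Lemma zresM x y : zres (x * y) = zres x * zres y.
Proof. by rewrite /zres padic_mulE expn1 intr_modFp rmorphM. Qed.
Lemma zres_surj a : exists z, zres z = a.
Proof.
exists (padic_cst p_pr (nat_of_ord a)); rewrite /zres /= expn1 intr_modFp.
by rewrite -pmulrn natr_Zp.
Qed.

(** The quotient has components z_(n+1) / p: division by p costs one digit of precision, hence the
    shift. *)
Lemma zres_eq0 z : zres z = 0 -> exists y : Zp, z = p%:R * y.
Proof.
move=> /eqP; rewrite /zres intr_Fp_eq0 => pz.
have pzn n : (p %| z n.+1)%Z.
  by apply/dvdz_mod0P; rewrite padic_mod1 -(padic_mod z 1) expn1; exact/dvdz_mod0P.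
pose f n := (z n.+1 %/ p)%Z.
have fp n : f n * p = z n.+1 by rewrite /f divzK.
have p0' : (p : int) != 0 by rewrite eqz_nat -lt0n.
have fP : padic_coherent p f.
  move=> n; apply/eqP; rewrite eqz_mod_dvd -(dvdz_mul2r p0') mulrBl !fp.
  by rewrite -PoszM -expnSr -eqz_mod_dvd padicP padic_mod.
exists (padic_of p_pr fP); apply: padic_eqP => n.
rewrite padic_mulE padic_natE /= modzMml modzMmr mulrC fp.
by rewrite -(padicP z n).
Qed.

(** Bezout gives an inverse modulo each p^n; uniqueness of inverses modulo p^n makes them
    coherent. *)
Lemma zres_unit z : zres z != 0 -> exists y : Zp, z * y = 1.
Proof.
rewrite /zres intr_Fp_eq0 => pz.
have cop n : coprimez (z n) (p ^ n)%N.
  case: n => [|n]; first by rewrite expn0 /coprimez gcdzC gcd1z.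
  rewrite coprimezE absz_nat coprimeXr// coprime_sym prime_coprime//.
  apply: contra pz => pz; rewrite -(padic_mod1 z n); apply/dvdz_mod0P; rewrite modz_mod.
  by apply/dvdz_mod0P; rewrite dvdzE.
have /choice[f fP] : forall n, exists u, (u * z n = 1 %[mod (p ^ n)%N])%Z.
  move=> n; have [[u v] /= E] := coprimezP _ _ (cop n); exists u.
  by apply/eqP; rewrite eq_sym eqz_mod_dvd -E addrAC subrr add0r dvdz_mull.
have fC : padic_coherent p f.
  move=> n; have := fP n.+1; have := fP n => E1 E2.
  have E3 : (f n.+1 * z n = 1 %[mod (p ^ n)%N])%Z.
    have -> : ((f n.+1 * z n) %% (p ^ n)%N = (f n.+1 * z n.+1) %% (p ^ n)%N)%Z.
      by rewrite -[in RHS]modzMmr padicP.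
    apply/eqP; rewrite eqz_mod_dvd; apply: (@dvdz_trans (p ^ n.+1)%N).
      by rewrite expnS PoszM dvdz_mull.
    by rewrite -eqz_mod_dvd E2.
  apply/eqP; rewrite eqz_mod_dvd -(Gauss_dvdzl _ (_ : coprimez (p ^ n)%N (z n))); last first.
    by rewrite coprimez_sym.
  by rewrite mulrBl -eqz_mod_dvd E1 E3.
exists (padic_of p_pr fC); apply: padic_eqP => n.
by rewrite padic_mulE /= modzMmr mulrC fP.
Qed.

Lemma padic_val (z : Zp) : z != 0 -> exists n u v, z = p%:R ^+ n * u /\ u * v = 1.
Proof.
move=> /padic_neq0[n]; elim: n z => [|n IH] z zn; first by rewrite padic_at0 eqxx in zn.
have [/eqP/zres_eq0[y yE]|/zres_unit[v v1]] := boolP (zres z == 0); last first.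
  by exists 0%N, z, v; rewrite expr0 mul1r.
have [|k [u [v [uE v1]]]] := IH y.
  apply: contra_neq zn => yn; rewrite yE padic_mulE padic_natE modzMml.
  have : ((p ^ n)%N %| y n.+1)%Z by apply/dvdz_mod0P; rewrite (padicP y n).
  move=> /dvdzP[c ->]; apply/dvdz_mod0P; rewrite expnS PoszM.
  by apply/dvdzP; exists c; ring.
by exists k.+1, u, v; rewrite yE uE exprS mulrA.
Qed.

Definition padic_residue (x : padic p_pr) : Fp :=
  if pselect (exists z, x = incl z) is left e then zres (sval (cid e)) else 0.

Lemma incl_inj : injective incl.
Proof. by move=> x y /eqP; rewrite /padic_incl tofrac_eq => /eqP. Qed.

Lemma padic_residueE z : padic_residue (incl z) = zres z.
Proof.
rewrite /padic_residue; case: pselect => [e|]; last by case; exists z.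
by rewrite -(incl_inj (svalP (cid e))).
Qed.

Lemma incl_nat n : incl n%:R = n%:R. Proof. by rewrite /padic_incl rmorph_nat. Qed.
Lemma inclM x y : incl (x * y) = incl x * incl y. Proof. by rewrite /padic_incl rmorphM. Qed.
Lemma inclB x y : incl (x - y) = incl x - incl y. Proof. by rewrite /padic_incl rmorphB. Qed.
Lemma incl1 : incl 1 = 1. Proof. by rewrite /padic_incl rmorph1. Qed.
Lemma inclX x n : incl (x ^+ n) = incl x ^+ n. Proof. by rewrite /padic_incl rmorphXn. Qed.
Lemma incl_eq0 x : (incl x == 0) = (x == 0). Proof. exact: tofrac_eq0. Qed.

Lemma padic_decomp (x : padic p_pr) : x != 0 -> exists i j u v,
  x = p%:R ^+ i * p%:R ^- j * incl u /\ u * v = 1.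
Proof.
have [a [b [b0 xE]]] := frac_decomp x; rewrite xE => x0.
have a0 : a != 0 by apply: contra_neq x0 => ->; rewrite tofrac0 mul0r.
have [i [u [v [aE uv]]]] := padic_val a0; have [j [u' [v' [bE uv']]]] := padic_val b0.
exists i, j, (u * v'), (v * u'); split; last by rewrite mulrACA uv [v' * _]mulrC uv' mulr1.
have u'0 : incl u' != 0.
  by rewrite incl_eq0; apply: contra_eq_neq uv' => ->; rewrite mul0r eq_sym oner_neq0.
have v'E : incl v' = (incl u')^-1.
  by apply: (mulfI u'0); rewrite mulfV// -inclM uv' incl1.
rewrite -![tofrac _]/(incl _) aE bE !inclM !inclX incl_nat v'E invfM.
by rewrite mulrACA.
Qed.

Lemma padic_dvr : is_dvr (@padic_ints p p_pr) p%:R padic_residue.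
Proof.
have pn0 n : (p%:R : padic p_pr) ^+ n != 0 by rewrite expf_neq0// padic_p_neq0.
have unitO u v : u * v = 1 -> incl v = (incl u)^-1 /\ incl u != 0.
  move=> uv; have u0 : incl u != 0.
    by rewrite incl_eq0; apply: contra_eq_neq uv => ->; rewrite mul0r eq_sym oner_neq0.
  by split=> //; apply: (mulfI u0); rewrite mulfV// -inclM uv incl1.
have dich x : x != 0 -> exists n u v, u * v = 1 /\ (x = p%:R ^+ n * incl u \/ x = p%:R ^- n * incl u).
  move=> /padic_decomp[i [j [u [v [xE uv]]]]].
  have [ij|/ltnW ij] := leqP j i.
    by exists (i - j)%N, u, v; split=> //; left; rewrite xE -[in LHS](subnK ij) exprD mulfK.
  exists (j - i)%N, u, v; split=> //; right; rewrite xE -[in LHS](subnK ij) exprD invfM.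
  by rewrite mulrCA mulfV// mulr1.
split.
- by exists 1; rewrite ?incl1.
- by move=> _ _ [x _ <-] [y _ <-]; exists (x - y); rewrite ?inclB.
- by move=> _ _ [x _ <-] [y _ <-]; exists (x * y); rewrite ?inclM.
- exact: padic_p_neq0.
- by rewrite -incl1 padic_residueE zres1.
- by move=> _ _ [x _ <-] [y _ <-]; rewrite -inclB !padic_residueE zresB.
- by move=> _ _ [x _ <-] [y _ <-]; rewrite -inclM !padic_residueE zresM.
- by move=> a; have [z <-] := zres_surj a; exists (incl z); [exists z|rewrite padic_residueE].
- move=> _ [z _ <-]; rewrite padic_residueE; split=> [/zres_eq0[y ->]|[y _ yE]].
    by rewrite inclM incl_nat mulKf ?padic_p_neq0//; exists y.
  have -> : z = p%:R * y.
    by apply: incl_inj; rewrite inclM incl_nat yE mulVKf// padic_p_neq0.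
  by rewrite zresM /zres padic_natE expn1 intr_modFp -pmulrn (pcharf0 (pchar_Fp p_pr)) mul0r.
- move=> x; have [->|/dich[n [u [v [uv [->|->]]]]]] := eqVneq x 0.
  + by left; exists 0; rewrite // /padic_incl rmorph0.
  + by left; exists (p%:R ^+ n * u) => //; rewrite inclM inclX incl_nat.
  + right; have [vE u0] := unitO _ _ uv; exists (p%:R ^+ n * v) => //.
    by rewrite inclM inclX incl_nat vE invfM invrK.
- move=> _ [z _ <-]; rewrite padic_residueE => /zres_unit[y zy].
  by have [<- _] := unitO _ _ zy; exists y.
- move=> x; have [->|/dich[n [u [v [uv [->|->]]]]]] := eqVneq x 0.
  + by exists 0%N; rewrite mulr0; exists 0; rewrite // /padic_incl rmorph0.
  + by exists 0%N; rewrite expr0 mul1r; exists (p%:R ^+ n * u) => //; rewrite inclM inclX incl_nat.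
  + by exists n; rewrite mulrA mulfV// mul1r; exists u.
- move=> x xP; have [z _ zE] := xP 0%N; rewrite expr0 invr1 mul1r in zE.
  rewrite -zE; apply/eqP; rewrite incl_eq0; apply/eqP/padic_eqP => n.
  have [y _ yE] := xP n.
  have -> : z = p%:R ^+ n * y.
    by apply: incl_inj; rewrite zE inclM inclX incl_nat yE mulVKf.
  rewrite padic_0E -natrX padic_mulE padic_natE modzz mul0r mod0z //.
Qed.

End PadicDVR.

(** * The topology of PGL_3 and the openness of vertex stabilizers *)

Lemma conj_scale_mul (F : fieldType) (a b Z : 'M[F]_3) (c d x y : F) :
  c != 0 -> a *m b = 1%:M ->
  c *: (a *m (d *: (x *: (c^-1 *: b) *m Z *m (y *: a)))) = (d * (x * y)) *: Z *m a.
Proof.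
move=> c0 ab; rewrite scalerA -?scalemxAl -?scalemxAr -?scalemxAl !scalerA.
rewrite !mulmxA ab mul1mx; congr (_ *: _); field.
exact: c0.
Qed.

Section StabilizerPerturbation.
Variables (K : fieldTopologicalType) (O : set K) (pi : K) (F : finFieldType) (res : K -> F).
Variable D : is_dvr O pi res.

(** The perturbation replaces [k] by [k + pi *: Y] with [Y] a multiple of a^-1 Z a. The exponents
    [n1] and [n2] clear the denominators of c^-1 a^-1 and a; the additional factor [pi] leaves the
    residue of [k] unchanged, so the sum stays in GL_3(O). *)
Lemma stabilizer_perturbation (a : GL3 K) (g : 'M[K]_3) :
    (exists c k, [/\ c != 0, isoK O k & g *m a = c *: (a *m k)]) ->
  exists n, forall Z, intmx O Z ->
    exists c k, [/\ c != 0, isoK O k & (g + pi ^+ n *: Z) *m a = c *: (a *m k)].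
Proof.
move=> [c [k [c0 kK E]]]; have [uk Ok Ovk] := kK; have ua := unitGL a.
have [n1 O1] := intmx_bound D (c^-1 *: invmx a); have [n2 O2] := intmx_bound D (a : 'M[K]_3).
exists (n1 + n2).+1 => Z OZ.
pose Y := (pi ^+ n1 *: (c^-1 *: invmx a)) *m Z *m (pi ^+ n2 *: (a : 'M[K]_3)).
have OY : intmx O Y by do 2?apply: (intmxM D).
exists c, (k + pi *: Y); split; first exact: c0.
  apply/(isoKP D); have OpY : intmx O (pi *: Y) by apply: (intmxZ D) => //; exact: (dvr_Opi D).
  split; first exact: (intmxD D).
  rewrite (resmxD D)// (resmxZ D)// ?(dvr_respi D) ?scale0r ?addr0; last exact: (dvr_Opi D).
  by have /(isoKP D)[] := kK.
rewrite mulmxDl E mulmxDr scalerDr; congr (_ + _).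
by rewrite exprS exprD conj_scale_mul// mulmxV.
Qed.

End StabilizerPerturbation.

Section PadicTopology.
Variables (p : nat) (p_pr : prime p).
Local Notation K := (padic p_pr).
Local Notation O := (@padic_ints p p_pr).
Local Notation D := (padic_dvr p_pr).
Local Notation pi := (p%:R : K).
Local Notation piG := (\pi_(PGL3 K)).

Lemma padic_ball_open (x : K) n : open [set x + pi ^+ n * z | z in O].
Proof.
suff : padic_open [set x + pi ^+ n * z | z in O] by [].
move=> _ [_ [z _ <-] <-]; exists n => y; exists (padic_incl (z + y)); first by exists (z + y).
by rewrite /padic_incl rmorphD mulrDr addrA natrX.
Qed.

Lemma padic_nbhs_ball (x : K) A : nbhs x A -> exists n, forall z, O z -> A (x + pi ^+ n * z).
Proof.
rewrite nbhsE => -[B [oB Bx] BA]; have pB : padic_open B := oB.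
have [n nP] := pB x Bx; exists n => _ [z _ <-]; apply: BA.
by have := nP z; rewrite natrX.
Qed.

Lemma padic_mx_openP m n (V : set 'M[K]_(m, n)) :
  open V <-> forall g, V g -> exists k, forall Z, intmx O Z -> V (g + pi ^+ k *: Z).
Proof.
rewrite openE; split=> [oV g /oV[P gP PV]|oV g /oV[k kP]].
  have /choice[f fP] : forall ij : 'I_m * 'I_n, exists k, forall z, O z ->
      P ij.1 ij.2 (g ij.1 ij.2 + pi ^+ k * z).
    by move=> ij; apply: padic_nbhs_ball; exact: gP.
  exists (\sum_ij f ij)%N => Z OZ; apply: PV => i j; rewrite !mxE (bigD1 (i, j))//= exprD -mulrA.
  apply: (fP (i, j)); apply: (dvrM D) => //; exact/(dvrX D)/(dvr_Opi D).
exists (fun i j => [set g i j + pi ^+ k * z | z in O]).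
  move=> i j; apply: open_nbhs_nbhs; split; first exact: padic_ball_open.
  by exists 0; [exact: (dvr0 D)|rewrite mulr0 addr0].
move=> m' m'P; have /choice[Z ZP] : forall ij : 'I_m * 'I_n, exists z, O z /\
    g ij.1 ij.2 + pi ^+ k * z = m' ij.1 ij.2.
  by move=> [i j]; have [z Oz zE] := m'P i j; exists z.
have -> : m' = g + pi ^+ k *: \matrix_(i, j) Z (i, j).
  by apply/matrixP => i j; rewrite !mxE (ZP (i, j)).2.
by apply: kP => i j; rewrite mxE; exact: (ZP (i, j)).1.
Qed.

Lemma PGL3_open (U : set (PGL3 K)) (V : set 'M[K]_3) : open V ->
  (forall g : GL3 K, U (piG g) <-> V g) -> open U.
Proof.
move=> oV UV; suff : open ((\pi_(PGL3 K)) @^-1` U : set (GL3 K)) by [].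
suff : wopen (@GL3_mx K) ((\pi_(PGL3 K)) @^-1` U) by [].
by exists V => //; apply/seteqP; split=> g /= /UV.
Qed.

Lemma PGL3_openP (U : set (PGL3 K)) : open U ->
  exists2 V : set 'M[K]_3, open V & forall g : GL3 K, U (piG g) <-> V g.
Proof.
move=> oU; have : wopen (@GL3_mx K) ((\pi_(PGL3 K)) @^-1` U) by exact: oU.
by move=> [V oV VE]; exists V => // g; have := congr1 (@^~ g) VE; rewrite /preimage /= => ->.
Qed.

Lemma stabilizer_open (x : bt_vertex O) : open [set s : PGL3 K | bt_actV O s x = x].
Proof.
have [a ->] := vtx_surj x.
pose V := [set m : 'M[K]_3 | exists c k, [/\ c != 0, isoK O k & m *m a = c *: (a *m k)]].
apply: (@PGL3_open _ V); last first.
  move=> g; have -> : [set s | bt_actV O s (vtx O a) = vtx O a] (piG g) = (vtx O (g * a)%g = vtx O a).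
    by rewrite -act_vtx.
  exact: (vtx_eq D).
by apply/padic_mx_openP => g /(stabilizer_perturbation D).
Qed.

Lemma PGL3_mulr_open (t : PGL3 K) (U : set (PGL3 K)) : open U ->
  open [set s | U (s * t)%g].
Proof.
elim/quotW: t => h /PGL3_openP[V oV UV].
apply: (@PGL3_open _ [set m | V (m *m h)]); last first.
  by move=> g; rewrite /= PGL3_piMg; exact: UV.
apply/padic_mx_openP => g /= Vgh; have /padic_mx_openP/(_ _ Vgh)[n nP] := oV.
have [k Ok] := intmx_bound D (h : 'M[K]_3).
exists (n + k)%N => Z OZ; rewrite mulmxDl exprD -scalerA -scalemxAl.
apply: nP; rewrite -scalemxAl scalemxAr.
exact: (intmxM D).
Qed.

End PadicTopology.

(** * Lattices *)

Section LatticePushforward.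
Variables (R : realType) (G G' : groupTopologicalType) (Gamma : subgroup G).
Variables (pr : G -> G') (sec : G' -> G) (U : set G) (H : subgroup G').
Hypothesis prM : forall g h, pr (g * h)%g = (pr g * pr h)%g.
Hypothesis secK : forall h, pr (sec h) = h.
Hypothesis pr_open : forall W, open W -> open (pr @^-1` W).
Hypothesis mulr_open : forall t W, open W -> open [set s : G | W (s * t)%g].
Hypothesis openU : open U.
Hypothesis U_sec : forall h g, U g -> U (sec h * g)%g.
Hypothesis U_div : forall g h, U g -> U h -> U (g^-1 * h)%g.
Hypothesis Gamma_U : forall g, exists2 c, (Gamma : set G) c & U (g * c)%g.
Hypothesis H_eq : forall h, (H : set G') h <-> exists c, [/\ (Gamma : set G) c, U c & h = pr c].

Local Notation piG := (\pi_(coset_space Gamma)).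
Local Notation piH := (\pi_(coset_space H)).

Lemma coset_eqP (G0 : groupTopologicalType) (H0 : subgroup G0) (x y : G0) :
  \pi_(coset_space H0) x = \pi_(coset_space H0) y <-> (H0 : set G0) (x^-1 * y)%g.
Proof. by split=> [/eqmodP/asboolP//|xy]; exact/eqmodP/asboolP. Qed.

Lemma coset_act_pi (G0 : groupTopologicalType) (H0 : subgroup G0) (g x : G0) :
  coset_act g (\pi_(coset_space H0) x) = \pi_(coset_space H0) (g * x)%g.
Proof.
apply/coset_eqP; rewrite invgM mulgA mulgVK.
by apply/coset_eqP; rewrite reprK.
Qed.

Let toU g : G := sval (cid2 (Gamma_U g)).
Let toU_Gamma g : (Gamma : set G) (toU g). Proof. by rewrite /toU; case: cid2. Qed.
Let toU_U g : U (g * toU g)%g. Proof. by rewrite /toU; case: cid2. Qed.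

(** Every coset of [Gamma] meets [U], and two points of one coset in [U] differ by an element of
    [Gamma] in [U], whose projection lies in [H]. Hence move the representative into [U], then
    project. *)
Definition coset_proj (x : coset_space Gamma) : coset_space H :=
  piH (pr (repr x * toU (repr x))%g).

Lemma pr_inv g : pr g^-1%g = (pr g)^-1%g.
Proof.
have pr1 : pr 1%g = 1%g by apply: (mulgI (pr 1%g)); rewrite -prM !mulg1.
by apply: (mulgI (pr g)); rewrite -prM !mulgV.
Qed.

Lemma coset_proj_pi g c : (Gamma : set G) c -> U (g * c)%g ->
  coset_proj (piG g) = piH (pr (g * c)%g).
Proof.
move=> Gc Ugc; rewrite /coset_proj; set r := repr _.
have /coset_eqP gr : piG g = piG r by rewrite reprK.
apply/coset_eqP/H_eq; exists ((r * toU r)^-1 * (g * c))%g; split.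
- rewrite invgM -mulgA (mulgA r^-1%g); apply: subgroupM; first exact/subgroupV/toU_Gamma.
  by apply: subgroupM => //; move/subgroupV: gr; rewrite invgM invgK.
- exact/U_div.
- by rewrite -pr_inv -prM.
Qed.

Lemma coset_proj_continuous W : open W -> open (coset_proj @^-1` W).
Proof.
move=> oW; suff oP : open [set g | (coset_proj @^-1` W) (piG g)] by [].
have -> : [set g | (coset_proj @^-1` W) (piG g)] =
    \bigcup_(c in (Gamma : set G)) [set g | (U `&` pr @^-1` (piH @^-1` W)) (g * c)%g].
  apply/seteqP; split=> g /=.
    move=> Wg; exists (toU g) => //; split; first exact: toU_U.
    by rewrite /preimage /= -(coset_proj_pi (toU_Gamma g) (toU_U g)).
  by move=> [c Gc [Ugc]]; rewrite /preimage /= -(coset_proj_pi Gc Ugc).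
apply: bigcup_open => c _; apply: mulr_open; apply: openI => //.
exact/pr_open.
Qed.

Lemma coset_proj_act h x : coset_proj (coset_act (sec h) x) = coset_act h (coset_proj x).
Proof.
rewrite -[x]reprK; move: (repr x) => g.
rewrite coset_act_pi (coset_proj_pi (toU_Gamma g) (toU_U g)) coset_act_pi.
have Uh : U (sec h * g * toU g)%g by rewrite -mulgA; exact/U_sec/toU_U.
by rewrite (coset_proj_pi (toU_Gamma g) Uh); congr piH; rewrite -mulgA (prM (sec h)) secK.
Qed.

Lemma coset_proj_measurable :
  measurable_fun [set: borel_coset_space Gamma]
    (coset_proj : borel_coset_space Gamma -> borel_coset_space H).
Proof.
apply: (measurability (@open (coset_space H) : set (set (borel_coset_space H)))) => [//|].
move=> _ [W oW <-].
rewrite setTI; apply: sub_sigma_algebra; exact: coset_proj_continuous.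
Qed.

Lemma lattice_pushforward : is_lattice R Gamma -> discrete_subgroup H ->
  is_lattice R H.
Proof.
move=> [_ [mu [mu0 muoo muI]]] dH; split=> //.
have mphi := coset_proj_measurable.
unshelve refine (ex_intro _ [the {measure set (borel_coset_space H) -> \bar R} of
  pushforward mu (coset_proj : borel_coset_space Gamma -> borel_coset_space H)] _).
  exact: mphi.
split; rewrite /= ?/pushforward //.
move=> h A mA; rewrite -[RHS](muI (sec h)); last first.
  by rewrite -[X in measurable X]setTI; exact: mphi.
by congr (mu _); apply/seteqP; split=> x; rewrite /preimage /= coset_proj_act.
Qed.

End LatticePushforward.

(** * The quotient complex and its automaton *)

Lemma orbit_eqP (G : groupType) (H : subgroup G) (T : choiceType) (a : action G T) x y :
  \pi_(orbit_space H a) x = \pi_(orbit_space H a) y <->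
  exists2 g, (H : set G) g & y = a g x.
Proof. by split=> [/eqmodP/asboolP//|xy]; exact/eqmodP/asboolP. Qed.

Lemma orbit_pi_repr (G : groupType) (H : subgroup G) (T1 T2 : choiceType)
    (a1 : action G T1) (a2 : action G T2) (f : T1 -> T2) x :
  (forall g x, f (a1 g x) = a2 g (f x)) ->
  \pi_(orbit_space H a2) (f (repr (\pi_(orbit_space H a1) x))) = \pi_(orbit_space H a2) (f x).
Proof.
move=> fE; have /esym/orbit_eqP[g Hg ->] := reprK (\pi_(orbit_space H a1) x).
by apply/esym/orbit_eqP; exists g.
Qed.

Lemma actK (G : groupType) (T : choiceType) (a : action G T) g : cancel (a g) (a g^-1%g).
Proof. by move=> x; rewrite -actM mulVg act1. Qed.

Lemma actKV (G : groupType) (T : choiceType) (a : action G T) g : cancel (a g^-1%g) (a g).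
Proof. by move=> x; rewrite -actM mulgV act1. Qed.

Section QuotientComplex.
Variables (G : groupType) (H : subgroup G) (X : vh_data) (a : vh_action G X).
Local Notation Q := (quotient_vh H a).
Local Notation piV := (\pi_(orbit_space H (sactV a))).
Local Notation piE := (\pi_(orbit_space H (sactE a))).
Local Notation piS := (\pi_(orbit_space H (sactS a))).

Lemma quo_org e : @sq_org Q (piE e) = piV (sq_org e).
Proof. exact/orbit_pi_repr/sact_org. Qed.
Lemma quo_inv e : @sq_inv Q (piE e) = piE (sq_inv e).
Proof. exact/orbit_pi_repr/sact_inv. Qed.
Lemma quo_side s : @sq_side Q (piS s) = piE (sq_side s).
Proof. exact/orbit_pi_repr/sact_side. Qed.
Lemma quo_rot s : @sq_rot Q (piS s) = piS (sq_rot s).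
Proof. exact/orbit_pi_repr/sact_rot. Qed.
Lemma quo_refl s : @sq_refl Q (piS s) = piS (sq_refl s).
Proof. exact/orbit_pi_repr/sact_refl. Qed.
Lemma quo_iter_rot n s : iter n (@sq_rot Q) (piS s) = piS (iter n (@sq_rot X) s).
Proof. by elim: n => // n IH; rewrite iterS IH quo_rot. Qed.
Lemma quo_iter_refl n s : iter n (@sq_refl Q) (piS s) = piS (iter n (@sq_refl X) s).
Proof. by elim: n => // n IH; rewrite iterS IH quo_refl. Qed.
Lemma quo_hor e : @sq_hor Q (piE e) <-> sq_hor e.
Proof.
rewrite /= /quotient_vh /=; have /esym/orbit_eqP[g Hg ->] := reprK (piE e).
by rewrite sact_hor.
Qed.

Lemma corner_org (s : sqS X) : square_complex X -> sq_org (sq_side (sq_refl s)) = sq_org (sq_side s).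
Proof. by move=> XC; rewrite (side_refl XC) -[LHS](side_rot XC) -iterS (rot4 XC). Qed.

Hypotheses (Xfree : free_on_cells H a) (XP : VHT_complex X).

Lemma free_fix_vertex g v : (H : set G) g -> sactV a g v = v -> g = 1%g.
Proof.
move=> Hg gv; apply: contrapT => g1.
by have [/(_ v)] := Xfree Hg g1; rewrite gv.
Qed.

(** Freeness on non-oriented edges and squares is what keeps an edge distinct from its inverse and
    the dihedral action free after passing to the quotient. *)
Lemma quotient_square_complex : square_complex Q.
Proof.
have XC := VH_square_complex (VHT_VH XP); split.
- by elim/quotW=> e; rewrite (quo_inv e) quo_inv (Defs.invK XC).
- elim/quotW=> e; rewrite (quo_inv e) => /orbit_eqP[g Hg ge].
  have [g1|g1] := pselect (g = 1%g).
    by move: ge; rewrite g1 act1 => /esym; exact: (inv_neq XC).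
  by have [_ /(_ (sq_inv e))[_]] := Xfree Hg g1; rewrite -ge (Defs.invK XC).
- elim/quotW=> s; rewrite (quo_rot s) (quo_side (sq_rot s)) quo_org (quo_side s) (side_rot XC).
  by rewrite /sq_term (quo_inv (sq_side s)) quo_org.
- elim/quotW=> s; rewrite (quo_refl s) (quo_iter_rot 3 s) (quo_side (sq_refl s)).
  by rewrite (quo_side (iter 3 _ s)) quo_inv (side_refl XC).
- by elim/quotW=> s; rewrite (quo_iter_rot 4 s) (rot4 XC).
- by elim/quotW=> s; rewrite (quo_refl s) (quo_refl (sq_refl s)) (refl2 XC).
- elim/quotW=> s; rewrite (quo_rot s) (quo_refl s) (quo_refl (sq_rot s)).
  by rewrite (quo_iter_rot 3 (sq_refl s)) (refl_rot XC).
- elim/quotW=> s i b; rewrite (quo_iter_refl b s) (quo_iter_rot i (iter b _ s)).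
  move=> /esym/orbit_eqP[g Hg gs].
  have [g1|g1] := pselect (g = 1%g).
    by move: gs; rewrite g1 act1; exact: (dihedral_free XC).
  by have [_ _ /(_ s i b)] := Xfree Hg g1; rewrite gs.
Qed.

(** Lift the two edges to a common origin and take the corner there. A second corner lifts its two
    sides by elements k and l of [H], and k^-1 l fixes the origin, so k = l and the corner upstairs
    is the same. *)
Lemma quotient_VHT : VHT_complex Q.
Proof.
have XC := VH_square_complex (VHT_VH XP).
split; first split; first exact: quotient_square_complex.
- by elim/quotW=> e; rewrite (quo_inv e) (quo_hor e) (quo_hor (sq_inv e)); exact: (VH_inv (VHT_VH XP)).
- elim/quotW=> s e f []; rewrite (quo_refl s) (quo_side s) (quo_side (sq_refl s)) => <- <-.
  rewrite (quo_hor (sq_side s)) (quo_hor (sq_side (sq_refl s))).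
  exact: (VH_bipartite (VHT_VH XP)).
elim/quotW=> e; elim/quotW=> f'; rewrite (quo_org e) (quo_org f') (quo_hor e) (quo_hor f') => /orbit_eqP[g Hg gf] he hf'.
pose f := sactE a g^-1%g f'.
have -> : piE f' = piE f by apply/orbit_eqP; exists g^-1%g => //; exact: subgroupV.
have of_ : sq_org e = sq_org f by rewrite sact_org gf actK.
have hf : ~ sq_hor f by rewrite sact_hor.
have [s [[se sf] us]] := VHT_complete XP of_ he hf.
exists (piS s); split; first by split; rewrite ?(quo_refl s) ?(quo_side s) ?(quo_side (sq_refl s)) ?se ?sf.
elim/quotW=> t []; rewrite (quo_refl t) (quo_side t) (quo_side (sq_refl t)) => /esym/orbit_eqP[k Hk kt] /esym/orbit_eqP[l Hl lt].
have rt : sactV a (k^-1 * l)%g (sq_org f) = sq_org f.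
  rewrite actM -sact_org -lt corner_org// kt sact_org actK; exact: of_.
have kl : k = l.
  apply/esym/(mulgI k^-1%g); rewrite mulVg; apply: (free_fix_vertex _ rt).
  by apply: subgroupM => //; exact: subgroupV.
have -> : piS t = piS (sactS a k^-1%g t).
  by apply/orbit_eqP; exists k^-1%g => //; exact: subgroupV.
congr piS; apply: us; split; rewrite ?sact_refl sact_side.
  by rewrite kt actK.
by rewrite lt kl actK.
Qed.

Lemma quotient_finite_VHT1 (v : sqV X) : vertex_transitive H a ->
  finite_set [set e : sqE X | sq_org e = v] ->
  finite_set [set s : sqS X | sq_org (sq_side s) = v] ->
  finite_VHT1_complex Q.
Proof.
move=> Htr finE finS; split; first exact: quotient_VHT.
- exists (piV v); elim/quotW=> w; apply/esym/orbit_eqP; exact: Htr.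
- apply: (sub_finite_set _ (finite_image piE finE)) => + _; elim/quotW=> e.
  have [g Hg ge] := Htr (sq_org e) v.
  exists (sactE a g e); first by rewrite /= sact_org.
  by apply/esym/orbit_eqP; exists g.
- apply: (sub_finite_set _ (finite_image piS finS)) => + _; elim/quotW=> s.
  have [g Hg gs] := Htr (sq_org (sq_side s)) v.
  exists (sactS a g s); first by rewrite /= sact_side sact_org.
  by apply/esym/orbit_eqP; exists g.
Qed.

End QuotientComplex.

Section GraphProduct.
Variables A B : graph.
Hypotheses (invKA : involutive (@ginv A)) (invKB : involutive (@ginv B)).
Hypotheses (neqA : forall e : gE A, ginv e <> e) (neqB : forall e : gE B, ginv e <> e).

Lemma graph_prod_VHT : VHT_complex (graph_prod A B).
Proof.
split; first split; first split.
- by case=> [[e v]|[v e]] /=; rewrite ?invKA ?invKB.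
- by case=> [[e v]|[v e]] /= E; [apply: (neqA (e := e))|apply: (neqB (e := e))]; case: E.
- by case=> [[e f] []] /=; rewrite /sq_term /=.
- by case=> [[e f] []] /=; rewrite /= ?invKA ?invKB.
- by case=> [[e f] []] /=; rewrite ?invKA ?invKB.
- by case=> [[e f] []].
- by case=> [[e f] []] /=; rewrite ?invKA ?invKB.
- move=> s [i ilt] b E; move: (congr1 (fun s => s.1.1) E) (congr1 (fun s => s.1.2) E) (congr1 snd E).
  case: s {E} => [[e f] c]; case: i ilt => [|[|[|[|i]]]] // ilt; case: b; case: c => //= eE fE cE;
    first [by split=> //; exact/val_inj | by case: (neqA eE) | by case: (neqB fE)].
- by case=> [[e v]|[v e]].
- by case=> [[e f] []] _ _ [<- <-] /=; tauto.
move=> [[e v]|[v e]] [[f w]|[w f]] //= -[<- ->] _ _.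
  exists ((e, f), true); split; first by split.
  move=> [[e' f'] []] [] //= E1 E2.
  by have -> : e' = e; [case: E1|have -> : f' = f; [case: E2|]].
Qed.

Lemma graph_prod_finE (u : gV A) (v : gV B) :
  finite_set [set e : gE A | gorg e = u] -> finite_set [set e : gE B | gorg e = v] ->
  finite_set [set e : sqE (graph_prod A B) | sq_org e = (u, v)].
Proof.
move=> fA fB; have fE : finite_set
    ([set (inl (e, v) : sqE (graph_prod A B)) | e in [set e : gE A | gorg e = u]] `|`
     [set inr (u, e) | e in [set e : gE B | gorg e = v]]).
  by rewrite finite_setU; split; exact: finite_image.
apply: sub_finite_set fE => -[[e w]|[w e]] /= [].
  by move=> <- <-; left; exists e.
by move=> <- <-; right; exists e.
Qed.

Lemma graph_prod_finS (u : gV A) (v : gV B) :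
  finite_set [set e : gE A | gorg e = u] -> finite_set [set e : gE B | gorg e = v] ->
  finite_set [set s : sqS (graph_prod A B) | sq_org (sq_side s) = (u, v)].
Proof.
move=> fA fB; apply: sub_finite_set (finite_setX (finite_setX fA fB) (@finite_finset bool setT)) => //.
by move=> [[e f] []] /= [<- <-]; split.
Qed.

End GraphProduct.

Lemma isomorphic_subgroups (G G' : groupType) (L : subgroup G) (M : subgroup G') (f : G -> G') :
  (forall x y, (L : set G) x -> (L : set G) y -> f (x * y)%g = (f x * f y)%g) ->
  (forall x, (L : set G) x -> f x = 1%g -> x = 1%g) ->
  f @` L = M -> isomorphic (subgroup_type M) (subgroup_type L).
Proof.
move=> fM f1 fLM.
have ex (y : subgroup_type M) : exists x : subgroup_type L, f (val x) = val y.
  have ML h : (M : set G') h -> (f @` L) h by rewrite fLM.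
  by have [x Lx fx] := ML _ (subgroup_valP y); exists (exist _ x (mem_set Lx)).
have [g gK] := choice ex.
have finj (x y : subgroup_type L) : f (val x) = f (val y) -> x = y.
  move=> fxy; have Lx := subgroup_valP x; have Ly := subgroup_valP y.
  have f11 : f 1%g = 1%g.
    by apply: (mulgI (f 1%g)); rewrite -fM ?mulg1//; exact: subgroup1.
  have LVx := subgroupV Lx.
  apply/val_inj/(mulgI (val x)^-1%g); rewrite mulVg; apply/esym/f1; first exact: subgroupM.
  by rewrite fM// -fxy -fM// mulVg.
have gM : {morph g : x y / (x * y)%g >-> (x * y)%g}.
  move=> x y; apply: finj; rewrite gK.
  rewrite [val (g x * g y)%g]/= fM ?gK//; exact: subgroup_valP.
have g1 : g 1%g = 1%g by apply: (mulgI (g 1%g)); rewrite -gM !mulg1.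
pose gm := isMultiplicative.Build (subgroup_type M) (subgroup_type L) g gM.
pose h : {multiplicative subgroup_type M -> subgroup_type L} := HB.pack g gm.
exists h.
have fM' (x : subgroup_type L) : f (val x) \in (M : set G').
  have LM y : (f @` L) y -> (M : set G') y by rewrite fLM.
  apply/mem_set/LM; exists (val x) => //; exact: subgroup_valP.
exists (fun x => exist _ (f (val x)) (fM' x)).
  by move=> y; apply/val_inj; rewrite /= gK.
by move=> x; apply: finj; rewrite gK.
Qed.

(** * The automaton as an action on edge paths *)

Section ProductAutomaton.
Variables (G1 G2 : groupType) (A B : graph) (a1 : graph_action G1 A) (a2 : graph_action G2 B).
Variable Gamma : subgroup (G1 * G2)%type.
Local Notation X := (graph_prod A B).
Local Notation a := (graph_prod_action a1 a2).
Local Notation Q := (quotient_vh Gamma a).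
Local Notation piE := (\pi_(orbit_space Gamma (sactE a))).
Local Notation piS := (\pi_(orbit_space Gamma (sactS a))).
Hypothesis ginvK : involutive (@ginv A).
Hypothesis free : forall c, (Gamma : set _) c -> forall u v,
  gactV a1 c.1 u = u -> gactV a2 c.2 v = v -> c = 1%g.
Hypothesis tr : forall u v u' v', exists2 c, (Gamma : set _) c &
  gactV a1 c.1 u = u' /\ gactV a2 c.2 v = v'.
Variable QP : finite_VHT1_complex Q.
Local Notation AT := (automaton_T QP).
Local Notation hor := (set_type (@sq_hor Q)).
Local Notation ver := (set_type (~` @sq_hor Q)).

Definition gterm (C : graph) (e : gE C) := gorg (ginv e).

Fact label_subproof (v : gV B) (e : gE A) : piE (inl (e, v)) \in @sq_hor Q.
Proof. by apply/mem_set/(quo_hor Gamma a). Qed.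
Definition label (v : gV B) (e : gE A) : alphabet AT :=
  exist (fun x => x \in @sq_hor Q) _ (label_subproof v e).

Fact state_subproof (u : gV A) (b : gE B) : piE (inr (u, b)) \in ~` @sq_hor Q.
Proof. by apply/mem_set => /(quo_hor Gamma a). Qed.
Definition state_of (u : gV A) (b : gE B) : states AT :=
  exist (fun x => x \in ~` @sq_hor Q) _ (state_subproof u b).

Lemma label_act c v e : (Gamma : set _) c ->
  label (gactV a2 c.2 v) (gactE a1 c.1 e) = label v e.
Proof.
by move=> Gc; apply/val_inj/esym/(orbit_eqP Gamma (sactE a)); exists c.
Qed.

Lemma state_act c u b : (Gamma : set _) c ->
  state_of (gactV a1 c.1 u) (gactE a2 c.2 b) = state_of u b.
Proof.
by move=> Gc; apply/val_inj/esym/(orbit_eqP Gamma (sactE a)); exists c.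
Qed.

Lemma label_inj v e e' : gorg e = gorg e' -> label v e = label v e' -> e = e'.
Proof.
move=> ee' /(congr1 val)/(orbit_eqP Gamma (sactE a))[c Gc /= E].
have E1 : e' = gactE a1 c.1 e by case: E.
have E2 : v = gactV a2 c.2 v by case: E.
have c1 : c = 1%g.
  by apply: (free Gc (u := gorg e) (v := v)) => //; rewrite -gact_org -E1.
by rewrite E1 c1 act1.
Qed.

Lemma label_surj u v (x : alphabet AT) : exists2 e, gorg e = u & label v e = x.
Proof.
case: x => x; elim/quotW: x => -[[e w]|[w b]] xh; last first.
  by have /set_mem/(quo_hor Gamma a) := xh.
have [c Gc [cu cv]] := tr (gorg e) w u v.
exists (gactE a1 c.1 e); first by rewrite gact_org.
by rewrite -cv label_act//; exact/val_inj.
Qed.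

Lemma state_surj u v (q : states AT) : exists2 b, gorg b = v & state_of u b = q.
Proof.
case: q => q; elim/quotW: q => -[[e w]|[w b]] qv.
  by have /set_mem/(_ (proj2 (quo_hor Gamma a (inl (e, w))) I)) := qv.
have [c Gc [cu cv]] := tr w (gorg b) u v.
exists (gactE a2 c.2 b); first by rewrite gact_org.
by rewrite -cu state_act//; exact/val_inj.
Qed.

Lemma corner_square_label e b :
  corner_square QP (label (gorg b) e) (state_of (gorg e) b) = piS ((e, b), true).
Proof.
rewrite /corner_square; case: cid => s /= sP.
have [| | |t [_ tU]] := VHT_complete (VHT1_VHT QP) (e := piE (inl (e, gorg b)))
    (f := piE (inr (gorg e, b))).
- by rewrite [LHS](quo_org Gamma a) [RHS](quo_org Gamma a).
- exact/(quo_hor Gamma a).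
- by move/(quo_hor Gamma a).
rewrite -(tU s sP); apply: tU; split; first exact: (quo_side Gamma a).
by rewrite (quo_refl Gamma a ((e, b), true)); exact: (quo_side Gamma a).
Qed.

Lemma trans_label e b :
  trans (label (gorg b) e) (state_of (gorg e) b) = state_of (gterm e) b.
Proof.
apply/val_inj.
change (@sq_side Q (sq_rot (corner_square QP (label (gorg b) e) (state_of (gorg e) b))) =
  piE (inr (gterm e, b))).
by rewrite corner_square_label (quo_rot Gamma a ((e, b), true)); exact: (quo_side Gamma a).
Qed.

Lemma out_label e b :
  out (label (gorg b) e) (state_of (gorg e) b) = label (gterm b) e.
Proof.
apply/val_inj.
change (@sq_inv Q (sq_side (sq_rot (sq_rot (corner_square QP (label (gorg b) e)
  (state_of (gorg e) b))))) = piE (inl (e, gterm b))).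
rewrite corner_square_label (quo_rot Gamma a ((e, b), true)) (quo_rot Gamma a ((ginv e, b), false)).
rewrite (quo_side Gamma a ((ginv e, ginv b), true)).
by rewrite (quo_inv Gamma a (inl (ginv e, gorg (ginv b)))) /= ginvK.
Qed.

Fixpoint is_path (u : gV A) (P : seq (gE A)) : Prop :=
  if P is e :: P' then gorg e = u /\ is_path (gterm e) P' else True.

Lemma is_path_act c u P : is_path u P -> is_path (gactV a1 c u) (map (gactE a1 c) P).
Proof.
elim: P u => //= e P IH u [eu /IH]; rewrite gact_org eu; split=> //.
by rewrite /gterm gact_inv gact_org.
Qed.

(** The computation runs through the strip of squares between P and its translate along [b]: the
    state is carried to the next copy of [b], and the output is the label on the opposite side. *)
Lemma transducer_label u b P : is_path u P ->
  transducer (state_of u b) (map (label (gorg b)) P) = map (label (gterm b)) P.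
Proof.
elim: P u => // e P IH u [<- eP]; rewrite !map_cons.
have cons q x w : @transducer AT q (x :: w) = out x q :: transducer (trans x q) w by [].
by rewrite cons out_label trans_label IH.
Qed.

Lemma word_path u v (w : seq (alphabet AT)) : exists P, is_path u P /\ map (label v) P = w.
Proof.
elim: w u => [|x w IH] u; first by exists [::].
have [e eu ex] := label_surj u v x; have [P [uP Pw]] := IH (gterm e).
by exists (e :: P); split=> //=; rewrite ex Pw.
Qed.

Lemma path_inj u v P P' : is_path u P -> is_path u P' ->
  map (label v) P = map (label v) P' -> P = P'.
Proof.
elim: P P' u => [|e P IH] [|e' P'] u; [by []|by move=> _ _ /(congr1 size)|
  by move=> _ _ /(congr1 size)|move=> [eu uP] [eu' uP'] E].
have ee : e = e' by apply: (label_inj _ (congr1 (head (label v e)) E)); rewrite eu eu'.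
by subst e'; congr (_ :: _); apply: IH uP uP' (congr1 behead E).
Qed.

Variables (Op : gV A) (Oq : gV B).
Local Notation L := (stabilizer Gamma (fst_action G2 (gactV a1)) Op).
Local Notation word := (seq (alphabet AT)).

Definition path_of (w : word) : seq (gE A) := sval (cid (word_path Op Oq w)).
Lemma path_ofP w : is_path Op (path_of w).
Proof. by rewrite /path_of; case: cid => P []. Qed.
Lemma path_ofK w : map (label Oq) (path_of w) = w.
Proof. by rewrite /path_of; case: cid => P []. Qed.
Lemma labelK P : is_path Op P -> path_of (map (label Oq) P) = P.
Proof. by move=> uP; apply: path_inj (path_ofP _) uP (path_ofK _). Qed.

Definition path_map (c : (G1 * G2)%type) (w : word) : word :=
  map (label Oq) (map (gactE a1 c.1) (path_of w)).

Lemma path_mapM c d w : (L : set _) d -> path_map (c * d)%g w = path_map c (path_map d w).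
Proof.
move=> [Gd dO]; rewrite /path_map labelK; last first.
  by rewrite -[X in is_path X]dO; exact/is_path_act/path_ofP.
rewrite -(map_comp (gactE a1 c.1) (gactE a1 d.1)); congr (map _ _).
by apply: eq_map => e; rewrite /= actM.
Qed.

Lemma path_map1 w : path_map 1%g w = w.
Proof. by rewrite /path_map (eq_map (act1 _)) map_id path_ofK. Qed.

Lemma path_map_bij c : (L : set _) c -> bijective (path_map c).
Proof.
move=> Lc; exists (path_map c^-1%g) => w.
  by rewrite -path_mapM// mulVg path_map1.
by rewrite -path_mapM ?mulgV ?path_map1//; exact: subgroupV.
Qed.

Lemma transducer_path_map b c : gorg b = Oq -> (L : set _) c ->
  gactV a2 c.2 (gterm b) = Oq -> transducer (state_of Op b) =1 path_map c.
Proof.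
move=> bO [Gc cO] cb w; rewrite -{1}(path_ofK w) -{1}bO transducer_label; last exact: path_ofP.
rewrite /path_map -map_comp; apply: eq_map => e /=.
by rewrite -cb label_act.
Qed.

Lemma stab_ex u v : exists2 c, (L : set _) c & gactV a2 c.2 u = v.
Proof. by have [c Gc [cO cb]] := tr Op u Op v; exists c. Qed.

Lemma automaton_T_invertible : invertible_automaton AT.
Proof.
move=> q; have [b bO <-] := state_surj Op Oq q; have [c Lc cb] := stab_ex (gterm b) Oq.
by apply: (eq_bij (path_map_bij Lc)) => w; rewrite (transducer_path_map bO Lc cb).
Qed.

(** A total function with default 1, as [path_map c] is shown to be bijective for [c] in the
    stabilizer only. *)
Definition path_bij (c : (G1 * G2)%type) : bijection word :=
  if pselect (bijective (path_map c)) is left e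
  then exist (fun f => `[< bijective f >]) (path_map c) (asboolT e) else 1%g.

Lemma path_bijE c : (L : set _) c -> sval (path_bij c) =1 path_map c.
Proof. by move=> Lc w; rewrite /path_bij; case: pselect => // /(_ (path_map_bij Lc)). Qed.

Lemma path_bijM c d : (L : set _) c -> (L : set _) d ->
  path_bij (c * d)%g = (path_bij c * path_bij d)%g.
Proof.
move=> Lc Ld; apply: bijection_inj => w; rewrite /= !path_bijE//; last exact: subgroupM.
exact: path_mapM.
Qed.

Hypothesis connA : forall P : gV A -> Prop, P Op ->
  (forall e, P (gorg e) -> P (gterm e)) -> forall u, P u.
Hypothesis connB : forall P : gV B -> Prop, P Oq ->
  (forall e, P (gorg e) -> P (gterm e)) -> forall u, P u.
Hypothesis faithA : forall c, (Gamma : set _) c -> (forall u, gactV a1 c.1 u = u) -> c = 1%g.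

(** A trivial action on words fixes every path from [Op], hence the end of every path, that is every
    vertex of A. *)
Lemma path_bij_ker c : (L : set _) c -> path_bij c = 1%g -> c = 1%g.
Proof.
move=> Lc c1; have [Gc cO] := Lc; apply: faithA => // u.
have fixP P : is_path Op P -> map (gactE a1 c.1) P = P.
  move=> uP; apply: (@path_inj Op Oq) => //.
    by rewrite -[X in is_path X]cO; exact: is_path_act.
  have := path_bijE Lc (map (label Oq) P); rewrite c1 /path_map labelK// => <-.
pose reach u := exists P, forall P', is_path u P' -> is_path Op (P ++ P').
suff : gactV a1 c.1 u = u /\ reach u by case.
move: u; apply: connA => [|e [_ [P PP]]]; first by split=> //; exists [::].
have eP := PP [:: e] (conj erefl I); split; last first.
  by exists (rcons P e) => P' eP'; rewrite cat_rcons; exact: PP.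
have := congr1 (last e) (fixP _ eP); rewrite map_cat !last_cat /= => ee.
by rewrite /gterm -gact_org -gact_inv ee.
Qed.

(** For the first inclusion, follow a path from [Oq] to c^-1 Oq. If its last edge is b and [d]
    carries the origin of b to [Oq], then c = (c d^-1) d, where c d^-1 is the generator of the edge
    d b and [d] is covered by induction. *)
Lemma automaton_group_eq (inv : invertible_automaton AT) :
  path_bij @` L = automaton_group inv :> set _.
Proof.
have path_bij1 : path_bij 1%g = 1%g.
  apply: bijection_inj => w; rewrite path_bijE; last exact: subgroup1.
  exact: path_map1.
have genE b c (q : states AT) : gorg b = Oq -> state_of Op b = q -> (L : set _) c ->
    gactV a2 c.2 (gterm b) = Oq ->
    path_bij c = exist (fun f => `[< bijective f >]) (transducer q) (asboolT (inv q)).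
  move=> bO <- Lc cb; apply: bijection_inj => w.
  by rewrite path_bijE//= (transducer_path_map bO Lc cb).
apply/seteqP; split=> [_ [c Lc <-]|f].
  move=> S SP; have [v vE] : exists v, gactV a2 c.2 v = Oq.
    by exists (gactV a2 c.2^-1%g Oq); rewrite actKV.
  move: v c Lc vE; apply: connB => [c [Gc cO] cq|b IH c Lc cb].
    by rewrite (free Gc cO cq) path_bij1; exact: subgroup1.
  have [d Ld db] := stab_ex (gorg b) Oq.
  have Ldb : (L : set _) (c * d^-1)%g by apply: subgroupM => //; exact: subgroupV.
  rewrite -(mulgVK d c) path_bijM//; apply: subgroupM; last exact: IH.
  apply: SP; exists (state_of Op (gactE a2 d.2 b)) => //; apply/esym.
  apply: (genE _ _ _ _ erefl Ldb); first by rewrite gact_org.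
  by rewrite /gterm gact_inv gact_org -actM /= mulgVK.
have [S SE] : exists S : subgroup (bijection word), (S : set _) = path_bij @` L.
  unshelve eexists (@Subgroup _ (path_bij @` L) _ _ _) => //.
  - by exists 1%g; first exact: subgroup1.
  - move=> _ _ [c Lc <-] [d Ld <-]; exists (c * d)%g; first exact: subgroupM.
    exact: path_bijM.
  - move=> _ [c Lc <-]; exists c^-1%g; first exact: subgroupV.
    apply: (mulgI (path_bij c)); rewrite -path_bijM ?mulgV//; exact: subgroupV.
move=> /(_ S); rewrite SE; apply => _ [q _ <-].
have [b bO qE] := state_surj Op Oq q; have [c Lc cb] := stab_ex (gterm b) Oq.
by exists c => //; exact: genE bO qE Lc cb.
Qed.

Lemma automaton_group_iso (inv : invertible_automaton AT) :
  isomorphic (subgroup_type (automaton_group inv)) (subgroup_type L).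
Proof.
apply: (isomorphic_subgroups path_bijM path_bij_ker); exact: automaton_group_eq.
Qed.

End ProductAutomaton.

(** * Vertex stabilizers as lattices in the factors *)

Section StabilizerLattice.
Variables (R : realType) (p q : nat) (p_pr : prime p) (q_pr : prime q).
Local Notation Gp := (PGL3 (padic p_pr)).
Local Notation Gq := (PGL3 (padic q_pr)).
Local Notation actp := (bt_actV (@padic_ints p p_pr)).
Local Notation actq := (bt_actV (@padic_ints q q_pr)).
Variable Gamma : subgroup (Gp * Gq)%type.
Hypothesis free : forall c, (Gamma : set _) c -> forall u v,
  actp c.1 u = u -> actq c.2 v = v -> c = 1%g.
Hypothesis tr : forall u v u' v', exists2 c, (Gamma : set _) c &
  actp c.1 u = u' /\ actq c.2 v = v'.

Lemma prod_mulr_open (t : (Gp * Gq)%type) (W : set (Gp * Gq)%type) : open W ->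
  open [set s | W (s * t)%g].
Proof.
move=> oW.
have cp : continuous (fun s : Gp => (s * t.1)%g) by apply/continuousP => V; exact: PGL3_mulr_open.
have cq : continuous (fun s : Gq => (s * t.2)%g) by apply/continuousP => V; exact: PGL3_mulr_open.
rewrite openE => s Ws; have := open_nbhs_nbhs (conj oW Ws).
move=> [[V1 V2] /= [V1s V2s] sub]; exists ([set x | V1 (x * t.1)%g], [set x | V2 (x * t.2)%g]).
  by split; [exact: cp V1s|exact: cq V2s].
by move=> [x y] /= [xV yV]; apply: sub.
Qed.

Lemma fst_open (V : set Gp) : open V -> open [set s : (Gp * Gq)%type | V s.1].
Proof.
suff : continuous (fst : (Gp * Gq)%type -> Gp) by move=> /continuousP/(_ V).
by move=> s; exact: (@cvg_fst _ _ (nbhs s.1) (nbhs s.2)).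
Qed.

Lemma snd_open (V : set Gq) : open V -> open [set s : (Gp * Gq)%type | V s.2].
Proof.
suff : continuous (snd : (Gp * Gq)%type -> Gq) by move=> /continuousP/(_ V).
by move=> s; exact: (@cvg_snd _ _ (nbhs s.1) (nbhs s.2)).
Qed.

(** The open set of the push-forward consists of all pairs whose first component fixes [u].
    Discreteness comes from freeness: the open stabilizer of a vertex of the other building meets
    [H] in 1. *)
Lemma snd_stabilizer_lattice (H : subgroup Gq) u :
    (forall h, (H : set Gq) h <-> exists c, [/\ (Gamma : set _) c, actp c.1 u = u & h = c.2]) ->
  is_lattice R Gamma -> is_lattice R H.
Proof.
move=> HE lat; apply: (@lattice_pushforward R _ _ Gamma snd (fun h => (1%g, h))
  [set g | actp g.1 u = u] H) => //.
- exact: snd_open.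
- exact: prod_mulr_open.
- apply: (fst_open (V := [set s | actp s u = u])); exact: stabilizer_open.
- by move=> h g gu; change (actp (1 * g.1)%g u = u); rewrite mul1g.
- move=> g h gu hu; change (actp (g.1^-1 * h.1)%g u = u).
  by rewrite actM hu -{1}gu actK.
- move=> g; have [c Gc [cu _]] := tr u (vtx _ 1%g) (actp g.1^-1%g u) (vtx _ 1%g).
  by exists c => //; change (actp (g.1 * c.1)%g u = u); rewrite actM cu actKV.
exists [set h | actq h (vtx _ 1%g) = vtx _ 1%g]; first exact: stabilizer_open.
apply/seteqP; split=> [h [hv /HE[c [Gc cu hE]]]|_ ->].
  by rewrite hE (free Gc cu (v := vtx _ 1%g))// -hE.
by split; [exact: act1|exact: subgroup1].
Qed.

Lemma fst_stabilizer_lattice (H : subgroup Gp) v :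
    (forall h, (H : set Gp) h <-> exists c, [/\ (Gamma : set _) c, actq c.2 v = v & h = c.1]) ->
  is_lattice R Gamma -> is_lattice R H.
Proof.
move=> HE lat; apply: (@lattice_pushforward R _ _ Gamma fst (fun h => (h, 1%g))
  [set g | actq g.2 v = v] H) => //.
- exact: fst_open.
- exact: prod_mulr_open.
- apply: (snd_open (V := [set s | actq s v = v])); exact: stabilizer_open.
- by move=> h g gu; change (actq (1 * g.2)%g v = v); rewrite mul1g.
- move=> g h gu hu; change (actq (g.2^-1 * h.2)%g v = v).
  by rewrite actM hu -{1}gu actK.
- move=> g; have [c Gc [_ cv]] := tr (vtx _ 1%g) v (vtx _ 1%g) (actq g.2^-1%g v).
  by exists c => //; change (actq (g.2 * c.2)%g v = v); rewrite actM cv actKV.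
exists [set h | actp h (vtx _ 1%g) = vtx _ 1%g]; first exact: stabilizer_open.
apply/seteqP; split=> [h [hv /HE[c [Gc cv hE]]]|_ ->].
  by rewrite hE (free Gc _ cv (u := vtx _ 1%g))// -hE.
by split; [exact: act1|exact: subgroup1].
Qed.

End StabilizerLattice.

(** * Irreducibility *)

Program Definition swap_subgroup (G1 G2 : groupType) (H : subgroup (G1 * G2)%type) :
    subgroup (G2 * G1)%type :=
  @Subgroup (G2 * G1)%type [set x | (H : set _) (x.2, x.1)] _ _ _.
Next Obligation. by move=> G1 G2 H; exact: subgroup1. Qed.
Next Obligation. by move=> G1 G2 H x y Hx Hy; exact: (subgroupM Hx Hy). Qed.
Next Obligation. by move=> G1 G2 H x Hx; exact: (subgroupV Hx). Qed.

Lemma pair_mulg (G1 G2 : groupType) (x y : (G1 * G2)%type) :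
  (x * y)%g = (x.1 * y.1, x.2 * y.2)%g.
Proof. by []. Qed.

Lemma pair_invg (G1 G2 : groupType) (x : (G1 * G2)%type) : (x^-1)%g = (x.1^-1, x.2^-1)%g.
Proof. by []. Qed.

Section Fibre.
Variables (R : realType) (K : fieldTopologicalType) (O : set K) (pi : K) (F : finFieldType).
Variables (res : K -> F) (D : is_dvr O pi res).
Local Notation act := (bt_actV O).
Variables (G1 : groupType) (T1 : choiceType) (a1 : action G1 T1).
Variable Gamma : subgroup (G1 * PGL3 K)%type.
Hypothesis free : forall c, (Gamma : set _) c -> forall u v,
  a1 c.1 u = u -> act c.2 v = v -> c = 1%g.
Hypothesis tr : forall u v u' v', exists2 c, (Gamma : set _) c & a1 c.1 u = u' /\ act c.2 v = v'.
Variable u0 : T1.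

Local Notation L := (snd_subgroup (stabilizer Gamma (fst_action (PGL3 K) a1) u0)).

Lemma snd_stab_transitive x y : exists2 s, (L : set _) s & y = act s x.
Proof. by have [c Gc [cu <-]] := tr u0 x u0 y; exists c.2 => //; exists c. Qed.

Lemma snd_stab_free s : (L : set _) s -> forall x, act s x = x -> s = 1%g.
Proof. by move=> [c [Gc cu] <-] x cx; rewrite (free Gc cu cx). Qed.

Program Definition kernel_subgroup : subgroup (PGL3 K) :=
  @Subgroup (PGL3 K) [set h | (Gamma : set _) (1, h)%g] _ _ _.
Next Obligation. exact: subgroup1. Qed.
Next Obligation.
by move=> x y Hx Hy; have := subgroupM Hx Hy; rewrite pair_mulg /= mulg1.
Qed.
Next Obligation. by move=> x Hx; have := subgroupV Hx; rewrite pair_invg /= invg1. Qed.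

Hypothesis ker : exists2 h, (Gamma : set _) (1, h)%g & h <> 1%g.

(** In [stab_finite], the simply transitive group is the projection of a vertex stabilizer, and the
    larger group is the projection of all of [Gamma], which still normalizes the kernel. *)
Lemma kernel_stab_finite :
  finite_set ((snd_subgroup Gamma : set _) `&` [set s | act s (vtx O 1%g) = vtx O 1%g]).
Proof.
apply: (@stab_finite R K O pi F res D L kernel_subgroup) => //.
- exact: snd_stab_transitive.
- exact: snd_stab_free.
- by move=> n Gn; exists (1, n)%g => //; split=> //; exact: act1.
- by move=> s [c [Gc _] <-]; exists c.
- move=> s n [c Gc <-] Gn; have := subgroupM (subgroupM Gc Gn) (subgroupV Gc).
  by rewrite !pair_mulg /= mulg1 mulgV.
Qed.

Lemma kernel_cosets : exists s : seq (G1 * PGL3 K)%type,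
  (forall x, x \in s -> (Gamma : set _) x /\ act x.2 (vtx O 1%g) = vtx O 1%g) /\
  forall c, (Gamma : set _) c -> act c.2 (vtx O 1%g) = vtx O 1%g ->
    exists2 x, x \in s & exists2 n, (Gamma : set _) (n, 1)%g & c = (x * (n, 1))%g.
Proof.
have /finite_seqP[r rE] := kernel_stab_finite.
pose stab c := (Gamma : set _) c /\ act c.2 (vtx O 1%g) = vtx O 1%g.
pose rep h := if pselect (exists c, stab c /\ c.2 = h) is left e then sval (cid e) else 1%g.
have repP c : stab c -> stab (rep c.2) /\ (rep c.2).2 = c.2.
  by move=> cP; rewrite /rep; case: pselect => [e|[]]; [case: cid|exists c].
have rep_stab h : stab (rep h).
  rewrite /rep; case: pselect => [e|_]; first by case: cid => c [].
  by split; [exact: subgroup1|exact: act1].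
exists [seq rep h | h <- r]; split=> [_ /mapP[h _ ->]|c Gc cO]; first exact: rep_stab.
have [Gr rE2] := repP c (conj Gc cO).
exists (rep c.2).
  apply/map_f; have : [set` r] c.2 by rewrite -rE; split=> //; exists c.
  by [].
exists ((rep c.2).1^-1 * c.1)%g.
  have := subgroupM (subgroupV Gr.1) Gc.
  by rewrite pair_mulg /= rE2 mulVg.
by rewrite pair_mulg /= mulg1 mulVKg rE2; case: c {cO rE2 Gc Gr}.
Qed.

(** If the other kernel were trivial, [kernel_cosets] would make the stabilizer of a vertex finite,
    although it is transitive on the infinite set [T1]. One nontrivial kernel thus gives both. *)
Lemma kernel_other : (exists f : nat -> T1, injective f) ->
  exists2 n, (Gamma : set _) (n, 1)%g & n <> 1%g.
Proof.
move=> [f finj]; have [s [sG sP]] := kernel_cosets; apply: contrapT => no.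
have no1 n : (Gamma : set _) (n, 1)%g -> n = 1%g.
  by move=> Gn; apply: contrapT => n1; apply: no; exists n.
have : finite_set (range f).
  apply: (@sub_finite_set _ _ [set` [seq a1 x.1 u0 | x <- s]]); last exact: finite_seq.
  move=> _ [i _ <-]; have [c Gc [cu cv]] := tr u0 (vtx O 1%g) (f i) (vtx O 1%g).
  have [x xs [n /no1 -> cE]] := sP c Gc cv.
  by apply/mapP; exists x => //; rewrite -cu cE pair_mulg /= mulg1.
move=> /(finite_preimage (f := f) (in2W finj)) fin; apply: infinite_nat.
by apply: sub_finite_set fin => i _; exists i.
Qed.

End Fibre.

Section Commensurable.
Variables (G1 G2 : groupType) (T1 T2 : choiceType) (a1 : action G1 T1) (a2 : action G2 T2).
Variables (Gamma : subgroup (G1 * G2)%type) (o1 : T1) (o2 : T2).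
Hypothesis tr : forall u v u' v', exists2 c, (Gamma : set _) c & a1 c.1 u = u' /\ a2 c.2 v = v'.
Variables (L1 : subgroup G1) (L2 : subgroup G2).
Hypothesis L1E : forall g, (L1 : set _) g <->
  exists c, [/\ (Gamma : set _) c, a2 c.2 o2 = o2 & g = c.1].
Hypothesis L2E : forall g, (L2 : set _) g <->
  exists c, [/\ (Gamma : set _) c, a1 c.1 o1 = o1 & g = c.2].

(** The product of the two kernels lies in both groups, and finitely many of its cosets cover each
    of them. *)
Lemma kernels_commensurable (s1 s2 : seq (G1 * G2)%type) :
    (forall y, y \in s2 -> (Gamma : set _) y) ->
    (forall c, (Gamma : set _) c -> a2 c.2 o2 = o2 ->
      exists2 x, x \in s1 & exists2 n, (Gamma : set _) (n, 1)%g & c = (x * (n, 1))%g) ->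
    (forall c, (Gamma : set _) c -> a1 c.1 o1 = o1 ->
      exists2 y, y \in s2 & exists2 m, (Gamma : set _) (1, m)%g & c = (y * (1, m))%g) ->
  commensurable Gamma (prod_subgroup L1 L2).
Proof.
move=> s2G s1P s2P.
have NN n m : (Gamma : set _) (n, 1)%g -> (Gamma : set _) (1, m)%g ->
    ((Gamma : set _) `&` (prod_subgroup L1 L2 : set _)) (n, m).
  move=> Gn Gm; split.
    by have := subgroupM Gn Gm; rewrite pair_mulg /= mulg1 mul1g.
  by split; [apply/L1E; exists (n, 1%g)|apply/L2E; exists (1%g, m)]; split=> //; exact: act1.
split.
  exists [seq (x * y)%g | x <- s1, y <- s2] => c Gc.
  (* [d] fixes [o1] and sends [o2] to c^-1 o2, so c = (c d) d^-1 is a product of elements of the two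
     stabilizers. *)
  have [d Gd [du dv]] := tr o1 o2 o1 (a2 c.2^-1%g o2).
  have [|x xs [n Gn cdE]] := s1P (c * d)%g (subgroupM Gc Gd).
    by rewrite pair_mulg /= actM dv actKV.
  have [|y ys [m Gm dE]] := s2P d^-1%g (subgroupV Gd).
    by rewrite pair_invg /= -{1}du actK.
  exists (x * y)%g; first exact: (allpairs_f (fun x y => (x * y)%g) xs ys).
  (* Conjugation by [y] keeps the kernel element [(n, 1)] in the first kernel. *)
  have -> : ((x * y)^-1 * c = y^-1 * (n, 1) * y * (1, m))%g.
    by rewrite -[c](mulgK d) cdE dE invgM !mulgA mulgVK.
  have := subgroupM (subgroupM (subgroupV (s2G y ys)) Gn) (s2G y ys).
  rewrite !pair_mulg pair_invg /= !mulg1 !mulVg ?mul1g => Gnn.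
  exact: NN.
exists [seq (x.1, y.2) | x <- s1, y <- s2] => -[g h] [/= /L1E[c [Gc cO ->]] /L2E[d [Gd dO ->]]].
have [x xs [n Gn ->]] := s1P c Gc cO; have [y ys [m Gm ->]] := s2P d Gd dO.
exists (x.1, y.2); first exact: (allpairs_f (fun x y => (x.1, y.2)) xs ys).
by rewrite pair_invg pair_mulg /= !mulKg; exact: NN.
Qed.

End Commensurable.

Section Irreducible.
Variables (R : realType) (p q : nat) (p_pr : prime p) (q_pr : prime q).
Local Notation Gp := (PGL3 (padic p_pr)).
Local Notation Gq := (PGL3 (padic q_pr)).
Local Notation Op := (@padic_ints p p_pr).
Local Notation Oq := (@padic_ints q q_pr).
Local Notation actp := (bt_actV Op).
Local Notation actq := (bt_actV Oq).
Variable Gamma : subgroup (Gp * Gq)%type.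
Hypothesis free : forall c, (Gamma : set _) c -> forall u v,
  actp c.1 u = u -> actq c.2 v = v -> c = 1%g.
Hypothesis tr : forall u v u' v', exists2 c, (Gamma : set _) c &
  actp c.1 u = u' /\ actq c.2 v = v'.
Local Notation op := (vtx Op 1%g).
Local Notation oq := (vtx Oq 1%g).
Local Notation Gamma' := (swap_subgroup Gamma).
Local Notation Lq := (snd_subgroup (stabilizer Gamma (fst_action Gq actp) op)).
Local Notation Lp := (snd_subgroup (stabilizer Gamma' (fst_action Gp actq) oq)).

Lemma swap_free c : (Gamma' : set _) c -> forall u v,
  actq c.1 u = u -> actp c.2 v = v -> c = 1%g.
Proof. by move=> Gc u v cu cv; have [c2 c1] := free Gc cv cu; case: c {Gc cu cv} c1 c2 => ? ? /= -> ->. Qed.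

Lemma swap_tr u v u' v' : exists2 c, (Gamma' : set _) c & actq c.1 u = u' /\ actp c.2 v = v'.
Proof.
have [c Gc [cu cv]] := tr v u v' u'.
by exists (c.2, c.1) => //; case: c Gc {cu cv}.
Qed.

Lemma fst_stab_swapP g : (Lp : set _) g <->
  exists c, [/\ (Gamma : set _) c, actq c.2 oq = oq & g = c.1].
Proof.
split=> [[c [Gc cO] <-]|[c [Gc cO ->]]]; first by exists (c.2, c.1).
by exists (c.2, c.1) => //; split=> //; case: c Gc {cO}.
Qed.

Lemma snd_stabP g : (Lq : set _) g <->
  exists c, [/\ (Gamma : set _) c, actp c.1 op = op & g = c.2].
Proof. by split=> [[c [Gc cO] <-]|[c [Gc cO ->]]]; exists c. Qed.

Lemma reducible_commensurable : (exists2 h, (Gamma : set _) (1, h)%g & h <> 1%g) ->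
  commensurable Gamma (prod_subgroup Lp Lq).
Proof.
move=> ker.
have [sq [sqG sqP]] := kernel_cosets R (padic_dvr q_pr) free tr op ker.
have ker' : exists2 h, (Gamma' : set _) (1, h)%g & h <> 1%g.
  by have [n Gn n1] := kernel_other R (padic_dvr q_pr) free tr op ker (bt_infinite (padic_dvr p_pr)); exists n.
have [sp [spG spP]] := kernel_cosets R (padic_dvr p_pr) swap_free swap_tr oq ker'.
apply: (@kernels_commensurable _ _ _ _ actp actq Gamma op oq tr _ _ _ _ sq [seq (x.2, x.1) | x <- sp]).
- exact: fst_stab_swapP.
- exact: snd_stabP.
- by move=> _ /mapP[x /spG[Gx _] ->].
- exact: sqP.
move=> c Gc cO; have [|x xs [n Gn cE]] := spP (c.2, c.1) _ cO.
  by case: c Gc {cO}.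
exists (x.2, x.1); first exact: (map_f (fun x => (x.2, x.1)) xs).
exists n => //; case: c {Gc cO} cE => c1 c2 /= E.
by have := congr1 (fun x => (x.2, x.1)) E.
Qed.

Lemma irreducible_kernel : irreducible_lattice R Gamma ->
  forall h, (Gamma : set _) (1, h)%g -> h = 1%g.
Proof.
move=> [lat irr] h Gh; apply: contrapT => h1; apply: irr; exists Lp, Lq; split.
- exact: (fst_stabilizer_lattice free tr fst_stab_swapP lat).
- exact: (snd_stabilizer_lattice free tr snd_stabP lat).
- by apply: reducible_commensurable; exists h.
Qed.

End Irreducible.

(** * Transport of property (T) and conclusion *)

Lemma isomorphic_sym (G H : groupType) : isomorphic G H -> isomorphic H G.
Proof.
move=> [f [g fK gK]].
have gM : {morph g : x y / (x * y)%g >-> (x * y)%g}.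
  by move=> x y; apply: (can_inj fK); rewrite gK gmulfM !gK.
pose gm := isMultiplicative.Build H G g gM.
by exists (HB.pack g gm : {multiplicative H -> G}); exists f.
Qed.

Lemma property_T_isomorphic (R : realType) (G H : groupType) :
  isomorphic G H -> property_T R G -> property_T R H.
Proof.
move=> [f [g fK gK]] [s [e [e0 sP]]]; exists [seq f x | x <- s], e; split=> //.
move=> V dot cV rho [v v0 vs].
have f1 : f 1%g = 1%g by apply: (mulgI (f 1%g)); rewrite -gmulfM !mulg1.
have rho1 : rho (f 1%g) =1 id by rewrite f1; exact: rep1.
have rhoM x y w : rho (f (x * y)%g) w = rho (f x) (rho (f y) w) by rewrite gmulfM repM.
pose rhof : unitary_rep G dot := UnitaryRep rho1 rhoM (fun x => rep_dot rho (f x)).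
have [|w w0 wE] := sP V dot cV rhof.
  by exists v => // x xs; apply: vs; exact: map_f.
by exists w => // h; rewrite -(gK h); exact: wE.
Qed.

Section BuildingGraph.
Variables (p : nat) (p_pr : prime p).
Local Notation D := (padic_dvr p_pr).
Local Notation X := (Delta1 p_pr).

Lemma Delta1_ginvK : involutive (@ginv X).
Proof. by move=> [[x y] xy]; exact: val_inj. Qed.

Lemma Delta1_ginv_neq (e : gE X) : ginv e <> e.
Proof.
move=> /(congr1 (fun e : gE X => (val e).1)) /= E.
by have := valP e; rewrite E => /(adj_irrefl D).
Qed.

Lemma Delta1_star_finite (u : gV X) : finite_set [set e : gE X | gorg e = u].
Proof.
have fin : finite_set [set (u, y) | y in [set y | bt_adj p%:R u y]].
  exact/finite_image/(adj_finite D).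
apply: sub_finite_set (finite_preimage (f := val : gE X -> _) (in2W val_inj) fin).
by move=> [[x y] xy] /= <-; exists y.
Qed.

Lemma Delta1_connected (o : gV X) (P : gV X -> Prop) : P o ->
  (forall e : gE X, P (gorg e) -> P (gorg (ginv e))) -> forall u, P u.
Proof.
move=> Po PP; apply: (bt_connected_from D Po) => y z yz.
exact: (PP (exist (fun e => bt_adj p%:R e.1 e.2) (y, z) yz)).
Qed.

End BuildingGraph.

Theorem proposition3p7 (R : realType) (p q : nat)
    (p_pr : prime p) (q_pr : prime q)
    (Gamma : subgroup (PGL3 (padic p_pr) * PGL3 (padic q_pr))%type) :
  irreducible_lattice R Gamma ->
  vertex_transitive Gamma (building_product_action p_pr q_pr) ->
  free_on_cells Gamma (building_product_action p_pr q_pr) ->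
  exists (SigmaP : finite_VHT1_complex (Sigma Gamma))
         (AT_inv : invertible_automaton (automaton_T SigmaP)),
    (forall Op : gV (Delta1 p_pr),
      [/\ isomorphic (subgroup_type (automaton_group AT_inv))
                     (subgroup_type (stabilizer_p Gamma Op)),
          {in (stabilizer_p Gamma Op : set _) &, injective snd} &
          is_lattice R (snd_subgroup (stabilizer_p Gamma Op))]) /\
    property_T R (subgroup_type (automaton_group AT_inv)).
Proof.
move=> irr vtr cfree.
pose actp := gactV (Delta1_action p_pr); pose actq := gactV (Delta1_action q_pr).
have free c : (Gamma : set _) c -> forall u v, actp c.1 u = u -> actq c.2 v = v -> c = 1%g.
  move=> Gc u v cu cv; apply: contrapT => c1.
  by have [/(_ (u, v)) + _ _] := cfree c Gc c1; apply; congr pair.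
have tr u v u' v' : exists2 c, (Gamma : set _) c & actp c.1 u = u' /\ actq c.2 v = v'.
  have [c Gc cE] := vtr (u, v) (u', v').
  by exists c => //; split; [exact: (congr1 fst (esym cE))|exact: (congr1 snd (esym cE))].
have faith c : (Gamma : set _) c -> (forall u, actp c.1 u = u) -> c = 1%g.
  move=> Gc /(bt_faithful (padic_dvr p_pr)) c1.
  (* Irreducibility enters here: [Gamma] acts faithfully on the first building. *)
  have c2 : c.2 = 1%g.
    by apply: (irreducible_kernel free tr irr); rewrite -c1; case: c Gc {c1}.
  by case: c c1 c2 {Gc} => ? ? /= -> ->.
pose op : gV (Delta1 p_pr) := vtx (@padic_ints p p_pr) 1%g.
pose oq : gV (Delta1 q_pr) := vtx (@padic_ints q q_pr) 1%g.
have SP : finite_VHT1_complex (Sigma Gamma).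
  apply: (quotient_finite_VHT1 (v := (op, oq)) cfree _ vtr).
  - apply: graph_prod_VHT; [exact: Delta1_ginvK|exact: Delta1_ginvK|
      exact: Delta1_ginv_neq|exact: Delta1_ginv_neq].
  - by apply: graph_prod_finE; exact: Delta1_star_finite.
  - by apply: graph_prod_finS; exact: Delta1_star_finite.
have inv : invertible_automaton (automaton_T SP).
  exact: (automaton_T_invertible (@Delta1_ginvK p p_pr) free tr op oq).
have iso Op : isomorphic (subgroup_type (automaton_group inv))
    (subgroup_type (stabilizer_p Gamma Op)).
  apply: (automaton_group_iso (@Delta1_ginvK p p_pr) free tr (Oq := oq)) => //.
  - exact: Delta1_connected.
  - exact: Delta1_connected.
have sndI Op c d : (stabilizer_p Gamma Op : set _) c -> (stabilizer_p Gamma Op : set _) d ->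
    c.2 = d.2 -> c = d.
  move=> Sc Sd cd; have [Gcd cdO] := subgroupM (subgroupV Sc) Sd.
  apply/esym/(mulgI c^-1%g); rewrite mulVg.
  apply: (free _ Gcd Op oq cdO).
  by rewrite [_.2](_ : _ = 1%g) ?act1// pair_mulg pair_invg /= cd mulVg.
exists SP, inv; split=> [Op|].
  split; first exact: iso.
    by move=> c d /set_mem Sc /set_mem Sd; exact: sndI Sc Sd.
  apply: (snd_stabilizer_lattice free tr (u := Op)) irr.1 => h.
  by split=> [[c [Gc cO] <-]|[c [Gc cO ->]]]; exists c.
(* Property (T) is established for the projection to the second factor, simply transitive on the
   vertices of its building, and is carried back through two isomorphisms. *)
apply: (property_T_isomorphic (isomorphic_sym (iso op))).
have sndiso : isomorphic (subgroup_type (snd_subgroup (stabilizer_p Gamma op)))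
    (subgroup_type (stabilizer_p Gamma op)).
  apply: (isomorphic_subgroups (f := snd)) => // c Sc c1.
  by apply: (sndI op) Sc (subgroup1 _) c1.
apply: (property_T_isomorphic sndiso).
apply: (building_property_T R (padic_dvr q_pr)).
  exact: (snd_stab_transitive tr).
exact: (snd_stab_free free).
Qed.
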